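(* Let $d\ge 1$, $L>0$, and let $W,\Phi,B$ satisfy the following assumption: there exists $m\in\mathbb{N}$ with $2m>d$ and $W\in H^m_S(\mathbb{T}^d)$; $\Phi$ is continuous on $\mathbb{R}$, $C^3$ on $\mathbb{R}\setminus\{0\}$, increasing on $\mathbb{R}_+$, and $\Phi\equiv 0$ on $\mathbb{R}_-$; $B>0$; and $W_0=\int_{\mathbb{T}^d}W(y)\,dy<0$. Let $r^1,r^2,r^3,r^4$ be coordinate-wise even shifts. Let $\kappa\in\left(\frac{2|W_0|^2}{L^{2d}\pi B^2},+\infty\right)$. If there exists a unique $k^*\in\mathbb{N}^d$ such that $$\frac{\tilde W(k^* )}{\Theta(k^* )}\cdot\frac14\sum_{\beta=1}^4\prod_{i=1}^d\cos\left(\frac{2\pi k_i^*}{L}r_i^\beta\right)=\frac{1}{L^{d/2}(\Phi_0^{\kappa})'\left(\frac1{L^d}-L^d\bar\rho_\infty^{\kappa}\left(\bar\rho_\infty^{\kappa}-\frac{\Phi_0^{\kappa}}{L^d}\right)\kappa\right)}$$ and $(\Phi_0^\kappa)''\ge0$, then $(m_\infty^\kappa,\kappa)=(W_0\bar\rho_\infty^\kappa,\kappa)$ is a bifurcation point of $\mathcal{Q}(m,\kappa)=0$.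
   Context: $\mathbb{N}=\{0,1,\dots\}$ and $\mathbb{T}^d=\mathbb{R}^d/(L\mathbb{Z})^d$. $L^2_S(\mathbb{T}^d)$ is the Hilbert space of $u\in L^2(\mathbb{T}^d)$ that are even in each coordinate separately, and $H^m_S(\mathbb{T}^d)=H^m(\mathbb{T}^d)\cap L^2_S(\mathbb{T}^d)$. The convolution is $u*v(x)=\int_{\mathbb{T}^d}u(x-y)v(y)\,dy$. For $k\in\mathbb{N}^d$, $\Theta(k)=\prod_{i=1}^d\sqrt{2-\delta_{k_i,0}}$ (Kronecker delta), $\omega_k(x)=\frac{\Theta(k)}{L^{d/2}}\prod_{i=1}^d\cos\left(\frac{2\pi k_i}{L}x_i\right)$, and $\tilde W(k)=\int_{\mathbb{T}^d}W(x)\omega_k(x)\,dx$. The four component model, for $\beta=1,2,3,4$ with noise $\sigma=1/\kappa$ and constant input $B$, is $$\tau\partial_t\rho^\beta=-\partial_s\big([\Phi^\beta(x,t)-s]\rho^\beta\big)+\sigma\,\partial_s^2\rho^\beta,\qquad \Phi^\beta(x,t)=\Phi\Big(\frac14\sum_{\beta'=1}^4\int_{\mathbb{T}^d}W^{\beta'}(x-y)\int_0^\infty s\rho^{\beta'}(y,s,t)\,ds\,dy+B\Big),$$ with $x\in\mathbb{T}^d$, $s\ge0$, no-flux boundary conditions at $s=0$ and $\int_0^\infty\rho^\beta(x,s,t)\,ds=L^{-d}$, where $W^\beta(x)=W(x-r^\beta)$ with shifts $r^\beta=(r^\beta_1,\dots,r^\beta_d)$. The shifts are called coordinate-wise even if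 the family $\{r^1,\dots,r^4\}$ (counted with multiplicity, modulo $L\mathbb{Z}^d$) is invariant under changing the sign of any single coordinate. For stationary states with averages $\bar\rho^\beta(x)=\int_0^\infty s\rho^\beta(x,s)\,ds$, the quantity $m=\frac14\sum_\beta W^\beta*\bar\rho^\beta$ is a zero of $$\mathcal{Q}(m,\kappa)=m-\frac14\sum_{\beta=1}^4W^\beta*\left(\frac{\int_0^\infty s\,e^{-\kappa(s-\Phi(m+B))^2/2}\,ds}{L^d\int_0^\infty e^{-\kappa(s-\Phi(m+B))^2/2}\,ds}\right).$$ For each $\kappa>0$, $\bar\rho_\infty^\kappa>0$ is the average of the unique spatially homogeneous stationary state (existence and uniqueness are known), i.e. the unique constant $y$ such that $$y=\frac{\int_0^\infty s\,e^{-\kappa(s-\Phi(W_0y+B))^2/2}\,ds}{L^d\int_0^\infty e^{-\kappa(s-\Phi(W_0y+B))^2/2}\,ds}.$$ Notation: $\Phi_0^\kappa=\Phi(W_0\bar\rho_\infty^\kappa+B)$, $(\Phi_0^\kappa)'=\Phi'(W_0\bar\rho_\infty^\kappa+B)$, $(\Phi_0^\kappa)''=\Phi''(W_0\bar\rho_\infty^\kappa+B)$. A bifurcation point of $\mathcal{Q}=0$ is a point of the curve $\{(W_0\bar\rho_\infty^\kappa,\kappa)\}$ at which a second, nontrivial, continuously differentiable curve of solutions of $\mathcal{Q}(m,\kappa)=0$ in $L^2_S(\mathbb{T}^d)\times(0,\infty)$ crosses it. *)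

(* Defs.v *)
From HB Require Import structures.
From mathcomp Require Import all_boot all_order all_algebra all_fingroup.
From mathcomp Require Import all_classical all_reals all_analysis.

Set Implicit Arguments.
Unset Strict Implicit.
Unset Printing Implicit Defensive.

Import Order.TTheory GRing.Theory Num.Theory.
Import numFieldNormedType.Exports.

Local Open Scope classical_set_scope.
Local Open Scope ring_scope.

(* The product (equivalently, Borel) sigma-algebra on R^n. *)
Section measurable_rV.
Context (R : realType) (n : nat).

Let coord_fun (i : 'I_n) (x : 'rV[R]_n) : measurableTypeR R := x ord0 i.

Let rV_set0 : g_sigma_preimage coord_fun set0.
Proof. exact: sigma_algebra0. Qed.

Let rV_setC A : g_sigma_preimage coord_fun A ->
  g_sigma_preimage coord_fun (~` A).
Proof. exact: sigma_algebraC. Qed.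

Let rV_bigcup (F : (set 'rV[R]_n)^nat) :
  (forall i, g_sigma_preimage coord_fun (F i)) ->
  g_sigma_preimage coord_fun (\bigcup_i (F i)).
Proof. exact: sigma_algebra_bigcup. Qed.

HB.instance Definition _ := @isMeasurable.Build default_measure_display
  'rV[R]_n (g_sigma_preimage coord_fun) rV_set0 rV_setC rV_bigcup.

Lemma measurable_coord_rV (i : 'I_n) :
  measurable_fun [set: 'rV[R]_n]
    ((fun x => x ord0 i) : 'rV[R]_n -> measurableTypeR R).
Proof.
move=> _ Y mY; rewrite setTI; apply: sub_sigma_algebra => /=.
rewrite -bigcup_seq/=; exists i => /=; first by rewrite mem_index_enum.
by exists Y => //; rewrite setTI.
Qed.

Lemma measurable_fun_rVP d1 (T1 : measurableType d1) (f : T1 -> 'rV[R]_n) :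
  measurable_fun [set: T1] f <->
  forall i, measurable_fun [set: T1]
    ((fun x => f x ord0 i) : T1 -> measurableTypeR R).
Proof.
apply: (@iff_trans _ (g_sigma_preimage (fun i => coord_fun i \o f)
  `<=` measurable)).
  rewrite g_sigma_preimage_comp; split=> [mf A [/= C preC <-]|prefS].
    exact: mf.
  by move=> _ A mA; apply: prefS; exists A.
split=> [cfS i|mf].
- move=> _ A mA; apply: cfS; apply: sub_sigma_algebra.
  rewrite -bigcup_seq/=; exists i => /=; first by rewrite mem_index_enum.
  by exists A.
- apply: smallest_sub; first exact: sigma_algebra_measurable.
  rewrite -bigcup_seq; apply: bigcup_sub => i _.
  by move=> A [C mC <-]; exact: mf.
Qed.

End measurable_rV.

Section torus_measure.
Context (R : realType).
Variable L : R.

(* Lebesgue measure on the circle, i.e. on the period [0, L). *)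
Definition circle_measure : set (measurableTypeR R) -> \bar R :=
  mrestr (@lebesgue_measure R) (measurable_itv `[0%R, L[).

HB.instance Definition _ := Measure.on circle_measure.

Lemma circle_measure_fin : fin_num_fun circle_measure.
Proof.
apply: lty_fin_num_fun => /=; rewrite /circle_measure /mrestr setTI.
by rewrite lebesgue_measure_itv/=; case: ifP => _; rewrite ?ltry.
Qed.

HB.instance Definition _ :=
  Measure_isFinite.Build _ _ _ circle_measure circle_measure_fin.

Definition cons_rV n (p : measurableTypeR R * 'rV[R]_n) : 'rV[R]_n.+1 :=
  row_mx (p.1%:M : 'rV[R]_1) p.2.

Lemma measurable_cons_rV n : measurable_fun setT (@cons_rV n).
Proof.
apply/measurable_fun_rVP => i.
rewrite /cons_rV; case: (@splitP 1 n i) => [j ij|k ik].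
- rewrite (_ : (fun x => _) = fst); first exact: measurable_fst.
  apply/funext => p; rewrite (_ : i = lshift n j); last exact/val_inj.
  by rewrite [LHS](@row_mxEl _ 1 1 n) mxE (ord1 j) eqxx mulr1n.
- rewrite (_ : (fun x => _) = (fun x : 'rV[R]_n => x ord0 k) \o snd).
    apply: measurableT_comp; last exact: measurable_snd.
    exact: measurable_coord_rV.
  apply/funext => p; rewrite (_ : i = rshift 1 k); last exact/val_inj.
  by rewrite [LHS](@row_mxEr _ 1 1 n).
Qed.

Section step.
Variables (n : nat) (nu : {finite_measure set 'rV[R]_n -> \bar R}).

Definition torus_step : set 'rV[R]_n.+1 -> \bar R :=
  pushforward (circle_measure \x nu)%E (@cons_rV n).

Let torus_step0 : torus_step set0 = 0%E.
Proof. by rewrite /torus_step /pushforward preimage_set0 measure0. Qed.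

Let torus_step_ge0 A : (0 <= torus_step A)%E.
Proof. exact: (measure_ge0 (circle_measure \x nu)%E). Qed.

Let torus_step_sigma_additive : semi_sigma_additive torus_step.
Proof.
move=> F mF tF mUF; rewrite /torus_step /pushforward preimage_bigcup.
apply: measure_semi_sigma_additive.
- by move=> k; rewrite -[X in measurable X]setTI; exact: measurable_cons_rV.
- apply/trivIsetP => /= i j _ _ ij; rewrite -preimage_setI.
  by move/trivIsetP : tF => /(_ _ _ _ _ ij) ->//; rewrite preimage_set0.
- by rewrite -preimage_bigcup -[X in measurable X]setTI;
    exact: measurable_cons_rV.
Qed.

HB.instance Definition _ := isMeasure.Build _ _ _ torus_step
  torus_step0 torus_step_ge0 torus_step_sigma_additive.

Let torus_step_fin : fin_num_fun torus_step.
Proof.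
apply: lty_fin_num_fun => /=.
rewrite /torus_step /pushforward preimage_setT -setXTT.
rewrite product_measure1E// lte_mul_pinfty ?measure_ge0//.
- exact: (fin_num_measure circle_measure).
- by rewrite -ge0_fin_numE ?measure_ge0//; exact: fin_num_measure.
Qed.

HB.instance Definition _ :=
  Measure_isFinite.Build _ _ _ torus_step torus_step_fin.

End step.

(* The torus T^n = R^n / (L Z)^n carries the Lebesgue measure of the cell
   [0, L)^n; functions on T^n are encoded as (L Z)^n-periodic functions on R^n
   (see [periodic]), and only their values on the cell are integrated. *)
Fixpoint torus_measure n : {finite_measure set 'rV[R]_n -> \bar R} :=
  match n with
  | 0%N => \d_(0 : 'rV[R]_0)
  | k.+1 => torus_step (torus_measure k)
  end.

End torus_measure.

Section torus_functions.
Context (R : realType) (d : nat).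
Variable L : R.
Local Notation T := 'rV[R]_d.
Local Notation mu := (torus_measure L d).
Implicit Types (u v : T -> R) (x : T) (i : 'I_d).

Definition unit_vec i : T := delta_mx ord0 i.

Definition periodic u := forall i x, u (x + L *: unit_vec i) = u x.

(* Elements of L^2(T^d) are handled through representatives; equality in
   L^2(T^d) is equality mu-almost everywhere. *)
Definition L2 u := periodic u /\ u \in Lfun mu 2%:E.

Definition flip i x : T :=
  \row_j (if j == i then - x ord0 j else x ord0 j).

Definition L2S u :=
  L2 u /\ forall i, {ae mu, forall x, u (flip i x) = u x}.

Definition L2norm u : \bar R := 'N[mu]_2%:E[EFin \o u]%E.

Definition partial i u : T -> R := fun x => 'D_(unit_vec i) u x.

Definition partials (s : seq 'I_d) u : T -> R := foldr partial u s.

Definition smooth u := forall s : seq 'I_d, continuous (partials s u) /\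
  forall i x, derivable (partials s u) x (unit_vec i).

(* H^m(T^d): all weak derivatives of order at most m are in L^2(T^d); the
   multi-index of a derivative is given as a list of coordinates. *)
Definition Hm (m : nat) u := L2 u /\
  forall s : seq 'I_d, (size s <= m)%N -> exists2 g, L2 g &
    forall phi, periodic phi -> smooth phi ->
      \int[mu]_x (u x * partials s phi x) =
      (-1) ^+ size s * \int[mu]_x (g x * phi x).

Definition HmS (m : nat) u := Hm m u /\ L2S u.

Definition convolution u v : T -> R := fun x => \int[mu]_y (u (x - y) * v y).

Definition Theta (k : {ffun 'I_d -> nat}) : R :=
  \prod_i Num.sqrt (2 - (k i == 0%N)%:R).

Definition omega (k : {ffun 'I_d -> nat}) : T -> R := fun x =>
  Theta k / L `^ (d%:R / 2) *
  \prod_i cos (2 * pi * (k i)%:R / L * x ord0 i).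

Definition cos_coef u (k : {ffun 'I_d -> nat}) : R :=
  \int[mu]_x (u x * omega k x).

(* Invariance of the family (r_1, ..., r_4), with multiplicity and modulo
   L Z^d, under each single sign change. *)
Definition coordinatewise_even (r : 'I_4 -> T) :=
  forall i, exists s : {perm 'I_4}, forall b, exists z : 'rV[int]_d,
    flip i (r b) = r (s b) + L *: map_mx intr z.

End torus_functions.

(* f is C^n on the (open) set A *)
Definition class_C (R : realType) (n : nat) (f : R -> R) (A : set R) :=
  forall x, A x ->
    (forall k, (k < n)%N -> derivable (f^`(k))%classic x 1) /\
    {for x, continuous (f^`(n))%classic}.

Section model.
Context (R : realType) (d : nat).
Variable L : R.
Local Notation T := 'rV[R]_d.
Local Notation mu := (torus_measure L d).
Local Notation leb := (@lebesgue_measure R).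
Variables (W : T -> R) (Phi : R -> R) (B : R).

Definition W0 : R := \int[mu]_x W x.

(* Average of the stationary density with noise 1 / kappa and input phi,
   whose total mass is L^-d. *)
Definition stat_avg (kappa phi : R) : R :=
  (\int[leb]_(s in `[0, +oo[) (s * expR (- (kappa * (s - phi) ^+ 2 / 2)))) /
  (L ^+ d * \int[leb]_(s in `[0, +oo[) expR (- (kappa * (s - phi) ^+ 2 / 2))).

(* The unique constant y solving the fixed point equation ([xget] picks an
   element of the set of solutions, which is a singleton). *)
Definition rho_inf (kappa : R) : R :=
  xget 0 [set y : R | y = stat_avg kappa (Phi (W0 * y + B))].

Definition m_inf (kappa : R) : R := W0 * rho_inf kappa.

Variable r : 'I_4 -> T.

Definition local_avg (m : T -> R) (kappa : R) : T -> R :=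
  fun y => stat_avg kappa (Phi (m y + B)).

Definition Q (m : T -> R) (kappa : R) : T -> R := fun x =>
  m x - 4^-1 * \sum_(b < 4)
    convolution L (fun z => W (z - r b)) (local_avg m kappa) x.

(* Q(m, kappa) = 0 in L^2_S. As the integral is a total operator, the
   integrability of the second factor of the convolutions is required
   explicitly. *)
Definition Q_zero (m : T -> R) (kappa : R) :=
  [/\ L2S L m, mu.-integrable setT (EFin \o local_avg m kappa) &
      {ae mu, forall x, Q m kappa x = 0}].

(* The map u : (-e, e) -> L^2_S is continuously differentiable, with
   derivative u', for the L^2 norm. *)
Definition C1_L2S (e : R) (u u' : R -> T -> R) := forall s, `|s| < e ->
  [/\ L2S L (u s), L2S L (u' s),
      L2norm L (h^-1 *: (u (s + h) - u s) - u' s) @[h --> 0^'] --> 0%E &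
      L2norm L (u' t - u' s) @[t --> s] --> 0%E].

(* (m, kappa) lies on the curve {(m_inf, kappa)}, and a second C^1 curve of
   solutions s |-> (u s, l s), |s| < e, crosses it there: it passes through
   (m, kappa) at s = 0, is off the trivial curve for s != 0, and its velocity
   at s = 0 is not a multiple of the velocity (m_inf', 1) of the trivial
   curve (in particular it does not vanish). *)
Definition bifurcation_point (m : T -> R) (kappa : R) :=
  [/\ 0 < kappa, {ae mu, forall x, m x = m_inf kappa} &
   exists e : R, 0 < e /\ exists (u u' : R -> T -> R) (l : R -> R),
    [/\ C1_L2S e u u' /\ class_C 1 l [set s | `|s| < e],
        forall s, `|s| < e -> 0 < l s /\ Q_zero (u s) (l s),
        l 0 = kappa /\ {ae mu, forall x, u 0 x = m x},
        forall s, `|s| < e -> s != 0 ->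
          ~ {ae mu, forall x, u s x = m_inf (l s)} &
        ~ {ae mu, forall x, u' 0 x = (l^`())%classic 0 * (m_inf^`())%classic kappa}]].

End model.

(* Main.v *)
(* Crandall-Rabinowitz bifurcation, by hand. With alpha = sqrt kappa, the
   stationary average for the input phi is tmean (alpha phi) / (alpha L^d), where
   tmean mu is the mean of the normal law N(mu, 1) conditioned to be nonnegative.
   The averaged kernel acts on even functions as a Fourier multiplier in the
   cosine basis, and the hypothesis on k* says that its product with the slope c of
   the response equals 1 for the mode k* only. Sampford's inequality tmean'' > 0
   together with Phi'' >= 0 makes c strictly increasing in alpha along the
   homogeneous branch, which is the transversality condition.
   Writing the second solution as m + s w with <w, omega k*> = 1 and dividing the
   equation by s, the Lyapunov-Schmidt reduction is a fixed point problem for alpha,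
   m and w which contracts for the sup norm on bounded even functions: the modes
   that are not inverted explicitly contribute little because cosine polynomials
   are dense in the even L^2 functions. *)
From HB Require Import structures.
Require Import Defs.
From mathcomp Require Import all_boot all_order all_algebra all_fingroup.
From mathcomp Require Import all_classical all_reals all_analysis.
From mathcomp Require Import measurable_realfun.
From mathcomp Require Import ring lra.

Set Implicit Arguments.
Unset Strict Implicit.
Unset Printing Implicit Defensive.

Import Order.TTheory GRing.Theory Num.Theory.
Import numFieldNormedType.Exports.

Local Open Scope classical_set_scope.
Local Open Scope ring_scope.

(** * Curves of fixed points *)

(** The obstacle is that a superposition operator sending m to h(m) is not differentiable on L^2
    unless h is affine, and that Phi is smooth only away from 0. All estimates are therefore uniform
    in x, with inputs kept in [a / 2, 2 a] around the homogeneous input a, which the lower bound on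
    kappa makes positive. Dividing by s costs one derivative: C^3 for Phi leaves an equation with
    Lipschitz gradient. Hence the calculus of C^{1,1} bounds, stable under products, composition and
    integration in a parameter, which feeds a fixed point theorem with quantitative conclusions. No
    Banach space is built. Sup distances are inequalities holding at every point, and membership is
    a predicate closed under linear combinations and pointwise limits, which carries measurability,
    periodicity and evenness together. The link between the two norms is that the torus has finite
    measure: a kernel small in L^2 gives a convolution operator small for the sup norm. *)

Section contraction.
Context (R : realType) (I : Type).
Implicit Types (f g y : I -> R) (C D r : R).

(** A relation rather than a number: no supremum is taken, so unbounded functions need no separate
    treatment. *)
Definition dist_le f g C := forall i, `|f i - g i| <= C.

Lemma dist_le_sym f g C : dist_le f g C -> dist_le g f C.
Proof. by move=> fg i; rewrite distrC. Qed.

Lemma dist_le_trans f g h C D :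
  dist_le f g C -> dist_le g h D -> dist_le f h (C + D).
Proof.
move=> fg gh i; rewrite -(subrKA (g i)).
by rewrite (le_trans (ler_normD _ _))// lerD.
Qed.

Lemma le_dist_le f g C D : C <= D -> dist_le f g C -> dist_le f g D.
Proof. by move=> CD fg i; exact: le_trans CD. Qed.

Lemma dist_lexx f C : 0 <= C -> dist_le f f C.
Proof. by move=> C0 i; rewrite subrr normr0. Qed.

Lemma cvg_geometric_half C : (C / 2 ^+ n) @[n --> \oo] --> (0 : R).
Proof.
under eq_fun => n do rewrite -exprVn.
by apply: cvg_geometric; rewrite ger0_norm ?invr_ge0// invf_lt1// ltr1n.
Qed.

Lemma le_of_halving (x C : R) : (forall n, x <= C / 2 ^+ n) -> x <= 0.
Proof.
move=> xC; apply: (cvgr_to_ge (@cvg_geometric_half C)).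
exact: nearW.
Qed.

(** Absorption argument: iterating C -> C / 2 + D from any a priori bound drives it to the fixed
    point 2 D. The iteration has to start from some finite bound, so each application supplies a
    crude one. *)
Lemma dist_le_halving f g C D :
  (forall C, 0 <= C -> dist_le f g C -> dist_le f g (C / 2 + D)) ->
  0 <= C -> 0 <= D -> dist_le f g C -> dist_le f g (2 * D).
Proof.
move=> H C0 D0 fgC.
have fgn n : dist_le f g (2 * D + C / 2 ^+ n).
  elim: n => [|n /H IH]; first by apply: le_dist_le fgC; rewrite expr0; lra.
  have C2 : 0 <= C / 2 ^+ n by rewrite divr_ge0// exprn_ge0.
  apply: le_dist_le (IH _); last by lra.
  by rewrite exprS invfM mulrA (mulrAC C); lra.
move=> i; rewrite -subr_le0; apply: (@le_of_halving _ C) => n.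
by rewrite lerBlDl fgn.
Qed.

Variable good : (I -> R) -> Prop.
Hypothesis good_lim : forall (u : nat -> I -> R) (l : I -> R), (forall n, good (u n)) ->
  (forall i, u n i @[n --> \oo] --> l i) -> good l.

(** Banach's theorem on a ball: the displacement r / 2 of the center keeps the iterates inside.
    Completeness is that of R at each point, and [good_lim] keeps the limit in the class. *)
Lemma contraction_fixed (Psi : (I -> R) -> I -> R) y0 r : 0 <= r -> good y0 ->
  (forall y, good y -> dist_le y y0 r -> good (Psi y)) ->
  (forall y y' C, good y -> good y' -> dist_le y y0 r -> dist_le y' y0 r ->
     0 <= C -> dist_le y y' C -> dist_le (Psi y) (Psi y') (C / 2)) ->
  dist_le (Psi y0) y0 (r / 2) ->
  exists y, [/\ good y, dist_le y y0 r & forall i, Psi y i = y i].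
Proof.
move=> r0 g0 gPsi cPsi dPsi; pose u n := iter n Psi y0.
have uB n : good (u n) /\ dist_le (u n) y0 r.
  elim: n => [|n [gu du]]; first by split => //; exact: dist_lexx.
  split; first exact: gPsi.
  rewrite (splitr r); apply: dist_le_trans dPsi.
  by apply: cPsi => //; exact: dist_lexx.
have ud n k : dist_le (u (n + k)%N) (u n) (r / 2 ^+ n).
  elim: n => [|n IH]; first by rewrite expr0 divr1; exact: (uB _).2.
  rewrite exprSr invfM mulrA.
  have [? ?] := uB (n + k)%N; have [? ?] := uB n.
  by apply: cPsi => //; rewrite divr_ge0// exprn_ge0.
have ulim i : exists l : R, u n i @[n --> \oo] --> l.
  suff : cvgn (fun n => u n i) by move=> /cvg_ex[l ul]; exists l.
  apply/cauchy_cvgP/cauchy_exP => e e0.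
  have /cvgrPdist_lt/(_ _ e0)[N _ /(_ N (leqnn N))] := @cvg_geometric_half r.
  rewrite sub0r normrN ger0_norm ?divr_ge0 ?exprn_ge0// => rN.
  exists (u N i); exists N => // n /= Nn; rewrite /ball/= distrC.
  by rewrite (le_lt_trans _ rN)// -(subnKC Nn) ud.
pose l i := sval (cid (ulim i)).
have ul i : u n i @[n --> \oo] --> l i by rewrite /l; case: cid.
have gl : good l by apply: good_lim ul => n; exact: (uB n).1.
have dl n : dist_le l (u n) (r / 2 ^+ n).
  move=> i; have : `|u k i - u n i| @[k --> \oo] --> `|l i - u n i|.
    by apply: cvg_norm; apply: cvgB (ul i) _; exact: cvg_cst.
  move=> /cvgr_to_le; apply; exists n => // k /= nk.
  by rewrite -(subnKC nk) ud.
have dl0 : dist_le l y0 r.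
  by apply: le_dist_le (dl 0%N); rewrite expr0 divr1.
exists l; split => // i; apply/eqP; rewrite -subr_eq0 -normr_le0.
apply: (@le_of_halving _ r) => n.
have [gn dn] := uB n.
have h0 : 0 <= r / 2 ^+ n by rewrite divr_ge0// exprn_ge0.
have h1 := cPsi _ _ _ gl gn dl0 dn h0 (dl n).
have := dist_le_trans h1 (dist_le_sym (dl n.+1)) i.
move/le_trans; apply.
by rewrite exprSr invfM mulrA -splitr.
Qed.

End contraction.

Section fixed_curve.
Context (R : realType) (I : Type).
Local Notation Y := (I -> R).
Implicit Types (s k C D E : R) (y z : Y).

Definition bounded_by z D := forall i, `|z i| <= D.

Lemma dist_le_bounded z D : dist_le z (fun=> 0) D -> bounded_by z D.
Proof. by move=> zD i; have := zD i; rewrite subr0. Qed.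

Variable good : Y -> Prop.
Hypothesis good_lim : forall (u : nat -> Y) (l : Y), (forall n, good (u n)) ->
  (forall i, u n i @[n --> \oo] --> l i) -> good l.
Hypothesis good_lin : forall k z z', good z -> good z' ->
  good (fun i => k * z i + z' i).

Lemma good_sub z z' : good z -> good z' -> good (fun i => z i - z' i).
Proof.
move=> gz gz'; have := good_lin (-1) gz' gz.
by congr good; apply/funext => i; rewrite mulN1r addrC.
Qed.

Lemma good_zero z : good z -> good (fun=> 0).
Proof.
move=> gz; have := good_sub gz gz.
by congr good; apply/funext => i; rewrite subrr.
Qed.

Lemma good_scale k z : good z -> good (fun i => k * z i).
Proof.
move=> gz; have := good_lin k gz (good_zero gz).
by congr good; apply/funext => i; rewrite addr0.
Qed.

(* [a] and [M] play the roles of the partial derivatives of [Psi s y] with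
   respect to [s] and [y] *)
Variables (Psi a : R -> Y -> Y) (M : R -> Y -> Y -> Y) (y0 : Y) (e r C : R).

Definition near_base s y := [/\ `|s| <= e, good y & dist_le y y0 r].

Hypotheses (e0 : 0 <= e) (r0 : 0 <= r) (C0 : 0 <= C) (good_y0 : good y0).
Hypothesis good_Psi : forall s y, near_base s y -> good (Psi s y).
Hypothesis good_a : forall s y, near_base s y -> good (a s y).
Hypothesis good_M : forall s y z D, near_base s y -> good z ->
  bounded_by z D -> good (M s y z).
Hypothesis a_le : forall s y, near_base s y -> bounded_by (a s y) C.
Hypothesis M_lin : forall s y k z z' D, near_base s y -> good z -> good z' ->
  bounded_by z D -> bounded_by z' D ->
  forall i, M s y (fun i => k * z i + z' i) i = k * M s y z i + M s y z' i.
Hypothesis M_le : forall s y z D, near_base s y -> good z -> 0 <= D ->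
  bounded_by z D -> bounded_by (M s y z) (D / 2).
Hypothesis Psi_contract : forall s y y' D, near_base s y -> near_base s y' ->
  0 <= D -> dist_le y y' D -> dist_le (Psi s y) (Psi s y') (D / 2).
Hypothesis Psi_expand : forall s s' y y' D, near_base s y -> near_base s' y' ->
  0 <= D -> dist_le y' y D ->
  forall i, `|Psi s' y' i - Psi s y i - (s' - s) * a s y i -
              M s y (fun i => y' i - y i) i| <= C * (`|s' - s| + D) ^+ 2.
Hypothesis a_lip : forall s s' y y' D, near_base s y -> near_base s' y' ->
  0 <= D -> dist_le y' y D -> dist_le (a s' y') (a s y) (C * (`|s' - s| + D)).
Hypothesis M_lip : forall s s' y y' z D E, near_base s y -> near_base s' y' ->
  0 <= D -> dist_le y' y D -> good z -> 0 <= E -> bounded_by z E ->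
  dist_le (M s' y' z) (M s y z) (C * (`|s' - s| + D) * E).
Hypothesis Psi_base : forall s, `|s| <= e -> dist_le (Psi s y0) y0 (r / 2).

Let M0 s y i : near_base s y -> M s y (fun=> 0) i = 0.
Proof.
move=> ok; apply/eqP; rewrite -normr_le0.
have := @M_le s y (fun=> 0) 0 ok (good_zero good_y0) (lexx _).
by rewrite mul0r; apply => j; rewrite normr0.
Qed.

Let MB s y z z' D i : near_base s y -> good z -> good z' ->
  bounded_by z D -> bounded_by z' D ->
  M s y (fun i => z i - z' i) i = M s y z i - M s y z' i.
Proof.
move=> ok gz gz' zD zD'; rewrite -[RHS]addrC -mulN1r -(M_lin _ ok gz' gz zD' zD).
by congr (M _ _ _ i); apply/funext => j; rewrite mulN1r addrC.
Qed.

Lemma fixed_curve : exists y y' : R -> Y, exists K, [/\ 0 <= K,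
  forall s, `|s| <= e -> [/\ near_base s (y s),
    forall i, Psi s (y s) i = y s i, good (y' s) & bounded_by (y' s) K],
  forall s z, near_base s z -> (forall i, Psi s z i = z i) -> z = y s &
  forall s s' i, `|s| <= e -> `|s'| <= e ->
    `|y s' i - y s i - (s' - s) * y' s i| <= K * (s' - s) ^+ 2 /\
    `|y' s' i - y' s i| <= K * `|s' - s|].
Proof.
have exy s : exists y, `|s| <= e -> near_base s y /\ forall i, Psi s y i = y i.
  have [se|_] := boolP (`|s| <= e); last by exists y0.
  have [|||y [gy yr fy]] := @contraction_fixed R I good good_lim (Psi s) y0 r r0 good_y0.
  - by move=> y gy yr; exact: good_Psi.
  - by move=> y z D gy gz yr zr D0 yz; exact: Psi_contract.
  - exact: Psi_base.
  by exists y.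
pose y s := sval (cid (exy s)).
have yP s : `|s| <= e -> near_base s (y s) /\ forall i, Psi s (y s) i = y s i.
  by rewrite /y; case: cid.
have exy' s : exists y', `|s| <= e -> [/\ good y', bounded_by y' (2 * C) &
    forall i, a s (y s) i + M s (y s) y' i = y' i].
  have [se|_] := boolP (`|s| <= e); last by exists y0.
  have [ok fy] := yP s se.
  have [|||||y' [gy' yr' fy']] := @contraction_fixed R I good good_lim
    (fun z i => a s (y s) i + M s (y s) z i) (fun=> 0) (2 * C).
  - by rewrite mulr_ge0.
  - exact: good_zero good_y0.
  - move=> z gz /dist_le_bounded zr.
    have := good_lin 1 (good_a ok) (good_M ok gz zr).
    by congr good; apply/funext => i; rewrite mul1r.
  - move=> z z' D gz gz' /dist_le_bounded zr /dist_le_bounded zr' D0 zz' i.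
    rewrite opprD addrACA subrr add0r -(MB _ ok gz gz' zr zr').
    by apply: M_le => //; exact: good_sub.
  - move=> i; rewrite M0// addr0 subr0 mulrAC divff// mul1r.
    exact: a_le.
  by exists y'; split => //; exact/dist_le_bounded.
pose y' s := sval (cid (exy' s)).
have yP' s : `|s| <= e -> [/\ good (y' s), bounded_by (y' s) (2 * C) &
    forall i, a s (y s) i + M s (y s) (y' s) i = y' s i].
  by rewrite /y'; case: cid.
pose L := 2 * (C + C * (2 * e)).
have L0 : 0 <= L by rewrite mulr_ge0// addr_ge0// mulr_ge0// mulr_ge0.
have ylip s s' : `|s| <= e -> `|s'| <= e ->
    dist_le (y s') (y s) (L * `|s' - s|).
  move=> se se'; have [ok fy] := yP s se; have [ok' fy'] := yP s' se'.
  have [_ gs ds] := ok; have [_ gs' ds'] := ok'.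
  have oks : near_base s' (y s) by [].
  have ds0 : `|s' - s| <= 2 * e.
    by rewrite (le_trans (ler_normB _ _))// mulr2n mulrDl mul1r lerD.
  rewrite /L -mulrA; apply: (@dist_le_halving R I _ _ (2 * r)).
  - move=> D D0 yD i; rewrite -fy' -[in X in _ - X]fy.
    rewrite -(subrKA (Psi s' (y s) i)).
    rewrite (le_trans (ler_normD _ _))// lerD//; first exact: Psi_contract.
    have yy : dist_le (y s) (y s) 0 by exact: dist_lexx.
    (* Dependence on s alone: with y fixed, the expansion leaves the term in a and a quadratic
       error, which is linear in |s' - s| because |s' - s| <= 2 e. *)
    have := Psi_expand ok oks (lexx 0) yy i.
    rewrite (_ : (fun i => _) = fun=> 0); last by apply/funext => j; rewrite subrr.
    rewrite M0// subr0 addr0 => h.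
    have ha : `|(s' - s) * a s (y s) i| <= C * `|s' - s|.
      by rewrite normrM mulrC ler_wpM2r//; exact: a_le.
    set u := Psi _ _ i - _ in h *; set v := (s' - s) * _ in h ha *.
    rewrite -(subrK v u) (le_trans (ler_normD _ _))// mulrDl addrC lerD//.
    rewrite (le_trans h)//.
    by rewrite expr2 [leLHS]mulrA ler_wpM2r// ler_wpM2l.
  - by rewrite mulr_ge0.
  - by rewrite mulr_ge0// addr_ge0// mulr_ge0// mulr_ge0.
  - by rewrite mulr2n mulrDl mul1r; apply: dist_le_trans ds' (dist_le_sym ds).
pose L1 := C * (1 + L).
have L10 : 0 <= L1 by rewrite mulr_ge0// addr_ge0.
pose K := 2 * (C * (1 + L) ^+ 2) + (2 * (L1 * (1 + 2 * C))) + 2 * C.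
have K1 : 0 <= 2 * (C * (1 + L) ^+ 2) by rewrite mulr_ge0// mulr_ge0// sqr_ge0.
have K2 : 0 <= 2 * (L1 * (1 + 2 * C)).
  by rewrite mulr_ge0// mulr_ge0// addr_ge0// mulr_ge0.
have K3 : 0 <= 2 * C by rewrite mulr_ge0.
exists y, y', K; split; first by rewrite /K !addr_ge0.
- move=> s se; have [ok fy] := yP s se; have [gy by' fy'] := yP' s se.
  split => // i; rewrite (le_trans (by' i))// /K lerDr addr_ge0//.
- move=> s z okz fz; have [se gz zr] := okz; have [ok fy] := yP s se.
  have [_ _ yr] := ok.
  have : dist_le z (y s) (2 * 0).
    apply: (@dist_le_halving _ _ _ _ (2 * r)) => //; rewrite ?mulr_ge0//.
      move=> D D0 zD i; rewrite addr0 -fz -[in X in _ - X]fy.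
      exact: Psi_contract.
    by rewrite mulr2n mulrDl mul1r; apply: dist_le_trans zr (dist_le_sym yr).
  rewrite mulr0 => zy; apply/funext => i; apply/eqP.
  by rewrite -subr_eq0 -normr_le0 zy.
move=> s s' i se se'.
have [ok fy] := yP s se; have [gy by' fy'] := yP' s se.
have [ok' fys'] := yP s' se'; have [gys' bys' fy's'] := yP' s' se'.
have [_ gs ds] := ok; have [_ gs' ds'] := ok'.
have ly := ylip s s' se se'.
have lD : 0 <= L * `|s' - s| by rewrite mulr_ge0.
set h := s' - s in lD ly *.
split.
(* The Taylor remainder is M applied to itself plus the expansion error, which is quadratic in h by
   the Lipschitz bound on y. *)
- have : dist_le (fun i => y s' i - y s i - h * y' s i) (fun=> 0)
      (2 * (C * ((1 + L) * `|h|) ^+ 2)).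
    apply: (@dist_le_halving _ _ _ _ (L * `|h| + `|h| * (2 * C))).
    + move=> D D0 /dist_le_bounded dD j; rewrite subr0.
      have gd : good (fun i => y s' i - y s i) by exact: good_sub.
      have ghy : good (fun i => h * y' s i) by exact: good_scale.
      have := Psi_expand ok ok' lD ly j.
      rewrite fys' fy -/h -[X in _ * (X + _) ^+ _]mul1r -mulrDl.
      set err := (X in `|X| <= _) => errP.
      have -> : y s' j - y s j - h * y' s j =
         M s (y s) (fun i => y s' i - y s i - h * y' s i) j + err.
        have b1 : bounded_by (fun i => y s' i - y s i) (L * `|h| + `|h| * (2 * C)).
          by move=> k; rewrite (le_trans (ly k))// lerDl mulr_ge0.
        have b2 : bounded_by (fun i => h * y' s i) (L * `|h| + `|h| * (2 * C)).
          by move=> k; rewrite normrM (@le_trans _ _ (`|h| * (2 * C)))// ?ler_wpM2l// lerDr.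
        rewrite (MB _ ok gd ghy b1 b2) /err.
        have -> : M s (y s) (fun i => h * y' s i) j = h * M s (y s) (y' s) j.
          have := M_lin h ok gy (good_zero good_y0) by' (z' := fun=> 0).
          move/(_ _ j); rewrite M0// addr0 => <-; last by move=> k; rewrite normr0.
          by congr (M _ _ _ j); apply/funext => k; rewrite addr0.
        by rewrite -fy'; ring.
      rewrite (le_trans (ler_normD _ _))// lerD//.
      by apply: M_le => //; exact: good_sub.
    + by rewrite addr_ge0// mulr_ge0.
    + by rewrite mulr_ge0// sqr_ge0.
    + move=> j; rewrite subr0 (le_trans (ler_normB _ _))// lerD//.
      by rewrite normrM ler_wpM2l.
  move=> /(_ i); rewrite subr0 => /le_trans; apply.
  rewrite exprMn real_normK ?num_real//.
  rewrite [leLHS](_ : _ = 2 * (C * (1 + L) ^+ 2) * h ^+ 2); last by ring.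
  by rewrite ler_wpM2r ?sqr_ge0// /K -addrA lerDl addr_ge0.
(* Subtracting the two linearized equations leaves M of the difference plus the variations of a and
   of M, both Lipschitz in h. *)
- have : dist_le (y' s') (y' s) (2 * (L1 * (1 + 2 * C) * `|h|)).
    apply: (@dist_le_halving _ _ _ _ (2 * C + 2 * C)).
    + move=> D D0 dD j; rewrite -fy's' -fy'.
      have l1 := a_lip ok ok' lD ly j.
      have l2 := M_lip ok ok' lD ly gys' K3 bys' j.
      have l3 : `|M s (y s) (y' s') j - M s (y s) (y' s) j| <= D / 2.
        rewrite -(MB _ ok gys' gy bys' by'); apply: M_le => //; exact: good_sub.
      rewrite -/h -[X in _ * (X + _)]mul1r -mulrDl mulrA -/L1 in l1 l2.
      rewrite (_ : _ - _ = (M s (y s) (y' s') j - M s (y s) (y' s) j) +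
        ((a s' (y s') j - a s (y s) j) +
         (M s' (y s') (y' s') j - M s (y s) (y' s') j))); last by ring.
      rewrite (le_trans (ler_normD _ _))// lerD// (le_trans (ler_normD _ _))//.
      rewrite (le_trans (lerD l1 l2))// -[X in X + _ <= _]mulr1 -mulrDr.
      by rewrite mulrAC.
    + by rewrite addr_ge0.
    + by rewrite mulr_ge0// mulr_ge0// addr_ge0.
    + move=> j; rewrite (le_trans (ler_normB _ _))// lerD//.
  move=> /(_ i) /le_trans; apply.
  rewrite mulrA ler_wpM2r// /K -addrA addrCA.
  by rewrite lerDl addr_ge0.
Qed.

End fixed_curve.

(** * Functions with Lipschitz gradient *)

Section C11.
Context (R : realType) (V : lmodType R) (N : V -> R).
Hypothesis N_ge0 : forall h, 0 <= N h.
Implicit Types (U : set V) (f : V -> R) (g : V -> V -> R) (C : R).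

(* [g p] is the gradient of [f] at [p]; a single constant serves all the bounds *)
Definition C11_with C U f g :=
  [/\ 0 <= C,
      forall p k h h', U p -> g p (k *: h + h') = k * g p h + g p h',
      forall p, U p -> `|f p| <= C /\ forall h, `|g p h| <= C * N h &
      forall p p', U p -> U p' ->
        [/\ `|f p' - f p| <= C * N (p' - p),
            `|f p' - f p - g p (p' - p)| <= C * N (p' - p) ^+ 2 &
            forall h, `|g p' h - g p h| <= C * N (p' - p) * N h]].

(** The gradient [g] is data, not a derivative extracted from [f]: the closure lemmas then compute
    it by formula, so that it can be evaluated at the base point. *)
Definition C11 U f g := exists C, C11_with C U f g.

Lemma C11_withW C D U f g : C <= D -> C11_with C U f g -> C11_with D U f g.
Proof.
move=> CD [C0 gl fb fl]; split => //; first exact: le_trans CD.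
  move=> p /fb[fC gC]; split => [|h]; first exact: le_trans CD.
  by rewrite (le_trans (gC h))// ler_wpM2r.
move=> p p' Up Up'; have [h1 h2 h3] := fl _ _ Up Up'; split.
- by rewrite (le_trans h1)// ler_wpM2r.
- by rewrite (le_trans h2)// ler_wpM2r// sqr_ge0.
- by move=> h; rewrite (le_trans (h3 h))// -!mulrA ler_wpM2r// mulr_ge0.
Qed.

Lemma C11_sub U U' f g : U' `<=` U -> C11 U f g -> C11 U' f g.
Proof.
move=> UU [C [C0 gl fb fl]]; exists C; split => //.
- by move=> p k h h' /UU; exact: gl.
- by move=> p /UU; exact: fb.
- by move=> p p' /UU Up /UU; exact: fl.
Qed.

Lemma C11_ext U f f' g g' : (forall p, U p -> f p = f' p) ->
  (forall p h, U p -> g p h = g' p h) -> C11 U f g -> C11 U f' g'.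
Proof.
move=> ff gg [C [C0 gl fb fl]]; exists C; split => //.
- by move=> p k h h' Up; rewrite -!gg//; exact: gl.
- by move=> p Up; rewrite -ff//; split=> [|h]; rewrite -?gg//; apply fb.
- move=> p p' Up Up'; rewrite -!ff// -gg//; have [h1 h2 h3] := fl _ _ Up Up'.
  by split => // h; rewrite -!gg.
Qed.

Lemma C11_cst U (a : R) : C11 U (fun=> a) (fun _ _ => 0).
Proof.
exists `|a|; split => //.
- by move=> *; rewrite mulr0 addr0.
- by move=> p _; split => // h; rewrite normr0 mulr_ge0.
- by move=> p p' _ _; split => [||h]; rewrite !subrr ?subr0 normr0 !mulr_ge0// sqr_ge0.
Qed.

Lemma C11_linear U (l : V -> R) C : (forall k h h', l (k *: h + h') = k * l h + l h') ->
  (forall h, `|l h| <= C * N h) -> (forall p, U p -> `|l p| <= C) ->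
  C11 U l (fun _ => l).
Proof.
move=> llin lN lU; exists `|C|.
have lN' h : `|l h| <= `|C| * N h.
  by rewrite (le_trans (lN h))// ler_wpM2r// ler_norm.
split => //.
- by move=> p Up; split => //; rewrite (le_trans (lU _ Up))// ler_norm.
- have lB p p' : l p' - l p = l (p' - p).
    by rewrite (_ : p' - p = (-1) *: p + p') ?llin ?mulN1r 1?addrC// scaleN1r addrC.
  move=> p p' _ _; split => [||h]; first by rewrite lB.
    by rewrite lB subrr normr0 mulr_ge0// sqr_ge0.
  by rewrite subrr normr0 !mulr_ge0.
Qed.

Lemma C11_add U f1 g1 f2 g2 : C11 U f1 g1 -> C11 U f2 g2 ->
  C11 U (fun p => f1 p + f2 p) (fun p h => g1 p h + g2 p h).
Proof.
move=> [C [C0 gl fb fl]] [D [D0 gl' fb' fl']]; exists (C + D); split => //.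
- exact: addr_ge0.
- by move=> p k h h' Up; rewrite gl// gl'//; ring.
- move=> p Up; have [h1 h2] := fb p Up; have [h3 h4] := fb' p Up; split => [|h].
    by rewrite (le_trans (ler_normD _ _))// lerD.
  by rewrite (le_trans (ler_normD _ _))// mulrDl lerD.
- move=> p p' Up Up'; have [h1 h2 h3] := fl p p' Up Up'.
  have [h4 h5 h6] := fl' p p' Up Up'; split => [||h].
  + by rewrite opprD addrACA (le_trans (ler_normD _ _))// mulrDl lerD.
  + rewrite [X in `|X|](_ : _ = (f1 p' - f1 p - g1 p (p' - p)) +
      (f2 p' - f2 p - g2 p (p' - p))); last by ring.
    by rewrite (le_trans (ler_normD _ _))// mulrDl lerD.
  + by rewrite opprD addrACA (le_trans (ler_normD _ _))// !mulrDl lerD.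
Qed.

Lemma C11_mul U f1 g1 f2 g2 : C11 U f1 g1 -> C11 U f2 g2 ->
  C11 U (fun p => f1 p * f2 p) (fun p h => f1 p * g2 p h + f2 p * g1 p h).
Proof.
have wlogC f g f' g' : C11 U f g -> C11 U f' g' ->
    exists C, C11_with C U f g /\ C11_with C U f' g'.
  move=> [C HC] [D HD]; exists (C + D); have [? _ _ _] := HC; have [? _ _ _] := HD.
  by split; [apply: C11_withW HC; rewrite lerDl|apply: C11_withW HD; rewrite lerDr].
move=> F1 F2; have [C [[C0 gl fb fl] [_ gl' fb' fl']]] := wlogC _ _ _ _ F1 F2.
exists (C * C + C * C + C * C + C * C); split => //.
- by rewrite !addr_ge0// mulr_ge0.
- by move=> p k h h' Up; rewrite gl// gl'//; ring.
- move=> p Up; have [h1 h2] := fb p Up; have [h3 h4] := fb' p Up; split => [|h].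
    rewrite normrM (@le_trans _ _ (C * C))// ?ler_pM// -!addrA lerDl !addr_ge0// mulr_ge0//.
  rewrite (@le_trans _ _ (C * (C * N h) + C * (C * N h)))//.
    by rewrite (le_trans (ler_normD _ _))// !normrM lerD// ler_pM.
  by rewrite !mulrA -mulrDl ler_wpM2r// -addrA lerDl addr_ge0// mulr_ge0.
- move=> p p' Up Up'; have [h1 h2 h3] := fl p p' Up Up'.
  have [h4 h5 h6] := fl' p p' Up Up'.
  have [b1 b2] := fb p Up; have [b3 b4] := fb' p Up.
  have [b1' b2'] := fb p' Up'; have [b3' b4'] := fb' p' Up'.
  have CN : 0 <= C * C * N (p' - p) by rewrite !mulr_ge0.
  split => [||h].
  + rewrite [X in `|X|](_ : _ = f1 p' * (f2 p' - f2 p) + f2 p * (f1 p' - f1 p)); last by ring.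
    rewrite (le_trans (ler_normD _ _))// !normrM.
    rewrite (@le_trans _ _ (C * (C * N (p' - p)) + C * (C * N (p' - p))))//.
      by rewrite lerD// ler_pM.
    by rewrite !mulrA !mulrDl -addrA lerDl addr_ge0.
  + rewrite [X in `|X|](_ : _ = (f1 p' - f1 p) * (f2 p' - f2 p) +
      (f1 p * (f2 p' - f2 p - g2 p (p' - p)) +
       f2 p * (f1 p' - f1 p - g1 p (p' - p)))); last by ring.
    have CN2 : 0 <= C * C * N (p' - p) ^+ 2 by rewrite !mulr_ge0// sqr_ge0.
    rewrite (le_trans (ler_normD _ _))// (@le_trans _ _ ((C * N (p' - p)) * (C * N (p' - p)) +
      (C * (C * N (p' - p) ^+ 2) + C * (C * N (p' - p) ^+ 2))))//.
      rewrite lerD//; first by rewrite normrM ler_pM.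
      by rewrite (le_trans (ler_normD _ _))// !normrM lerD// ler_pM.
    set n := N _ in CN CN2 *; rewrite -subr_ge0.
    by rewrite [X in 0 <= X](_ : _ = C * C * n ^+ 2)//; ring.
  + rewrite [X in `|X|](_ : _ = f1 p' * (g2 p' h - g2 p h) + (f1 p' - f1 p) * g2 p h +
       (f2 p' * (g1 p' h - g1 p h) + (f2 p' - f2 p) * g1 p h)); last by ring.
    have e : (C * C + C * C + C * C + C * C) * N (p' - p) * N h =
      C * (C * N (p' - p) * N h) + C * N (p' - p) * (C * N h) +
      (C * (C * N (p' - p) * N h) + C * N (p' - p) * (C * N h)) by ring.
    rewrite e; have CNh : 0 <= C * N h by rewrite mulr_ge0.
    rewrite (le_trans (ler_normD _ _))// lerD// (le_trans (ler_normD _ _))//;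
      by rewrite !normrM lerD// ler_pM.
Qed.

Lemma C11_scale U (a : R) f g : C11 U f g ->
  C11 U (fun p => a * f p) (fun p h => a * g p h).
Proof.
move=> Hf; apply: C11_ext (C11_mul (C11_cst U a) Hf) => // p h Up.
by rewrite mulr0 addr0.
Qed.

End C11.

Section C11_comp.
Context (R : realType) (V : lmodType R) (N : V -> R).
Hypothesis N_ge0 : forall h, 0 <= N h.

Definition C11_scalar (A : set R) (phi dphi : R -> R) :=
  @C11 R R^o Num.norm A phi (fun x h => dphi x * h).

Lemma C11_comp (U : set V) f g (A : set R) phi dphi : C11 N U f g ->
  (forall p, U p -> A (f p)) -> C11_scalar A phi dphi ->
  C11 N U (fun p => phi (f p)) (fun p h => dphi (f p) * g p h).
Proof.
move=> [C [C0 gl fb fl]] UA [D [D0 _ pb pl]].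
pose E := D + D * C + D * C ^+ 2 + D * C.
have e1 : 0 <= D * C by rewrite mulr_ge0.
have e2 : 0 <= D * C ^+ 2 by rewrite mulr_ge0// sqr_ge0.
have dphiD x : A x -> `|dphi x| <= D.
  by move=> /pb[_ /(_ 1)]; rewrite mulr1 normr1 mulr1.
exists E; split => //.
- by rewrite !addr_ge0.
- by move=> p k h h' Up; rewrite gl//; ring.
- move=> p Up; have Af := UA _ Up; have [h1 _] := pb _ Af; have [h3 h4] := fb p Up.
  split => [|h]; first by rewrite (le_trans h1)// /E -!addrA lerDl !addr_ge0.
  rewrite normrM (@le_trans _ _ (D * (C * N h)))//.
    by rewrite ler_pM//; exact: dphiD.
  by rewrite mulrA ler_wpM2r// /E lerDr !addr_ge0.
- move=> p p' Up Up'; have [Af Af'] := (UA _ Up, UA _ Up').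
  have [h1 h2 h3] := fl p p' Up Up'; have [b1 b2] := fb _ Up.
  have [k1 k2 k3] := pl _ _ Af Af'; split => [||h].
  + rewrite (le_trans k1)// (@le_trans _ _ (D * (C * N (p' - p))))//.
      by rewrite ler_wpM2l.
    by rewrite mulrA ler_wpM2r// /E lerDr !addr_ge0.
  + rewrite [X in `|X|](_ : _ = (phi (f p') - phi (f p) - dphi (f p) * (f p' - f p)) +
       dphi (f p) * (f p' - f p - g p (p' - p))); last by ring.
    rewrite (le_trans (ler_normD _ _))//.
    rewrite (@le_trans _ _ (D * (C * N (p' - p)) ^+ 2 + D * (C * N (p' - p) ^+ 2)))//.
      rewrite lerD//.
        by rewrite (le_trans k2)// ler_wpM2l// lerXn2r// ?nnegrE ?normr_ge0// mulr_ge0.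
      by rewrite normrM ler_pM//; exact: dphiD.
    rewrite [leLHS](_ : _ = (D * C ^+ 2 + D * C) * N (p' - p) ^+ 2); last by ring.
    by rewrite ler_wpM2r ?sqr_ge0// /E -addrA lerDr addr_ge0.
  + rewrite [X in `|X|](_ : _ = (dphi (f p') - dphi (f p)) * g p' h +
       dphi (f p) * (g p' h - g p h)); last by ring.
    have := k3 1; rewrite !mulr1 normr1 mulr1 => k3'.
    rewrite (le_trans (ler_normD _ _))//.
    rewrite (@le_trans _ _ (D * (C * N (p' - p)) * (C * N h) + D * (C * N (p' - p) * N h)))//.
      rewrite lerD// normrM ler_pM//.
      * by rewrite (le_trans k3')// ler_wpM2l.
      * exact: (fb _ Up').2.
      * exact: dphiD.
    rewrite [leLHS](_ : _ = (D * C ^+ 2 + D * C) * N (p' - p) * N h); last by ring.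
    by rewrite ler_wpM2r// ler_wpM2r// /E -addrA lerDr addr_ge0.
Qed.

End C11_comp.

Section C11_scalar_itv.
Context (R : realType).

Lemma mvt_bound (f df : R -> R) (u v C : R) :
  (forall x, u <= x <= v -> is_derive x 1 f (df x)) ->
  (forall x, u <= x <= v -> `|df x| <= C) ->
  forall x y, u <= x <= v -> u <= y <= v -> `|f y - f x| <= C * `|y - x|.
Proof.
move=> fd dC; suff H x y : x <= y -> u <= x <= v -> u <= y <= v ->
    `|f y - f x| <= C * `|y - x|.
  move=> x y xu yu; have [xy|/ltW yx] := leP x y; first exact: H.
  by rewrite distrC [in leRHS]distrC; exact: H.
move=> xy /andP[ux xv] /andP[uy yv].
have [||c] := @MVT_segment R f df x y xy.
- move=> z; rewrite in_itv/= => /andP[xz zy]; apply: fd.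
  by rewrite (le_trans ux (ltW xz))/= (le_trans (ltW zy) yv).
- apply: derivable_within_continuous => z; rewrite in_itv/= => /andP[xz zy].
  have /fd[] // : u <= z <= v by rewrite (le_trans ux xz)/= (le_trans zy yv).
rewrite in_itv/= => /andP[xc cy] ->.
by rewrite normrM ler_wpM2r// dC// (le_trans ux xc)/= (le_trans cy yv).
Qed.

Lemma C11_scalar_itv (f df ddf : R -> R) (u v : R) : u <= v ->
  (forall x, u <= x <= v -> is_derive x 1 f (df x)) ->
  (forall x, u <= x <= v -> is_derive x 1 df (ddf x)) ->
  (forall x, u <= x <= v -> {for x, continuous ddf}) ->
  C11_scalar [set x | u <= x <= v] f df.
Proof.
move=> uv fd dfd ddfc.
have bnd (g : R -> R) : (forall x, u <= x <= v -> {for x, continuous g}) ->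
    exists2 C : R, 0 <= C & forall x, u <= x <= v -> `|g x| <= C.
  move=> gc; have [|c _ cmax] := @EVT_max R (fun x => `|g x|) u v uv.
    apply: continuous_in_subspaceT => x /[!inE]/= xuv.
    by apply: continuous_comp; [apply: gc; rewrite in_itv/= in xuv|exact: norm_continuous].
  by exists `|g c| => // x xuv; apply: cmax; rewrite in_itv.
have dcont (g dg : R -> R) (x : R) : is_derive x 1 g (dg x) -> {for x, continuous g}.
  by move=> [h _]; apply/differentiable_continuous/derivable1_diffP.
have [C1 C10 fC] := bnd f (fun x xuv => dcont _ _ _ (fd x xuv)).
have [C2 C20 dfC] := bnd df (fun x xuv => dcont _ _ _ (dfd x xuv)).
have [C3 C30 ddfC] := bnd ddf ddfc.
exists (C1 + C2 + C3); split.
- by rewrite !addr_ge0.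
- by move=> p k h h' _; rewrite mulrDr /GRing.scale/= mulrCA.
- move=> p pU; split => [|h]; first by rewrite (le_trans (fC p pU))// -addrA lerDl addr_ge0.
  rewrite normrM ler_wpM2r// (le_trans (dfC p pU))// addrAC lerDr addr_ge0//.
- move=> x y xU yU; have l1 := mvt_bound fd dfC xU yU; have l2 := mvt_bound dfd ddfC.
  split => [||h].
  + rewrite (le_trans l1)// ler_wpM2r// addrAC lerDr addr_ge0//.
  (* Subtracting the tangent at x leaves a derivative bounded by C3 |y - x| between x and y, and the
     mean value bound gives the quadratic remainder. *)
  + pose g z := f z - df x * z.
    have gd z : Num.min x y <= z <= Num.max x y -> is_derive z 1 g (df z - df x).
      move=> /andP[z1 z2]; have zU : u <= z <= v.
        move: xU yU => /andP[ux xv] /andP[uy yv]; apply/andP; split.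
          by rewrite (le_trans _ z1)// le_min ux uy.
        by rewrite (le_trans z2)// ge_max xv yv.
      have ? := fd _ zU.
      rewrite (_ : g = f - df x *: (id : R -> R))//.
      by apply: is_derive_eq; rewrite /GRing.scale/= mulr1.
    have gC z : Num.min x y <= z <= Num.max x y -> `|df z - df x| <= C3 * `|y - x|.
      move=> /andP[z1 z2]; have zU : u <= z <= v.
        move: xU yU => /andP[ux xv] /andP[uy yv]; apply/andP; split.
          by rewrite (le_trans _ z1)// le_min ux uy.
        by rewrite (le_trans z2)// ge_max xv yv.
      rewrite (le_trans (l2 _ _ xU zU))// ler_wpM2l//.
      move: z1 z2; rewrite ge_min le_max ler_norml => /orP[]z1 /orP[]z2;
        case: (ger0P (y - x)) => yx; apply/andP; split; lra.
    have := mvt_bound gd gC (x := x) (y := y).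
    rewrite !ge_min !le_max !lexx !orbT/= => /(_ isT isT).
    rewrite /g -mulrA [X in `|X|](_ : _ = f y - f x - df x * (y - x)); last by ring.
    move=> /le_trans; apply; rewrite expr2 ler_wpM2r//.
    by rewrite lerDr addr_ge0.
  + rewrite -mulrBl normrM ler_wpM2r// (le_trans (l2 _ _ xU yU))// ler_wpM2r// lerDr addr_ge0//.
Qed.

End C11_scalar_itv.

(** * Integrals over [0, 1] depending on a parameter *)

Section integral01.
Context (R : realType).
Local Notation leb := (@lebesgue_measure R).
Implicit Types (f g : R -> R) (C k : R).

Definition lip01 f := exists C, forall t t', 0 <= t <= 1 -> 0 <= t' <= 1 ->
  `|f t' - f t| <= C * `|t' - t|.

Lemma lip01_integrable f : lip01 f -> leb.-integrable `[0, 1] (EFin \o f).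
Proof.
move=> [C fC]; apply: continuous_compact_integrable; first exact: segment_compact.
apply/subspace_continuousP => t; rewrite /= in_itv/= => t01.
apply/cvgrPdist_lt => e e0; rewrite near_withinE; near=> t' => /=.
rewrite in_itv/= => t'01; rewrite (le_lt_trans (fC _ _ t'01 t01))//.
have C1 : 0 < `|C| + 1 by rewrite ltr_wpDl.
rewrite (@le_lt_trans _ _ ((`|C| + 1) * `|t - t'|))//.
  by rewrite ler_wpM2r// (le_trans (ler_norm C))// lerDl.
rewrite mulrC -ltr_pdivlMr//; near: t'.
by apply: (@cvgr_dist_lt _ _ _ _ _ id); [exact: cvg_id|rewrite divr_gt0].
Unshelve. all: by end_near. Qed.

Definition int01 f : R := \int[leb]_(t in `[0, 1]) f t.

Lemma int01B f g : lip01 f -> lip01 g ->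
  int01 (fun t => f t - g t) = int01 f - int01 g.
Proof. by move=> fL gL; rewrite /int01 RintegralB//; exact: lip01_integrable. Qed.

Lemma lip01Z k f : lip01 f -> lip01 (fun t => k * f t).
Proof.
move=> [C fC]; exists (`|k| * C) => t t' t01 t'01.
by rewrite -mulrBr normrM -mulrA ler_wpM2l// fC.
Qed.

Lemma lip01D f g : lip01 f -> lip01 g -> lip01 (fun t => f t + g t).
Proof.
move=> [C fC] [D gD]; exists (C + D) => t t' t01 t'01.
by rewrite opprD addrACA (le_trans (ler_normD _ _))// mulrDl lerD ?fC ?gD.
Qed.

Lemma lip01B f g : lip01 f -> lip01 g -> lip01 (fun t => f t - g t).
Proof.
move=> fL gL; have := lip01D fL (lip01Z (-1) gL).
by congr lip01; apply/funext => t; rewrite mulN1r.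
Qed.

Lemma int01_linear k f g : lip01 f -> lip01 g ->
  int01 (fun t => k * f t + g t) = k * int01 f + int01 g.
Proof.
move=> fL gL; rewrite /int01 RintegralD//; last 2 first.
- by apply: lip01_integrable; exact: lip01Z.
- exact: lip01_integrable.
by rewrite RintegralZl//; exact: lip01_integrable.
Qed.

Lemma int01_cst k : int01 (fun=> k) = k.
Proof.
rewrite /int01 Rintegral_cst//= lebesgue_measure_itv/= lte_fin ltr01.
by rewrite -EFinD subr0/= mulr1.
Qed.

Lemma eq_int01 f g : (forall t, 0 <= t <= 1 -> f t = g t) -> int01 f = int01 g.
Proof.
by move=> fg; apply: eq_Rintegral => t; rewrite inE/= in_itv/=; exact: fg.
Qed.

Lemma int01_le f C : lip01 f -> (forall t, 0 <= t <= 1 -> `|f t| <= C) ->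
  `|int01 f| <= C.
Proof.
move=> fL fC.
apply: le_trans (le_normr_Rintegral _ (lip01_integrable fL)) _ => //.
rewrite -[leRHS]int01_cst; apply: le_Rintegral => //.
- have [D fD] := fL; apply: (@lip01_integrable (fun t => `|f t|)).
  by exists D => t t' t01 t'01; rewrite (le_trans (ler_dist_dist _ _))// fD.
- by apply: (@lip01_integrable (fun=> C)); exists 0 => *; rewrite subrr normr0 mul0r.
Qed.

(** Differentiation under the integral sign: the joint bound in (t, p) is uniform in t, so every
    estimate integrates over a set of measure 1 with the same constant. With [N 0 = 0] a move in t
    alone costs |t' - t|, whence integrability in t. *)
Lemma C11_integral (V : lmodType R) (N : V -> R) (U : set V)
    (G : R^o * V -> R) (dG : R^o * V -> R^o * V -> R) :
  (forall h, 0 <= N h) -> N 0 = 0 ->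
  C11 (fun th : R^o * V => `|th.1| + N th.2) [set tp : R^o * V | 0 <= tp.1 <= 1 /\ U tp.2] G dG ->
  C11 N U (fun p => int01 (fun t => G (t, p)))
          (fun p h => int01 (fun t => dG (t, p) (0, h))).
Proof.
move=> N0 N00 [C [C0 gl fb fl]].
have GL p : U p -> lip01 (fun t => G (t, p)).
  move=> Up; exists C => t t' t01 t'01.
  have [+ _ _] := fl (t, p) (t', p) (conj t01 Up) (conj t'01 Up).
  by rewrite /= subrr N00 addr0.
have dGL p h : U p -> lip01 (fun t => dG (t, p) (0, h)).
  move=> Up; exists (C * N h) => t t' t01 t'01.
  have [_ _ /(_ (0, h))] := fl (t, p) (t', p) (conj t01 Up) (conj t'01 Up).
  by rewrite /= subrr N00 addr0 normr0 add0r mulrAC.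
exists C; split => //.
- move=> p k h h' Up; rewrite -int01_linear; [|exact: dGL..].
  apply: eq_int01 => t t01; rewrite -gl//; congr dG.
  by apply/pair_equal_spec; split => //=; rewrite scaler0 addr0.
- move=> p Up; split => [|h].
    by apply: int01_le => [|t t01]; [exact: GL|apply fb].
  apply: int01_le => [|t t01]; first exact: dGL.
  have [_ /(_ (0, h))] := fb (t, p) (conj t01 Up).
  by rewrite /= normr0 add0r.
- move=> p p' Up Up'.
  have fl' t : 0 <= t <= 1 -> _ := fun t01 => fl (t, p) (t, p') (conj t01 Up) (conj t01 Up').
  split => [||h].
  + rewrite -int01B; [|exact: GL..].
    apply: int01_le => [|t t01]; first by apply: lip01B; exact: GL.
    by have [+ _ _] := fl' _ t01; rewrite /= subrr normr0 add0r.
  + rewrite -int01B; [|exact: GL..]; rewrite -int01B; last 2 first.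
    * by apply: lip01B; exact: GL.
    * exact: dGL.
    apply: int01_le => [|t t01].
      by apply: lip01B; [apply: lip01B; exact: GL|exact: dGL].
    have [_ + _] := fl' _ t01; rewrite /= subrr normr0 add0r.
    by rewrite (_ : (_ - _ : R^o * V) = (0, p' - p))//; congr pair; rewrite /= subrr.
  + rewrite -int01B; [|exact: dGL..].
    apply: int01_le => [|t t01]; first by apply: lip01B; exact: dGL.
    by have [_ _ /(_ (0, h))] := fl' _ t01; rewrite /= subrr normr0 !add0r.
Qed.

End integral01.

(** * The conditioned normal law *)

Section barrier.
Context (R : realType).
Implicit Types f df : R -> R.

Lemma is_derive_root_sign f (x d : R) : is_derive x 1 f d -> 0 < d -> f x = 0 ->
  \forall h \near (0 : R)^'+, 0 < f (x + h) /\ f (x - h) < 0.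
Proof.
move=> [fx fd] d0 fx0.
have : (fun h : R => h^-1 *: (f (h *: 1 + x) - f x)) @ 0^' --> d by rewrite -fd.
move/cvgr_gt/(_ _ d0); rewrite near_withinE => /nbhs_ballP[e /= e0 eP].
exists e => //= h /=; rewrite sub0r normrN => he h0.
have h1 : 0 < h^-1 *: (f (h *: 1 + x) - f x).
  by apply: eP; rewrite /ball/= ?sub0r ?normrN// gt_eqF.
have h2 : 0 < (- h)^-1 *: (f ((- h) *: 1 + x) - f x).
  by apply: eP; rewrite /ball/= ?sub0r ?normrN// oppr_eq0 gt_eqF.
rewrite fx0 subr0 /GRing.scale/= mulr1 in h1 h2; split.
  by rewrite pmulr_rgt0 ?invr_gt0// addrC in h1.
rewrite invrN mulNr oppr_gt0 in h2.
by move: h2; rewrite pmulr_rlt0 ?invr_gt0// subr0 mulr1 addrC.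
Qed.

(** A function whose derivative is positive at each of its zeros can cross 0 only upward. Sign
    questions about a solution of a differential equation thus reduce to its zero set, where the
    equation simplifies. *)
Lemma barrier_gt0 f df : (forall x : R, 0 <= x -> is_derive x 1 f (df x)) ->
  0 <= f 0 -> (forall x : R, 0 <= x -> f x = 0 -> 0 < df x) ->
  forall x : R, 0 < x -> 0 < f x.
Proof.
move=> fd f0 dpos.
have fc (x : R) : 0 <= x -> {for x, continuous f}.
  by move=> /fd[h _]; apply/differentiable_continuous/derivable1_diffP.
have fge0 (x : R) : 0 <= x -> 0 <= f x.
  move=> x0; rewrite leNgt; apply/negP => fx.
  (* At the supremum z of A, f z >= 0 by continuity, and f stays nonnegative just to the right of z:
     this contradicts the choice of z. *)
  pose A := [set t | 0 <= t <= x /\ 0 <= f t].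
  have A0 : A 0 by rewrite /A/= lexx x0.
  have Aub : ubound A x by move=> t [/andP[]].
  have hsA : has_sup A by split; [exists 0|exists x].
  set z := sup A.
  have z0 : 0 <= z by apply: ub_le_sup => //; exact: hsA.2.
  have zx : z <= x by apply: ge_sup => //; exact: hsA.1.
  have fz : 0 <= f z.
    rewrite leNgt; apply/negP => fz.
    have /cvgr_lt/(_ _ fz)/nbhs_ballP[e /= e0 eP] := fc _ z0.
    have [t At zt] := sup_adherent e0 hsA.
    have tz : t <= z by apply: ub_le_sup => //; exact: hsA.2.
    case: At => _; apply/negP; rewrite -ltNge; apply: eP.
    by rewrite /ball/= ger0_norm ?subr_ge0// ltrBlDr -ltrBlDl.
  have {}zx : z < x.
    by rewrite lt_neqAle zx andbT; apply: contraTneq fx => <-; rewrite -leNgt.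
  have right : \forall h \near (0 : R)^'+, 0 <= f (z + h).
    move: fz; rewrite le_eqVlt => /predU1P[/esym fz|fz].
      by apply: filterS (is_derive_root_sign (fd _ z0) (dpos _ z0 fz) fz) => h [/ltW].
    have /cvgr_gt/(_ _ fz)/nbhs_ballP[e /= e0 eP] := fc _ z0.
    exists e => //= h /=; rewrite sub0r normrN => he h0; apply/ltW/eP.
    by rewrite /ball/= opprD addrA subrr sub0r normrN.
  have [h [h0 hx]] : exists h : R, [/\ 0 < h, z + h <= x & 0 <= f (z + h)].
    near (0 : R)^'+ => h; exists h; split => //.
    - by rewrite -lerBrDl; near: h; apply: nbhs_right_le; rewrite subr_gt0.
    - by near: h.
  move=> fh; have : z + h <= z.
    by apply: ub_le_sup; [exact: hsA.2|rewrite /A/= hx (addr_ge0 z0 (ltW h0))].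
  by rewrite gerDl leNgt h0.
(* A zero at x > 0 would make f negative just to the left of x. *)
move=> x x0; rewrite lt_neqAle fge0 ?ltW// andbT; apply/eqP => /esym fx.
near (0 : R)^'+ => h.
have [] : 0 < f (x + h) /\ f (x - h) < 0.
  near: h; have d0 := dpos _ (ltW x0) fx.
  exact: is_derive_root_sign (fd _ (ltW x0)) d0 fx.
move=> _; apply/negP; rewrite -leNgt fge0// subr_ge0.
by near: h; exact: nbhs_right_le.
Unshelve. all: by end_near. Qed.

End barrier.

Section is_derive_pointwise.
Context (R : realType).
Implicit Types (f g : R -> R) (x a b : R).

Lemma is_derive_mulR f g x a b : is_derive x 1 f a -> is_derive x 1 g b ->
  is_derive x 1 (fun y => f y * g y) (a * g x + f x * b).
Proof.
move=> fa gb; rewrite (_ : (fun y => f y * g y) = f * g)//.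
by apply: is_derive_eq; rewrite /GRing.scale/= addrC [g x * a]mulrC.
Qed.

Lemma is_derive_addR f g x a b : is_derive x 1 f a -> is_derive x 1 g b ->
  is_derive x 1 (fun y => f y + g y) (a + b).
Proof.
move=> fa gb; rewrite (_ : (fun y => f y + g y) = f + g)//.
exact: is_deriveD.
Qed.

Lemma is_derive_scaleR f x k a : is_derive x 1 f a ->
  is_derive x 1 (fun y => k * f y) (k * a).
Proof.
move=> fa; have := @is_derive_mulR (fun=> k) f x 0 a (is_derive_cst k x 1) fa.
by rewrite mul0r add0r.
Qed.

Lemma is_derive_compR f g x a b : is_derive x 1 g b -> is_derive (g x) 1 f a ->
  is_derive x 1 (fun y => f (g y)) (a * b).
Proof. by move=> gb fa; exact: is_derive1_comp. Qed.

Lemma is_derive_invR f x a : f x != 0 -> is_derive x 1 f a ->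
  is_derive x 1 (fun y => (f y)^-1) (- a / f x ^+ 2).
Proof.
move=> fx fa; rewrite (_ : - a / f x ^+ 2 = - f x ^- 2 *: a).
  exact: is_deriveV.
by rewrite /GRing.scale/= mulrC mulrN mulNr.
Qed.

Lemma is_derive_continuous f x a : is_derive x 1 f a -> {for x, continuous f}.
Proof. by move=> [h _]; exact/differentiable_continuous/derivable1_diffP. Qed.

End is_derive_pointwise.

Section gauss.
Context (R : realType).
Local Notation leb := (@lebesgue_measure R).
Implicit Types x mu : R.

Definition gpdf : R -> R := normal_pdf 0 1.

Definition gcdf x : R := \int[leb]_(t in `]-oo, x]) gpdf t.

Lemma gpdfE x : gpdf x = (Num.sqrt (pi *+ 2))^-1 * expR (- (x ^+ 2 / 2)).
Proof.
have -> : gpdf x = normal_peak 1 * normal_fun 0 1 x.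
  by rewrite /gpdf /normal_pdf oner_eq0.
by rewrite /normal_peak /normal_fun expr1n mul1r subr0 mulNr.
Qed.

Lemma gpdf_gt0 x : 0 < gpdf x.
Proof.
by rewrite gpdfE mulr_gt0 ?expR_gt0// invr_gt0 sqrtr_gt0 pmulrn_lgt0// pi_gt0.
Qed.

Lemma gpdfN x : gpdf (- x) = gpdf x.
Proof. by rewrite !gpdfE sqrrN. Qed.

Lemma is_derive_gpdf x : is_derive x 1 gpdf (- x * gpdf x).
Proof.
have -> : gpdf = (fun x => (Num.sqrt (pi *+ 2))^-1 * expR (- (x ^+ 2 / 2))).
  by apply/funext => y; rewrite gpdfE.
have h : is_derive x 1 (fun y : R => - (y ^+ 2 / 2)) (- x).
  have -> : (fun y : R => - (y ^+ 2 / 2)) = (fun y => - 2^-1 * (y * y)).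
    by apply/funext => y; rewrite mulNr mulrC.
  have := is_derive_scaleR (- 2^-1)
    (is_derive_mulR (is_derive_id x (1 : R)) (is_derive_id x (1 : R))).
  by congr is_derive; rewrite /=; field.
have := is_derive_scaleR (Num.sqrt (pi *+ 2))^-1
  (is_derive_compR h (is_derive_expR _)).
by congr is_derive; ring.
Qed.

Lemma gpdf_continuous : continuous gpdf.
Proof. by apply: continuous_normal_pdf; rewrite oner_eq0. Qed.

Lemma gpdf_integrable (A : set R) : measurable A -> leb.-integrable A (EFin \o gpdf).
Proof.
by move=> mA; apply: integrableS (integrable_normal_pdf _ _).
Qed.

Lemma is_derive_gcdf x : is_derive x 1 gcdf (gpdf x).
Proof.
have [||||h1 h2] := @continuous_FTC1 R gpdf (BInfty _ true) x (x + 1).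
- by rewrite ltrDl.
- exact: gpdf_integrable.
- by rewrite ltNyr.
- exact: gpdf_continuous.
apply: DeriveDef; first exact: h1.
by rewrite -derive1E; exact: h2.
Qed.

Lemma gcdf_ge0 x : 0 <= gcdf x.
Proof. by apply: Rintegral_ge0 => t _; exact/ltW/gpdf_gt0. Qed.

Lemma gcdf_increasing x y : x < y -> gcdf x < gcdf y.
Proof.
move=> xy; have [||c _] := @MVT R gcdf gpdf x y xy.
- by move=> z _; exact: is_derive_gcdf.
- by apply: derivable_within_continuous => z _; have [] := is_derive_gcdf z.
by rewrite -subr_gt0 => ->; rewrite mulr_gt0 ?gpdf_gt0 ?subr_gt0.
Qed.

Lemma gcdf_gt0 x : 0 < gcdf x.
Proof.
by rewrite (le_lt_trans (gcdf_ge0 (x - 1)))// gcdf_increasing// ltrBlDr ltrDl.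
Qed.

Lemma gpdf_total : \int[leb]_t gpdf t = 1.
Proof. by rewrite /Rintegral integral_normal_pdf. Qed.

Lemma gcdf0 : gcdf 0 = 2^-1.
Proof.
have sym := @ge0_symfun_integralT R gpdf (fun x => ltW (gpdf_gt0 x))
  gpdf_continuous (fun x => esym (gpdfN x)).
have half : \int[leb]_(t in `[0, +oo[) gpdf t = 2^-1.
  rewrite /Rintegral; move: sym.
  rewrite (_ : [set x : R | 0 <= x] = `[0, +oo[%classic); last first.
    by apply/seteqP; split => x/=; rewrite in_itv/= andbT.
  rewrite integral_normal_pdf; case: (integral _ _ _) => [r| |].
  - rewrite -EFinM => -[e] /=; apply: (@mulfI _ (2 : R)) => //.
    by rewrite -e divff.
  - by rewrite gt0_muley ?lte_fin.
  - by rewrite gt0_muleNy ?lte_fin.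
have := @Rintegral_itvB R gpdf -oo%O +oo%O 0.
rewrite set_itvNyy => /(_ (gpdf_integrable measurableT) isT isT).
rewrite gpdf_total Rintegral_itv_obnd_cbnd; last exact: gpdf_integrable.
by rewrite half /gcdf => /eqP; rewrite subr_eq => /eqP; lra.
Qed.

Lemma gcdfD x : gcdf x + gcdf (- x) = 1.
Proof.
have -> : gcdf x + gcdf (- x) = gcdf 0 + gcdf (- 0).
  apply: (@is_derive_0_is_cst R (fun x => gcdf x + gcdf (- x))) => y.
  have := is_derive_addR (is_derive_gcdf y)
    (is_derive_compR (is_deriveN (is_derive_id y (1 : R))) (is_derive_gcdf (- y))).
  by congr is_derive; rewrite /= gpdfN mulrN1 subrr.
by rewrite oppr0 gcdf0; field.
Qed.

(** The identity as a random variable, so that [gcdf] is recognized as the distribution function of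
    the normal law and inherits its limit at infinity. *)
Let idTR : measurableTypeR R -> R := idfun.

HB.instance Definition _ :=
  @isMeasurableFun.Build _ _ _ _ idTR (@measurable_id _ _ setT).

Lemma gcdf_cvgy : gcdf x @[x --> +oo] --> (1 : R).
Proof.
have := @cvg_cdfy1 _ _ _ (normal_prob (0 : R) 1) (idTR : {RV (normal_prob (0 : R) 1) >-> R}).
rewrite (_ : cdf _ = EFin \o gcdf).
  by move=> /fine_cvg.
apply/funext => x; rewrite /cdf /distribution /pushforward /normal_prob /=.
rewrite /gcdf /Rintegral fineK//; apply: integrable_fin_num => //.
exact: gpdf_integrable.
Qed.

Lemma cvg_affiney (k m : R) : 0 < k -> k * (s - m) @[s --> +oo] --> +oo.
Proof.
move=> k0; apply/cvgryPge => A; near=> s.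
rewrite -ler_pdivrMl// lerBrDr; near: s; apply: nbhs_pinfty_ge; exact: num_real.
Unshelve. all: by end_near. Qed.

Lemma gpdf_cvgy : gpdf x @[x --> +oo] --> (0 : R).
Proof.
have -> : gpdf = (fun x => (Num.sqrt (pi *+ 2))^-1 * gauss_fun ((Num.sqrt 2)^-1 * (x - 0))).
  apply/funext => x; rewrite gpdfE /gauss_fun exprMn subr0 exprVn sqr_sqrtr//.
  by rewrite [2^-1 * _]mulrC.
rewrite -[X in _ --> X](mulr0 (Num.sqrt (pi *+ 2))^-1).
apply: cvgM; first exact: cvg_cst.
apply: (cvg_comp _ _ (cvg_affiney _ _)); last exact: cvg_gauss_fun.
by rewrite invr_gt0 sqrtr_gt0.
Qed.

Lemma integral0y_primitive (f F : R -> R) (l : R) :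
  (forall x, 0 <= x -> 0 <= f x) -> continuous f ->
  F x @[x --> +oo] --> l -> (forall x, is_derive x 1 F (f x)) ->
  \int[leb]_(x in `[0, +oo[) f x = l - F 0.
Proof.
move=> f0 fc Fl Fd; apply: (Rintegral_ge0_continuous_FTC2y f0 _ Fl).
- exact: continuous_subspaceT.
- by move=> x _; have [] := Fd x.
- by apply: cvg_at_right_filter; exact: is_derive_continuous (Fd 0).
- by move=> x _; rewrite derive1E; have [_ ->] := Fd x.
Qed.

Let is_derive_affine (k m x : R) : is_derive x 1 (fun s : R => k * (s - m)) k.
Proof.
have := is_derive_scaleR k (is_derive_addR (is_derive_id x (1 : R)) (is_derive_cst (- m) x (1 : R))).
by congr is_derive; rewrite addr0 mulr1.
Qed.

Let gpdf_affine_continuous (k m : R) : continuous (fun s => gpdf (k * (s - m))).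
Proof.
move=> s; apply: is_derive_continuous.
exact: is_derive_compR (is_derive_affine k m s) (is_derive_gpdf _).
Qed.

Lemma integral0y_gpdf (c k m : R) : 0 <= c -> 0 < k ->
  \int[leb]_(s in `[0, +oo[) (c * gpdf (k * (s - m))) = c * (gcdf (k * m) / k).
Proof.
move=> c0 k0; apply: etrans (@integral0y_primitive (fun s => c * gpdf (k * (s - m)))
  (fun s => c / k * gcdf (k * (s - m))) (c / k * 1) _ _ _ _) _.
- by move=> x _; rewrite mulr_ge0//; exact/ltW/gpdf_gt0.
- by move=> x; apply: cvgM; [exact: cvg_cst|exact: gpdf_affine_continuous].
- apply: cvgM; first exact: cvg_cst.
  by apply: (cvg_comp _ _ (cvg_affiney _ k0)); exact: gcdf_cvgy.
- move=> x; have := is_derive_scaleR (c / k)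
    (is_derive_compR (is_derive_affine k m x) (is_derive_gcdf _)).
  by congr is_derive; field; rewrite gt_eqF.
- rewrite sub0r mulrN -(gcdfD (k * m)); field.
  by rewrite gt_eqF.
Qed.

Lemma integral0y_id_gpdf (c k m : R) : 0 <= c -> 0 < k ->
  \int[leb]_(s in `[0, +oo[) (s * (c * gpdf (k * (s - m)))) =
  c * (m * gcdf (k * m) / k + gpdf (k * m) / k ^+ 2).
Proof.
move=> c0 k0; have kn0 : k != 0 by rewrite gt_eqF.
apply: etrans (@integral0y_primitive (fun s => s * (c * gpdf (k * (s - m))))
  (fun s => c * m / k * gcdf (k * (s - m)) + - c / k ^+ 2 * gpdf (k * (s - m)))
  (c * m / k * 1 + - c / k ^+ 2 * 0) _ _ _ _) _.
- by move=> x x0; rewrite !mulr_ge0//; exact/ltW/gpdf_gt0.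
- move=> x; apply: cvgM; first exact: cvg_id.
  by apply: cvgM; [exact: cvg_cst|exact: gpdf_affine_continuous].
- apply: cvgD; (apply: cvgM; first exact: cvg_cst).
    by apply: (cvg_comp _ _ (cvg_affiney _ k0)); exact: gcdf_cvgy.
  by apply: (cvg_comp _ _ (cvg_affiney _ k0)); exact: gpdf_cvgy.
- move=> x; have := is_derive_addR
    (is_derive_scaleR (c * m / k) (is_derive_compR (is_derive_affine k m x) (is_derive_gcdf _)))
    (is_derive_scaleR (- c / k ^+ 2) (is_derive_compR (is_derive_affine k m x) (is_derive_gpdf _))).
  by congr is_derive; field.
- rewrite sub0r mulrN gpdfN -(gcdfD (k * m)); field.
  exact: kn0.
Qed.

(* mean of the normal law N(mu, 1) conditioned to be nonnegative *)
Definition tmean mu : R := mu + gpdf mu / gcdf mu.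

(** Both integrands are multiples of the normal density at alpha (s - phi), and the normalizing
    factor cancels in the quotient. *)
Lemma stat_avgE (d : nat) (L kappa phi : R) : 0 < kappa ->
  stat_avg d L kappa phi =
  tmean (Num.sqrt kappa * phi) / (Num.sqrt kappa * L ^+ d).
Proof.
move=> k0; set al := Num.sqrt kappa.
have al0 : 0 < al by rewrite sqrtr_gt0.
have c0 : 0 < Num.sqrt (pi *+ 2) :> R by rewrite sqrtr_gt0 pmulrn_lgt0// pi_gt0.
have E s : expR (- (kappa * (s - phi) ^+ 2 / 2)) =
    Num.sqrt (pi *+ 2) * gpdf (al * (s - phi)).
  by rewrite gpdfE mulVKf ?gt_eqF// exprMn sqr_sqrtr// ltW.
rewrite /stat_avg; under eq_Rintegral => s _ do rewrite E.
under [X in _ / (_ * X)]eq_Rintegral => s _ do rewrite E.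
rewrite integral0y_gpdf ?ltW// integral0y_id_gpdf ?ltW// /tmean.
have Q0 := gcdf_gt0 (al * phi).
(* For L ^+ d = 0 both sides are 0, the inverse of 0 being 0. *)
have [->|L0] := eqVneq (L ^+ d) 0; first by rewrite mulr0 mul0r invr0 !mulr0.
by field; rewrite L0 !gt_eqF.
Qed.

Lemma is_derive_tmean mu : is_derive mu 1 tmean (1 + mu * tmean mu - tmean mu ^+ 2).
Proof.
have Q0 : gcdf mu != 0 by rewrite gt_eqF// gcdf_gt0.
have := is_derive_addR (is_derive_id mu (1 : R)) (is_derive_mulR (is_derive_gpdf mu)
  (is_derive_invR Q0 (is_derive_gcdf mu))).
by congr is_derive; rewrite /tmean; field.
Qed.

Lemma tmean_continuous : continuous tmean.
Proof. by move=> mu; exact: is_derive_continuous (is_derive_tmean mu). Qed.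

Lemma tmean_gt_id mu : mu < tmean mu.
Proof. by rewrite ltrDl divr_gt0 ?gpdf_gt0 ?gcdf_gt0. Qed.

Lemma tmean0_sqr : tmean 0 ^+ 2 = 2 / pi.
Proof.
rewrite /tmean add0r gcdf0 invrK gpdfE expr0n/= mul0r oppr0 expR0 mulr1.
rewrite exprMn exprVn sqr_sqrtr; last by rewrite mulrn_wge0// pi_ge0.
have := pi_gt0 R; move: (@pi R) => p p0; rewrite -mulr_natr; field.
by rewrite gt_eqF.
Qed.

(** The variance of the conditioned normal law, equal to the derivative of [tmean]. Its own
    derivative is the third central moment. *)
Definition dtmean mu : R := 1 + mu * tmean mu - tmean mu ^+ 2.

Let pig : 2 <= (pi : R) < 4.
Proof. by have := pihalf_ge1 R; have := pihalf_lt2 R; lra. Qed.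

Lemma is_derive_dtmean mu : is_derive mu 1 dtmean
  (tmean mu + (mu - 2 * tmean mu) * dtmean mu).
Proof.
have tm := is_derive_tmean mu.
have := is_derive_addR (is_derive_cst (1 : R) mu (1 : R))
  (is_derive_addR (is_derive_mulR (is_derive_id mu (1 : R)) tm)
   (is_derive_scaleR (-1) (is_derive_mulR tm tm))).
congr is_derive; last by rewrite /dtmean /=; ring.
by apply/funext => y; rewrite /dtmean /=; ring.
Qed.

(** At a zero of the variance its derivative reduces to [tmean], which is positive; the initial
    value is 1 - 2 / pi. So [barrier_gt0] applies. *)
Lemma dtmean_gt0 mu : 0 < mu -> 0 < dtmean mu.
Proof.
apply: (@barrier_gt0 R dtmean _ (fun x _ => is_derive_dtmean x)).
  rewrite /dtmean mul0r addr0 tmean0_sqr subr_ge0 ler_pdivrMr ?mul1r.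
    by have /andP[] := pig.
  exact: pi_gt0.
by move=> x x0 ->; rewrite mulr0 addr0 (le_lt_trans x0)// tmean_gt_id.
Qed.

Lemma dtmean_ge0 mu : 0 <= mu -> 0 <= dtmean mu.
Proof.
rewrite le_eqVlt => /predU1P[<-|/dtmean_gt0/ltW//].
rewrite /dtmean mul0r addr0 tmean0_sqr subr_ge0 ler_pdivrMr ?mul1r ?pi_gt0//.
by have /andP[] := pig.
Qed.

(* Sampford's inequality: the hazard rate of the normal law is convex. *)
Lemma ddtmean_gt0 mu : 0 < mu -> 0 < tmean mu + (mu - 2 * tmean mu) * dtmean mu.
Proof.
(* The factor tmean mu - mu is the hazard rate, hence positive, and only the sign of the quadratic
   factor is at stake. Its value at 0 is 4 / pi - 1. *)
move=> mu0; rewrite (_ : _ + _ = (tmean mu - mu) * (2 * tmean mu ^+ 2 - mu * tmean mu - 1)); last first.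
  by rewrite /dtmean; ring.
rewrite mulr_gt0 ?subr_gt0 ?tmean_gt_id//.
have tm x := is_derive_tmean x.
have fd x : is_derive x 1 (fun x => 2 * tmean x ^+ 2 - x * tmean x - 1)
    ((4 * tmean x - x) * dtmean x - tmean x).
  have := is_derive_addR (is_derive_addR (is_derive_scaleR 2 (is_derive_mulR (tm x) (tm x)))
    (is_derive_scaleR (-1) (is_derive_mulR (is_derive_id x (1 : R)) (tm x))))
    (is_derive_cst (- 1 : R) x (1 : R)).
  congr is_derive; last by rewrite /dtmean/=; ring.
  by apply/funext => y /=; ring.
rewrite -subr_gt0.
apply: (@barrier_gt0 R (fun x => 2 * tmean x ^+ 2 - x * tmean x - 1) _
  (fun x _ => fd x) _ _ mu mu0).
  rewrite mul0r subr0 tmean0_sqr subr_ge0 mulrA ler_pdivlMr ?pi_gt0// mul1r.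
  by have /andP[] := pig; lra.
(* On the zero set x tmean x = 2 (tmean x)^2 - 1, which makes the variance (tmean x)^2 and the
   derivative 2 (tmean x)^3. *)
move=> x x0 fx0.
have xt := le_lt_trans x0 (tmean_gt_id x).
have -> : dtmean x = tmean x ^+ 2 by rewrite /dtmean; lra.
rewrite (_ : _ - _ = tmean x * (4 * tmean x ^+ 2 - x * tmean x - 1)); last by ring.
rewrite mulr_gt0// (_ : _ - 1 = 2 * tmean x ^+ 2); last by lra.
by rewrite mulr_gt0// exprn_gt0.
Qed.

End gauss.

(** * Affine changes of variables on the torus *)

Section circle.
Context (R : realType).
Local Notation leb := (@lebesgue_measure R).
Implicit Types (a t : R) (A : set (measurableTypeR R)).

Lemma measurable_shiftR a :
  measurable_fun setT ((fun t => t + a) : measurableTypeR R -> measurableTypeR R).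
Proof.
exact: (@measurable_realfun.measurable_funD _ _ _ setT (fun t : R => t) (fun=> a)).
Qed.

Lemma lebesgue_measure_shift a A : measurable A ->
  leb ((fun t => t + a) @^-1` A) = leb A.
Proof.
move=> mA; have mf := measurable_shiftR a.
apply/esym/(@lebesgue_measure_unique R (pushforward leb _)) => //= _ [[u v]] _ <-.
rewrite /pushforward (_ : _ @^-1` _ = `]u - a, v - a]%classic); last first.
  by apply/seteqP; split => t /=; rewrite !in_itv/= ltrBlDr lerBrDr.
rewrite !lebesgue_measure_itv/= !lte_fin ltrD2r; case: ifP => // _.
by rewrite -!EFinB; congr EFin; ring.
Qed.

Variable L : R.
Hypothesis L0 : 0 < L.

Definition circle_shift a t : R := if t < L - a then t + a else t + a - L.

Lemma measurable_circle_shift a : measurable_fun setT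
  (circle_shift a : measurableTypeR R -> measurableTypeR R).
Proof.
apply: measurable_fun_ifT => /=.
- exact: (@measurable_realfun.measurable_fun_ltr _ _ _ setT (fun t : R => t) (fun=> L - a)).
- exact: measurable_shiftR.
- under eq_fun do rewrite -addrA; exact: measurable_shiftR.
Qed.

Lemma measurable_opprR a :
  measurable_fun setT ((fun t => a - t) : measurableTypeR R -> measurableTypeR R).
Proof.
exact: (@measurable_realfun.measurable_funB _ _ _ setT (fun=> a) (fun t : R => t)).
Qed.

Lemma preimage_measurable (f : measurableTypeR R -> measurableTypeR R) A :
  measurable_fun setT f -> measurable A -> measurable (f @^-1` A).
Proof. by move=> mf mA; rewrite -[X in measurable X]setTI; exact: mf. Qed.

Lemma circle_measure_shift a A : 0 <= a < L -> measurable A ->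
  circle_measure L (circle_shift a @^-1` A) = circle_measure L A.
Proof.
move=> /andP[a0 aL] mA; rewrite /circle_measure /mrestr.
have mi (u v : R) : measurable (`[u, v[%classic : set (measurableTypeR R)) by [].
have mAi u v : measurable (A `&` `[u, v[) by exact: measurableI.
rewrite (_ : _ `&` _ = ((fun t => t + a) @^-1` (A `&` `[a, L[)) `|`
    ((fun t => t + (a - L)) @^-1` (A `&` `[0, a[))); last first.
  apply/seteqP; rewrite /circle_shift; split=> t /=; rewrite !in_itv/=.
    move=> -[+ /andP[t0 tL]]; case: ifPn => [ta At|]; [left|rewrite -leNgt => ta At; right].
      by split => //; apply/andP; split; lra.
    by rewrite addrA; split => //; apply/andP; split; lra.
  move=> [[At /andP[t1 t2]]|[At /andP[t1 t2]]].
    by rewrite (_ : t < L - a); [split => //; apply/andP; split|]; lra.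
  rewrite (_ : t < L - a = false); last by apply/negbTE; rewrite -leNgt; lra.
  by rewrite -addrA; split => //; apply/andP; split; lra.
rewrite measureU; last 3 first.
- by apply: preimage_measurable; [exact: measurable_shiftR|exact: mAi].
- by apply: preimage_measurable; [exact: measurable_shiftR|exact: mAi].
- apply/seteqP; split => t //= [[_ +] [_]]; rewrite !in_itv/= => /andP[t1 t2] /andP[t3 t4].
  by lra.
transitivity (leb (A `&` `[a, L[) + leb (A `&` `[0%R, a[))%E.
  by congr (_ + _)%E; exact: lebesgue_measure_shift.
rewrite -measureU//; last first.
  apply/seteqP; split => t //= [[_ +] [_]]; rewrite !in_itv/= => /andP[t1 t2] /andP[t3 t4].
  by lra.
congr (leb _); rewrite -setIUr setUC; congr (A `&` _).
apply/seteqP; split => t /=; rewrite !in_itv/=.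
  by move=> [/andP[t1 t2]|/andP[t1 t2]]; apply/andP; split; lra.
by move=> /andP[t1 t2]; case: (ltP t a) => ta; [left|right]; rewrite ?t1 ?t2.
Qed.

(** The reflection exchanges [0, L) and (0, L], which differ by two points of measure 0. *)
Lemma circle_measure_opp A : measurable A ->
  circle_measure L ((fun t => L - t) @^-1` A) = circle_measure L A.
Proof.
move=> mA; rewrite /circle_measure /mrestr.
have mi (i : interval R) : measurable ([set` i] : set (measurableTypeR R)) by [].
have mAi i : measurable (A `&` [set` i]) := measurableI _ _ mA (mi i).
rewrite (_ : _ `&` _ = -%R @^-1` ((fun t => t + L) @^-1` (A `&` `]0, L]))); last first.
  apply/seteqP; split => t /=; rewrite !in_itv/= [- t + L]addrC.
    by move=> [At /andP[t0 tL]]; split => //; apply/andP; split; lra.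
  move=> [At /andP[t0 tL]]; split => //; apply/andP; split; [lra|].
  lra.
rewrite -/(pushforward leb (-%R : _ -> measurableTypeR R) _) lebesgue_measureN; last first.
  by apply: preimage_measurable; [exact: measurable_shiftR|exact: mAi].
rewrite (lebesgue_measure_shift L (mAi _)).
have H x i : A `&` [set x] `<=` [set x] by move=> y [].
have null (x : R) : leb (A `&` [set x]) = 0.
  apply/eqP; rewrite eq_le measure_ge0 andbT -(lebesgue_measure_set1 x).
  by apply: le_measure; rewrite ?inE//; apply: measurableI.
have split1 : A `&` `[0, L[ = (A `&` [set 0]) `|` (A `&` `]0, L[).
  by rewrite -setIUr (@setU1itv _ _ _ _ false)// bnd_simp.
have split2 : A `&` `]0, L] = (A `&` `]0, L[) `|` (A `&` [set L]).
  by rewrite -setIUr setUitv1// bnd_simp.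
have U1 : leb (A `&` [set 0] `|` A `&` `]0%R, L[) =
    (leb (A `&` [set 0%R]) + leb (A `&` `]0%R, L[))%E.
  apply: measureU => //; first exact: measurableI.
  by apply/seteqP; split => t //= [[_ ->] [_]]; rewrite in_itv/= ltxx.
have U2 : leb (A `&` `]0%R, L[ `|` A `&` [set L]) =
    (leb (A `&` `]0%R, L[) + leb (A `&` [set L]))%E.
  apply: measureU => //; first exact: measurableI.
  by apply/seteqP; split => t //= [[_ +] [_ tL]]; rewrite tL in_itv/= ltxx andbF.
by rewrite split1 split2 U1 U2 !null add0e adde0.
Qed.

(** Periodicity replaces a by its residue b in [0, L), for which the translation rearranges two
    pieces of the cell. *)
Lemma circle_integral_shift (g : R -> \bar R) a :
  measurable_fun [set: R] g -> (forall t, 0 <= g t)%E ->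
  (forall t, g (t + L) = g t) ->
  (\int[circle_measure L]_t g (t + a)%R = \int[circle_measure L]_t g t)%E.
Proof.
move=> mg g0 gL.
have gLn t (n : nat) : g (t + L *+ n) = g t.
  by elim: n => [|n IH]; rewrite ?mulr0n ?addr0// mulrSr addrA gL.
have gLz t (z : int) : g (t + L *~ z) = g t.
  case: z => n; first exact: gLn.
  by rewrite NegzE mulrNz -(gLn (t - _) n.+1) subrK.
pose z := Num.floor (a / L); pose b := a - L *~ z.
have b0L : 0 <= b < L.
  have /andP[z1 z2] := floor_itv (a / L).
  rewrite /b -mulrzr subr_ge0 ltrBlDl -[X in _ < _ + X]mulr1 -mulrDr.
  by rewrite -ler_pdivlMl// mulrC z1/= mulrC -ltr_pdivrMr// -intrD1.
have shiftE t : g (t + a) = g (circle_shift b t).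
  rewrite (_ : t + a = t + b + L *~ z); last by rewrite /b; ring.
  rewrite gLz /circle_shift; case: ifP => // _.
  by rewrite -[RHS]gL subrK.
under eq_integral => t _ do rewrite shiftE.
rewrite -(@ge0_integral_pushforward _ _ _ _ R _ (measurable_circle_shift b) (circle_measure L) setT g)//.
apply: eq_measure_integral => [|mf A mA _]; first exact: measurable_circle_shift.
exact: circle_measure_shift.
Qed.

Lemma circle_integral_opp (g : R -> \bar R) :
  measurable_fun [set: R] g -> (forall t, 0 <= g t)%E ->
  (forall t, g (t + L) = g t) ->
  (\int[circle_measure L]_t g (- t)%R = \int[circle_measure L]_t g t)%E.
Proof.
move=> mg g0 gL.
under eq_integral => t _ do rewrite -(gL (- t)) [(- t + L)%R]addrC.
rewrite -(@ge0_integral_pushforward _ _ _ _ R _ (measurable_opprR L) (circle_measure L) setT g)//.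
apply: eq_measure_integral => [|mf A mA _]; first exact: measurable_opprR.
exact: circle_measure_opp.
Qed.

End circle.

Section torus_affine.
Context (R : realType).
Variable L : R.
Hypothesis L0 : 0 < L.

Lemma cons_rV0 n (p : measurableTypeR R * 'rV[R]_n) : cons_rV p ord0 ord0 = p.1.
Proof.
have -> : (ord0 : 'I_n.+1) = lshift n (ord0 : 'I_1) by exact: val_inj.
by rewrite /cons_rV [LHS](@row_mxEl _ 1 1 n) mxE.
Qed.

Lemma cons_rVS n (p : measurableTypeR R * 'rV[R]_n) (j : 'I_n) :
  cons_rV p ord0 (lift ord0 j) = p.2 ord0 j.
Proof.
have -> : lift ord0 j = rshift 1 j by exact: val_inj.
by rewrite /cons_rV [LHS](@row_mxEr _ 1 1 n).
Qed.

Lemma torus_integralS n (f : 'rV[R]_n.+1 -> \bar R) : measurable_fun setT f ->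
  (forall x, 0 <= f x)%E ->
  (\int[torus_measure L n.+1]_x f x =
   \int[circle_measure L]_t \int[torus_measure L n]_y f (cons_rV (t, y)))%E.
Proof.
move=> mf f0.
transitivity (\int[(circle_measure L \x torus_measure L n)%E]_p f (cons_rV p))%E.
  by rewrite -(@ge0_integral_pushforward _ _ _ _ R _ (@measurable_cons_rV R n) _ setT f)//.
rewrite (fubini_tonelli1 (fun p => f (cons_rV p)))//.
by apply: measurableT_comp => //; exact: measurable_cons_rV.
Qed.

Lemma torus_measureT n : torus_measure L n setT = (L ^+ n)%:E.
Proof.
elim: n => [|n IH]; first by rewrite /= diracT.
rewrite /= /torus_step /pushforward preimage_setT -setXTT.
transitivity (circle_measure L setT * torus_measure L n setT)%E.
  exact: product_measure1E.
rewrite IH /circle_measure /mrestr setTI lebesgue_measure_itv/= lte_fin L0.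
by rewrite -EFinD subr0 -EFinM exprS.
Qed.

(** Common form of the changes of variables in use: translations, the maps [refl x] and the sign
    changes [flip i]. *)
Definition affine n (e a x : 'rV[R]_n) : 'rV[R]_n :=
  \row_i (e ord0 i * x ord0 i + a ord0 i).

Definition signs n (e : 'rV[R]_n) := forall i, e ord0 i = 1 \/ e ord0 i = -1.

Lemma measurable_affine n (e a : 'rV[R]_n) : measurable_fun setT (affine e a).
Proof.
apply/measurable_fun_rVP => i; rewrite /affine.
under eq_fun do rewrite mxE.
apply: measurable_funD => //; apply: measurable_funM => //.
exact: measurable_coord_rV.
Qed.

Definition tail_rV n (e : 'rV[R]_n.+1) : 'rV[R]_n := \row_j e ord0 (lift ord0 j).

Lemma affine_cons n (e a : 'rV[R]_n.+1) t y : affine e a (cons_rV (t, y)) =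
  cons_rV (e ord0 ord0 * t + a ord0 ord0, affine (tail_rV e) (tail_rV a) y).
Proof.
apply/rowP => i; case: (unliftP ord0 i) => [j ->|->].
  by rewrite [LHS]mxE !cons_rVS !mxE.
by rewrite [LHS]mxE !cons_rV0.
Qed.

Lemma periodic_cons0 (T : Type) n (f : 'rV[R]_n.+1 -> T) t y :
  (forall i x, f (x + L *: unit_vec R i) = f x) ->
  f (cons_rV (t + L, y)) = f (cons_rV (t, y)).
Proof.
move=> fL; rewrite -[RHS](fL ord0); congr f; apply/rowP => i.
case: (unliftP ord0 i) => [j ->|->].
  by rewrite [RHS]mxE !cons_rVS !mxE /= mulr0 addr0.
by rewrite [RHS]mxE !cons_rV0 !mxE /= mulr1.
Qed.

Lemma periodic_consS (T : Type) n (f : 'rV[R]_n.+1 -> T) t y j :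
  (forall i x, f (x + L *: unit_vec R i) = f x) ->
  f (cons_rV (t, y + L *: unit_vec R j)) = f (cons_rV (t, y)).
Proof.
move=> fL; rewrite -[RHS](fL (lift ord0 j)); congr f; apply/rowP => i.
case: (unliftP ord0 i) => [k ->|->].
  by rewrite [RHS]mxE !cons_rVS !mxE /= (inj_eq lift_inj).
by rewrite [RHS]mxE !cons_rV0 !mxE /= mulr0 addr0.
Qed.

(** Induction on the dimension by Tonelli: the map acts on each coordinate separately, so the circle
    case settles the first one and the induction hypothesis the others. *)
Lemma torus_integral_affine_ge0 n (e a : 'rV[R]_n) (f : 'rV[R]_n -> \bar R) :
  signs e -> measurable_fun setT f -> (forall x, 0 <= f x)%E ->
  (forall i x, f (x + L *: unit_vec R i) = f x) ->
  (\int[torus_measure L n]_x f (affine e a x) = \int[torus_measure L n]_x f x)%E.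
Proof.
elim: n => [|n IH] in e a f *.
  move=> _ _ _ _; apply: eq_integral => x _; congr f.
  by apply/rowP => -[].
move=> se mf f0 fL.
have mfa : measurable_fun setT (f \o affine e a).
  by apply: measurableT_comp => //; exact: measurable_affine.
rewrite (torus_integralS mfa (fun x => f0 _)) (torus_integralS mf f0).
have mcons t : measurable_fun setT (fun y : 'rV[R]_n => cons_rV (t, y)).
  apply: measurableT_comp; first exact: measurable_cons_rV.
  exact: measurable_fun_pair.
pose g t := (\int[torus_measure L n]_y f (cons_rV (t, y)))%E.
have gE t : (\int[torus_measure L n]_y f (affine e a (cons_rV (t, y))))%E =
    g (e ord0 ord0 * t + a ord0 ord0).
  under eq_integral => y _ do rewrite affine_cons.
  apply: (IH _ _ (fun y => f (cons_rV (_, y)))) => //.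
  - by move=> i; rewrite mxE; exact: se.
  - by apply: measurableT_comp.
  - by move=> i x; exact: periodic_consS.
under eq_integral => t _ do rewrite gE.
have mg : measurable_fun [set: R] g.
  apply: (@measurable_fun_fubini_tonelli_F _ _ _ _ R (torus_measure L n)
    (fun p => f (cons_rV p))) => //.
  by apply: measurableT_comp => //; exact: measurable_cons_rV.
have g0 t : (0 <= g t)%E by exact: integral_ge0.
have gL t : g (t + L) = g t.
  by apply: eq_integral => y _; exact: periodic_cons0.
case: (se ord0) => ->.
  under eq_integral => t _ do rewrite mul1r.
  exact: circle_integral_shift.
transitivity (\int[circle_measure L]_t (fun t : R => g (t + a ord0 ord0)%R) (- t)%R)%E.
  by apply: eq_integral => t _; rewrite mulN1r.
apply: etrans (circle_integral_opp L0 (g := fun t : R => g (t + a ord0 ord0)) _ _ _) _.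
- apply: measurableT_comp => //; exact: measurable_shiftR.
- by move=> t; exact: g0.
- by move=> t; rewrite addrAC gL.
- exact: circle_integral_shift.
Qed.

Lemma torus_integral_affine n (e a : 'rV[R]_n) (f : 'rV[R]_n -> \bar R) :
  signs e -> measurable_fun setT f ->
  (forall i x, f (x + L *: unit_vec R i) = f x) ->
  (\int[torus_measure L n]_x f (affine e a x) = \int[torus_measure L n]_x f x)%E.
Proof.
move=> se mf fL; rewrite integralE [RHS]integralE; congr (_ - _)%E.
- rewrite -(@torus_integral_affine_ge0 _ e a f^\+%E) => //.
  + by apply: eq_integral => x _; rewrite !funeposE.
  + exact: measurable_funepos.
  + by move=> i x; rewrite !funeposE fL.
- rewrite -(@torus_integral_affine_ge0 _ e a f^\-%E) => //.
  + by apply: eq_integral => x _; rewrite !funenegE.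
  + exact: measurable_funeneg.
  + by move=> i x; rewrite !funenegE fL.
Qed.

End torus_affine.

(** * Square integrable functions and density *)

Section square_integrable.
Context d (T : measurableType d) (R : realType).
Variable mu : {finite_measure set T -> \bar R}.
Implicit Types (f g h : T -> R) (k B e : R).

Local Notation intR f := (\int[mu]_x f x).

Lemma integrableRD f g : mu.-integrable setT (EFin \o f) ->
  mu.-integrable setT (EFin \o g) ->
  mu.-integrable setT (EFin \o (fun x => f x + g x)).
Proof. by move=> fi gi; exact: (integrableD measurableT fi gi). Qed.

Lemma integrableRZ k f : mu.-integrable setT (EFin \o f) ->
  mu.-integrable setT (EFin \o (fun x => k * f x)).
Proof. by move=> fi; exact: (integrableZl measurableT k fi). Qed.

Lemma le_integrableR f g : measurable_fun setT f -> (forall x, `|f x| <= g x) ->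
  mu.-integrable setT (EFin \o g) -> mu.-integrable setT (EFin \o f).
Proof.
move=> mf fg; apply: le_integrable => //; first exact/measurable_EFinP.
by move=> x _ /=; rewrite lee_fin (le_trans (fg x))// ler_norm.
Qed.

Definition sqint f := measurable_fun setT f /\
  mu.-integrable setT (EFin \o (fun x => f x ^+ 2)).

Definition ip f g : R := intR (fun x => f x * g x).

Lemma bounded_integrable f B : measurable_fun setT f -> bounded_by f B ->
  mu.-integrable setT (EFin \o f).
Proof.
move=> mf fB; apply: (@le_integrableR _ (fun=> B)) => //.
by apply: finite_measure_integrable_cst.
Qed.

Lemma bounded_sqint f B : measurable_fun setT f -> bounded_by f B -> sqint f.
Proof.
move=> mf fB; split => //; apply: (@bounded_integrable _ (B ^+ 2)).
  exact: measurable_funX.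
move=> x; rewrite normrX lerXn2r// ?nnegrE//; exact: le_trans (fB x).
Qed.

Lemma sqint_mul_integrable f g : sqint f -> sqint g ->
  mu.-integrable setT (EFin \o (fun x => f x * g x)).
Proof.
move=> [mf f2] [mg g2].
apply: (@le_integrableR _ (fun x => f x ^+ 2 + g x ^+ 2)).
- exact: measurable_funM.
- move=> x; rewrite normrM -[f x ^+ 2]real_normK ?num_real//.
  rewrite -[g x ^+ 2]real_normK ?num_real//.
  have := sqr_ge0 (`|f x| - `|g x|); have := mulr_ge0 (normr_ge0 (f x)) (normr_ge0 (g x)).
  by rewrite sqrrB; lra.
- exact: integrableRD.
Qed.

Lemma sqint1 : sqint (fun=> 1).
Proof. by apply: (@bounded_sqint _ 1) => // x; rewrite normr1. Qed.

Lemma sqint_integrable f : sqint f -> mu.-integrable setT (EFin \o f).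
Proof.
move=> fs; have := sqint_mul_integrable fs sqint1.
by congr (_.-integrable _ (_ \o _)); apply/funext => x; rewrite mulr1.
Qed.

Lemma le_sqint f g : measurable_fun setT f -> (forall x, `|f x| <= `|g x|) ->
  sqint g -> sqint f.
Proof.
move=> mf fg [mg g2]; split => //; apply: le_integrableR g2.
  exact: measurable_funX.
move=> x; rewrite normrX -[leRHS]real_normK ?num_real//.
by rewrite lerXn2r// ?nnegrE.
Qed.

Lemma sqintD f g : sqint f -> sqint g -> sqint (fun x => f x + g x).
Proof.
move=> [mf f2] [mg g2]; split; first exact: measurable_funD.
apply: (@le_integrableR _ (fun x => 2 * f x ^+ 2 + 2 * g x ^+ 2)).
- by apply: measurable_funX; exact: measurable_funD.
- move=> x; rewrite ger0_norm ?sqr_ge0//.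
  by have := sqr_ge0 (f x - g x); rewrite sqrrB sqrrD; lra.
- by apply: integrableRD; exact: integrableRZ.
Qed.

Lemma sqintZ k f : sqint f -> sqint (fun x => k * f x).
Proof.
move=> [mf f2]; split; first exact: measurable_funM.
have := integrableRZ (k ^+ 2) f2.
by congr (_.-integrable _ (_ \o _)); apply/funext => x; rewrite exprMn.
Qed.

Lemma sqintB f g : sqint f -> sqint g -> sqint (fun x => f x - g x).
Proof.
move=> fs gs; have := sqintD fs (sqintZ (-1) gs).
by congr sqint; apply/funext => x; rewrite mulN1r.
Qed.

Lemma sqint_sum (I : Type) (s : seq I) (F : I -> T -> R) :
  (forall i, sqint (F i)) -> sqint (fun x => \sum_(i <- s) F i x).
Proof.
move=> Fs; elim: s => [|i s IH].
  under eq_fun do rewrite big_nil.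
  by apply: (@bounded_sqint _ 0) => // x; rewrite normr0.
by under eq_fun do rewrite big_cons; exact: sqintD.
Qed.

Lemma ipC f g : ip f g = ip g f.
Proof. by apply: eq_Rintegral => x _; rewrite mulrC. Qed.

Lemma ipDl f g h : sqint f -> sqint g -> sqint h ->
  ip (fun x => f x + g x) h = ip f h + ip g h.
Proof.
move=> fs gs hs; rewrite /ip -RintegralD//; try exact: sqint_mul_integrable.
by apply: eq_Rintegral => x _; rewrite mulrDl.
Qed.

Lemma ipZl k f h : sqint f -> sqint h -> ip (fun x => k * f x) h = k * ip f h.
Proof.
move=> fs hs; rewrite /ip -RintegralZl//; last exact: sqint_mul_integrable.
by apply: eq_Rintegral => x _; rewrite mulrA.
Qed.

Lemma ipBl f g h : sqint f -> sqint g -> sqint h ->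
  ip (fun x => f x - g x) h = ip f h - ip g h.
Proof.
move=> fs gs hs; rewrite -[- ip g h]mulN1r -ipZl// -ipDl//; last exact: sqintZ.
by apply: eq_Rintegral => x _; rewrite mulN1r.
Qed.

Lemma ip0l h : ip (fun=> 0) h = 0.
Proof.
rewrite /ip; under eq_Rintegral do rewrite mul0r.
by rewrite Rintegral_cst// mul0r.
Qed.

Lemma ip_suml (I : Type) (s : seq I) (F : I -> T -> R) h :
  (forall i, sqint (F i)) -> sqint h ->
  ip (fun x => \sum_(i <- s) F i x) h = \sum_(i <- s) ip (F i) h.
Proof.
move=> Fs hs; elim: s => [|i s IH].
  rewrite big_nil; under [X in ip X _]eq_fun do rewrite big_nil.
  exact: ip0l.
rewrite big_cons -IH -ipDl//; last exact: sqint_sum.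
by congr ip; apply/funext => x; rewrite big_cons.
Qed.

Lemma ip_ge0 f : 0 <= ip f f.
Proof. by apply: Rintegral_ge0 => x _; rewrite -expr2 sqr_ge0. Qed.

Lemma le_ip f g k : sqint f -> sqint g -> (forall x, f x ^+ 2 <= k * g x ^+ 2) ->
  ip f f <= k * ip g g.
Proof.
move=> fs gs fg; rewrite -ipZl// /ip; apply: le_Rintegral => //.
- exact: sqint_mul_integrable.
- exact: sqint_mul_integrable (sqintZ _ gs) gs.
- by move=> x _; rewrite -expr2 -mulrA -expr2.
Qed.

(** Integral form of (u + v)^2 <= 2 u^2 + 2 v^2: the constant 2 is the price for working with
    squared distances throughout. *)
Lemma ip_triangle f g h : sqint f -> sqint g -> sqint h ->
  ip (fun x => f x - h x) (fun x => f x - h x) <=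
  2 * ip (fun x => f x - g x) (fun x => f x - g x) +
  2 * ip (fun x => g x - h x) (fun x => g x - h x).
Proof.
move=> fs gs hs; set u := (fun x => f x - g x); set v := (fun x => g x - h x).
have us : sqint u by exact: sqintB.
have vs : sqint v by exact: sqintB.
have fhs := sqintB fs hs.
rewrite -!ipZl// /ip -RintegralD//; last 2 first.
- exact: sqint_mul_integrable (sqintZ _ us) us.
- exact: sqint_mul_integrable (sqintZ _ vs) vs.
apply: le_Rintegral => //.
- exact: sqint_mul_integrable.
- apply: integrableRD; apply: sqint_mul_integrable => //; exact: sqintZ.
move=> x _; rewrite (_ : f x - h x = u x + v x); last by rewrite /u /v; ring.
by rewrite -subr_ge0 [leRHS](_ : _ = (u x - v x) ^+ 2) ?sqr_ge0//; ring.
Qed.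

(** Cauchy-Schwarz in the weighted form |f| <= (e + f^2 / e) / 2, integrated against the bound on
    g. *)
Lemma ip_le_bounded f g B e : sqint f -> measurable_fun setT g ->
  bounded_by g B -> 0 < e -> 0 <= B -> ip f f <= e ^+ 2 ->
  `|ip f g| <= B * e * (fine (mu setT) + 1) / 2.
Proof.
move=> fs mg gB e0 B0 fe; have gs : sqint g := bounded_sqint mg gB.
rewrite (le_trans (le_normr_Rintegral _ (sqint_mul_integrable fs gs)))//.
have i1 : mu.-integrable setT (EFin \o (fun=> B * e / 2)) by exact: finite_measure_integrable_cst.
have i2 := integrableRZ (B / (2 * e)) (sqint_mul_integrable fs fs).
rewrite (@le_trans _ _ (intR (fun x => B * e / 2 + B / (2 * e) * (f x * f x))))//.
  apply: le_Rintegral => //.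
  - have := sqint_mul_integrable fs gs => /integrable_norm.
    by apply: eq_integrable.
  - exact: integrableRD.
  move=> x _; rewrite normrM (@le_trans _ _ (`|f x| * B))// ?ler_wpM2l//.
  rewrite (_ : _ + _ = B * ((e ^+ 2 + `|f x| ^+ 2) / (2 * e))); last first.
    by rewrite real_normK ?num_real//; field; rewrite gt_eqF.
  rewrite mulrC ler_wpM2l// ler_pdivlMr ?mulr_gt0//.
  by have := sqr_ge0 (e - `|f x|); rewrite sqrrB; lra.
rewrite RintegralD// Rintegral_cst// RintegralZl//; last exact: sqint_mul_integrable.
rewrite -/(ip f f) (@le_trans _ _ (B * e / 2 * fine (mu setT) + B / (2 * e) * e ^+ 2))//.
  by rewrite lerD2l ler_wpM2l// divr_ge0// mulr_ge0// ltW.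
rewrite le_eqVlt; apply/orP; left; apply/eqP; field.
by rewrite gt_eqF.
Qed.

Lemma dominated_ip (u : nat -> T -> R) f h : sqint h -> measurable_fun setT f ->
  (forall n, measurable_fun setT (u n)) -> (forall n x, `|u n x| <= h x) ->
  (forall x, u n x @[n --> \oo] --> f x) ->
  ip (fun x => f x - u n x) (fun x => f x - u n x) @[n --> \oo] --> (0 : R).
Proof.
move=> hs mf mu_ uh uf.
have fh x : `|f x| <= h x.
  by apply: (cvgr_to_le (cvg_norm (uf x))); apply: nearW => n; exact: uh.
have h4 : mu.-integrable setT (EFin \o (fun x => 4 * (h x * h x))).
  by apply: integrableRZ; exact: sqint_mul_integrable.
have mfu n : measurable_fun setT (fun x => f x - u n x) by exact: measurable_funB.
have [||||| _ _] := @dominated_convergence _ T R mu setT measurableT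
    (fun n => EFin \o (fun x => (f x - u n x) * (f x - u n x))) (fun=> 0%E)
    (EFin \o (fun x => 4 * (h x * h x))).
- by move=> n; apply/measurable_EFinP; exact: measurable_funM.
- exact: measurable_cst.
- apply: aeW => x _; apply: cvg_EFin; first exact: nearW.
  rewrite (_ : 0 = (f x - f x) * (f x - f x)); last by rewrite subrr mulr0.
  by apply: cvgM; apply: cvgB => //; exact: cvg_cst.
- exact: h4.
- apply: aeW => x n _ /=; rewrite lee_fin normrM.
  have dfu : `|f x - u n x| <= 2 * h x.
    by rewrite (le_trans (ler_normB _ _))// mulr2n mulrDl mul1r lerD.
  by rewrite (_ : 4 * _ = (2 * h x) * (2 * h x)) ?ler_pM//; ring.
by rewrite integral0 => /fine_cvg.
Qed.

End square_integrable.

(** * Polynomials tending to the indicator of y < 1/2 *)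

Section threshold_polynomial.
Context (R : realType).
Implicit Types (t u y z : R).

Lemma bernoulli_ineq t n : -1 <= t -> 1 + n%:R * t <= (1 + t) ^+ n.
Proof.
move=> t1; elim: n => [|n IH]; first by rewrite mul0r addr0 expr0.
rewrite exprS (le_trans _ (ler_wpM2l _ IH))//; last by rewrite -lerBlDl sub0r.
rewrite -subr_ge0 -natr1 (_ : _ - _ = n%:R * t ^+ 2); last by ring.
by rewrite mulr_ge0// sqr_ge0.
Qed.

Lemma cvg_natr_geometric z : 0 <= z < 1 -> n%:R * z ^+ n @[n --> \oo] --> (0 : R).
Proof.
rewrite le_eqVlt => /andP[/predU1P[<- _|z0 z1]].
  apply/cvg_ballP => e e0; exists 1%N => // n /= n1.
  by rewrite expr0n gtn_eqF// mulr0; exact: ballxx.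
(* As z^n = w^n w^n, Bernoulli bounds n w^n by 1 / t and the remaining factor tends to 0. *)
pose w := Num.sqrt z; pose t := w^-1 - 1.
have w0 : 0 < w by rewrite sqrtr_gt0.
have w1 : w < 1 by rewrite -(sqrtr1 R) ltr_sqrt.
have t0 : 0 < t by rewrite subr_gt0 invf_gt1.
have wt : w^-1 = 1 + t by rewrite /t addrC subrK.
apply: (@squeeze_cvgr _ _ _ _ (fun=> 0) (fun n => t^-1 * w ^+ n)).
- apply: nearW => n; apply/andP; split; first by rewrite mulr_ge0// exprn_ge0// ltW.
  rewrite (_ : z ^+ n = w ^+ n * w ^+ n); last first.
    by rewrite -exprMn -expr2 sqr_sqrtr// ltW.
  have wn0 : 0 <= w ^+ n by rewrite exprn_ge0// ltW.
  rewrite mulrA ler_wpM2r// -[leRHS]mul1r ler_pdivlMr//.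
  have := bernoulli_ineq n (le_trans (lerN10 R) (ltW t0)).
  rewrite -wt => /(ler_wpM2r wn0); rewrite exprVn mulVf ?expf_neq0 ?gt_eqF//.
  by apply: le_trans; rewrite mulrDl mul1r mulrAC lerDr.
- exact: cvg_cst.
- rewrite -[X in _ --> X](mulr0 t^-1); apply: cvgM; first exact: cvg_cst.
  by apply: cvg_expr; rewrite ger0_norm// ltW.
Unshelve. all: by end_near. Qed.

(** The polynomials (1 - y^n)^(2^n) familiar from proofs of the Stone-Weierstrass theorem tend to 1
    / e at y = 1/2; the additional factor n in the exponent brings this limit to 0, so that the
    limit is an indicator everywhere on [0, 1]. *)
Definition threshold_poly n y := (1 - y ^+ n) ^+ (n * 2 ^ n).

Lemma threshold_poly_itv n y : 0 <= y <= 1 -> 0 <= threshold_poly n y <= 1.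
Proof.
move=> /andP[y0 y1]; rewrite /threshold_poly.
have yn : y ^+ n <= 1 by rewrite exprn_ile1.
by rewrite exprn_ge0 ?subr_ge0//= exprn_ile1 ?subr_ge0// gerBl exprn_ge0.
Qed.

(* The dichotomy at 1/2 comes from [2 ^ n * y ^ n]: Bernoulli's inequality gives
   [1 - n (2 y) ^ n] as a lower bound and [1 / (1 + n (2 y) ^ n)] as an upper bound *)
Lemma cvg_threshold_poly y : 0 <= y <= 1 ->
  threshold_poly n y @[n --> \oo] --> ((y < 2^-1)%R%:R : R).
Proof.
move=> y01; have /andP[y0 y1] := y01; case: ltP => y2.
  apply: (@squeeze_cvgr _ _ _ _ (fun n => 1 - n%:R * (2 * y) ^+ n) (fun=> 1)).
  - apply: nearW => n; have /andP[_ ->] := threshold_poly_itv n y01; rewrite andbT.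
    have yn : y ^+ n <= 1 by rewrite exprn_ile1.
    have := @bernoulli_ineq (- y ^+ n) (n * 2 ^ n) _; rewrite lerN2 => /(_ yn).
    by apply: le_trans; rewrite natrM natrX mulrN -mulrA exprMn.
  - rewrite -[X in _ --> X]subr0; apply: cvgB; first exact: cvg_cst.
    by apply: cvg_natr_geometric; rewrite mulr_ge0//= mulrC -ltr_pdivlMr// mul1r.
  - exact: cvg_cst.
apply: (@squeeze_cvgr _ _ _ _ (fun=> 0) (fun n => (n.+1%:R)^-1)).
- apply: nearW => n; have /andP[-> _] := threshold_poly_itv n y01 => /=.
  have yn0 : 0 <= y ^+ n by rewrite exprn_ge0.
  have yn : y ^+ n <= 1 by rewrite exprn_ile1.
  rewrite -[leRHS]mul1r ler_pdivlMr//.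
  apply: (@le_trans _ _ (threshold_poly n y * (1 + y ^+ n) ^+ (n * 2 ^ n))).
    rewrite ler_wpM2l//; first by have /andP[] := threshold_poly_itv n y01.
    apply: le_trans (bernoulli_ineq _ (le_trans (lerN10 R) yn0)).
    rewrite -nat1r lerD2l natrM natrX -mulrA -exprMn -[leLHS]mulr1 ler_wpM2l//.
    by rewrite exprn_ege1// -ler_pdivrMl// mulr1.
  rewrite /threshold_poly -exprMn exprn_ile1// -subr_sqr expr1n.
    by rewrite subr_ge0 exprn_ile1.
  by rewrite gerBl sqr_ge0.
- exact: cvg_cst.
- exact: cvg_harmonic.
Qed.

End threshold_polynomial.

(** * The L^2 closure of an algebra of bounded functions *)

Section dense_algebra.
Context d (T : measurableType d) (R : realType).
Variable mu : {finite_measure set T -> \bar R}.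
Implicit Types (f g h p q : T -> R) (k B C e : R) (A : set T).

Local Notation sqint := (sqint mu).
Local Notation ip := (ip mu).

Variable P : (T -> R) -> Prop.
Hypothesis P_meas : forall p, P p -> measurable_fun setT p.
Hypothesis P_bnd : forall p, P p -> exists B, bounded_by p B.
Hypothesis P_lin : forall k p q, P p -> P q -> P (fun x => k * p x + q x).
Hypothesis P_mul : forall p q, P p -> P q -> P (fun x => p x * q x).
Hypothesis P_one : P (fun=> 1).

Definition dist2 f g := ip (fun x => f x - g x) (fun x => f x - g x).

Definition L2dense g := sqint g /\
  forall e, 0 < e -> exists2 p, P p & dist2 g p <= e.

Lemma P_sqint p : P p -> sqint p.
Proof. by move=> Pp; have [B pB] := P_bnd Pp; exact: bounded_sqint (P_meas Pp) pB. Qed.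

Lemma dense_P p : P p -> L2dense p.
Proof.
move=> Pp; split; first exact: P_sqint.
move=> e e0; exists p => //; rewrite /dist2.
under [X in ip X _]eq_fun do rewrite subrr.
by rewrite ip0l ltW.
Qed.

Lemma dense_approx g : sqint g ->
  (forall e, 0 < e -> exists2 h, L2dense h & dist2 g h <= e) -> L2dense g.
Proof.
move=> gs gh; split => // e e0.
have e4 : 0 < e / 4 by rewrite divr_gt0.
have [h [hs hd] gh4] := gh _ e4; have [p Pp hp] := hd _ e4.
exists p => //; rewrite (le_trans (ip_triangle gs hs (P_sqint Pp)))//.
by rewrite /dist2 in gh4 hp; lra.
Qed.

Lemma dense_lim (u : nat -> T -> R) f h : sqint h -> measurable_fun setT f ->
  (forall n, L2dense (u n)) -> (forall n x, `|u n x| <= h x) ->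
  (forall x, u n x @[n --> \oo] --> f x) -> L2dense f.
Proof.
move=> hs mf ud uh uf; apply: dense_approx.
  apply: le_sqint hs => // x; rewrite (le_trans _ (ler_norm _))//.
  by apply: (cvgr_to_le (cvg_norm (uf x))); apply: nearW => n; exact: uh.
move=> e e0; have := dominated_ip hs mf (fun n => (ud n).1.1) uh uf.
move=> /cvgr_lt/(_ _ e0)[n _ /(_ n (leqnn n)) un].
by exists (u n) => //; exact: ltW.
Qed.

Lemma dense_lin k f g : L2dense f -> L2dense g -> L2dense (fun x => k * f x + g x).
Proof.
move=> [fs fd] [gs gd]; split; first by apply: sqintD => //; exact: sqintZ.
move=> e e0; pose c := 2 * k ^+ 2 + 2.
have c0 : 0 < c by rewrite ltr_wpDl// mulr_ge0// sqr_ge0.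
have ec : 0 < e / c by rewrite divr_gt0.
have [p Pp fp] := fd _ ec; have [q Pq gq] := gd _ ec.
exists (fun x => k * p x + q x); first exact: P_lin.
have [ps qs] := (P_sqint Pp, P_sqint Pq).
have h1 := sqintD (sqintZ k fs) gs.
have h2 := sqintD (sqintZ k ps) gs.
have h3 := sqintD (sqintZ k ps) qs.
apply: le_trans (ip_triangle h1 h2 h3) _.
have l1 : dist2 (fun x => k * f x + g x) (fun x => k * p x + g x) <= k ^+ 2 * dist2 f p.
  apply: le_ip; [exact: sqintB|exact: sqintB|move=> x].
  by rewrite (_ : _ - _ = k * (f x - p x)) ?exprMn//; ring.
have l2 : dist2 (fun x => k * p x + g x) (fun x => k * p x + q x) <= 1 * dist2 g q.
  apply: le_ip; [exact: sqintB|exact: sqintB|move=> x].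
  by rewrite (_ : _ - _ = g x - q x) ?mul1r//; ring.
rewrite -!/(dist2 _ _) (@le_trans _ _ (2 * (k ^+ 2 * (e / c)) + 2 * (e / c)))//.
  rewrite lerD// ler_wpM2l//; last by rewrite (le_trans l2)// mul1r.
  by rewrite (le_trans l1)// ler_wpM2l// sqr_ge0.
rewrite [leLHS](_ : _ = e)//; rewrite /c in c0 *; field.
by rewrite gt_eqF.
Qed.

Lemma dense_mul f g B C : bounded_by f B -> bounded_by g C ->
  L2dense f -> L2dense g -> L2dense (fun x => f x * g x).
Proof.
move=> fB gC [fs fd] [gs gd].
have fgs : sqint (fun x => f x * g x).
  apply: (@bounded_sqint _ _ _ _ _ (B * C)); first exact: measurable_funM fs.1 gs.1.
  by move=> x; rewrite normrM ler_pM.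
split => // e e0.
have c1 : 0 < 4 * (B ^+ 2 + 1) by rewrite mulr_gt0// ltr_wpDl// sqr_ge0.
(* q is chosen first, because its bound D, which cannot be prescribed, sets the accuracy required of
   p. *)
have [q Pq gq] := gd _ (divr_gt0 e0 c1).
have [D qD] := P_bnd Pq.
have c2 : 0 < 4 * (D ^+ 2 + 1) by rewrite mulr_gt0// ltr_wpDl// sqr_ge0.
have [p Pp fp] := fd _ (divr_gt0 e0 c2).
exists (fun x => p x * q x); first exact: P_mul.
have [ps qs] := (P_sqint Pp, P_sqint Pq).
have fqs : sqint (fun x => f x * q x).
  apply: (@bounded_sqint _ _ _ _ _ (B * D)); first exact: measurable_funM fs.1 qs.1.
  by move=> x; rewrite normrM ler_pM.
have pqs := P_sqint (P_mul Pp Pq).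
apply: le_trans (ip_triangle fgs fqs pqs) _.
have l1 : dist2 (fun x => f x * g x) (fun x => f x * q x) <= (B ^+ 2 + 1) * dist2 g q.
  apply: le_ip; [exact: sqintB|exact: sqintB|move=> x].
  rewrite -mulrBr exprMn ler_wpM2r ?sqr_ge0// (@le_trans _ _ (B ^+ 2))// ?lerDl//.
  by rewrite -[f x ^+ 2]real_normK ?num_real// lerXn2r// ?nnegrE// (le_trans _ (fB x)).
have l2 : dist2 (fun x => f x * q x) (fun x => p x * q x) <= (D ^+ 2 + 1) * dist2 f p.
  apply: le_ip; [exact: sqintB|exact: sqintB|move=> x].
  rewrite -mulrBl exprMn mulrC ler_wpM2r ?sqr_ge0// (@le_trans _ _ (D ^+ 2))// ?lerDl//.
  by rewrite -[q x ^+ 2]real_normK ?num_real// lerXn2r// ?nnegrE// (le_trans _ (qD x)).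
have b1 : 0 <= B ^+ 2 + 1 by rewrite addr_ge0// sqr_ge0.
have b2 : 0 <= D ^+ 2 + 1 by rewrite addr_ge0// sqr_ge0.
have m1 := le_trans l1 (ler_wpM2l b1 gq).
have m2 := le_trans l2 (ler_wpM2l b2 fp).
rewrite -!/(dist2 _ _) (le_trans (lerD (ler_wpM2l _ m1) (ler_wpM2l _ m2)))//.
rewrite le_eqVlt; apply/orP; left; apply/eqP; field.
by rewrite !gt_eqF// ltr_wpDl// sqr_ge0.
Qed.

Lemma dense_sum (I : Type) (s : seq I) (F : I -> T -> R) :
  (forall i, L2dense (F i)) -> L2dense (fun x => \sum_(i <- s) F i x).
Proof.
move=> Fd; elim: s => [|i s IH].
  have := dense_P (P_lin (-1) P_one P_one); congr L2dense; apply/funext => x.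
  by rewrite big_nil mulN1r addNr.
have := dense_lin 1 (Fd i) IH; congr L2dense; apply/funext => x.
by rewrite big_cons mul1r.
Qed.

Lemma bounded_indic A : bounded_by (\1_A : T -> R) 1.
Proof. by move=> x; rewrite indicE; case: (_ \in _); rewrite ?normr1 ?normr0. Qed.

Lemma dense_indicC A : L2dense (\1_A : T -> R) -> L2dense (\1_(~` A) : T -> R).
Proof.
move=> dA; have := dense_lin (-1) dA (dense_P P_one); congr L2dense.
apply/funext => x; rewrite !indicE in_setC.
by case: (_ \in _); rewrite /= ?mulr1 ?mulr0 ?add0r// addNr.
Qed.

Lemma dense_indicI A A' : L2dense (\1_A : T -> R) -> L2dense (\1_A' : T -> R) ->
  L2dense (\1_(A `&` A') : T -> R).
Proof.
move=> dA dA'; have := dense_mul (bounded_indic A) (bounded_indic A') dA dA'.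
by congr L2dense; apply/funext => x; rewrite !indicE in_setI -natrM mulnb.
Qed.

Lemma dense_indicU A A' : L2dense (\1_A : T -> R) -> L2dense (\1_A' : T -> R) ->
  L2dense (\1_(A `|` A') : T -> R).
Proof.
move=> dA dA'; rewrite -[A `|` A']setCK setCU.
by apply: dense_indicC; apply: dense_indicI; exact: dense_indicC.
Qed.

Lemma dense_indic_bigcup (F : nat -> set T) :
  (forall n, measurable (F n)) -> (forall n, L2dense (\1_(F n) : T -> R)) ->
  L2dense (\1_(\bigcup_n F n) : T -> R).
Proof.
move=> mF dF; pose G n := \big[setU/set0]_(i < n) F i.
have dG n : L2dense (\1_(G n) : T -> R).
  rewrite /G; elim: n => [|n IH]; last by rewrite big_ord_recr; exact: dense_indicU.
  by rewrite big_ord0 -setCT; apply: dense_indicC; rewrite indicT; exact: dense_P.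
apply: (@dense_lim (fun n => \1_(G n)) _ (fun=> 1)) => //.
- exact: sqint1.
- by apply: measurable_indic; exact: bigcup_measurable.
- by move=> n x; exact: bounded_indic.
move=> x; have [[N _ FNx]|nFx] := pselect ((\bigcup_n F n) x).
  apply/cvg_ballP => e e0; exists N.+1 => // n /= Nn.
  rewrite !indicE !mem_set; [exact: ballxx| |by exists N].
  by rewrite /G -bigcup_mkord; exists N.
apply/cvg_ballP => e e0; apply: nearW => n.
rewrite !indicE !memNset//; first exact: ballxx.
by rewrite /G -bigcup_mkord => -[i _ Fix]; apply: nFx; exists i.
Qed.

Lemma P_exp p n : P p -> P (fun x => p x ^+ n).
Proof.
move=> Pp; elim: n => [|n IH]; first by have := P_one; congr P; apply/funext => x.
by have := P_mul Pp IH; congr P; apply/funext => x; rewrite exprS.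
Qed.

(** This is how sets enter the closure: [threshold_poly n] composed with p stays in the algebra and
    converges boundedly to the indicator. *)
Lemma dense_indic_lt p : P p -> (forall x, 0 <= p x <= 1) ->
  L2dense (\1_[set x | p x < 2^-1] : T -> R).
Proof.
move=> Pp p01.
have Pn n : P (fun x => threshold_poly n (p x)).
  apply: P_exp; have := P_lin (-1) (P_exp n Pp) P_one.
  by congr P; apply/funext => x; rewrite mulN1r addrC.
have mA : measurable [set x | p x < 2^-1].
  rewrite [X in measurable X](_ : _ = p @^-1` `]-oo, 2^-1[); last first.
    by apply/seteqP; split => x /=; rewrite in_itv.
  by rewrite -[X in measurable X]setTI; exact: (P_meas Pp).
apply: (@dense_lim (fun n x => threshold_poly n (p x)) _ (fun=> 1)).
- exact: sqint1.
- exact: measurable_indic.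
- by move=> n; exact: dense_P.
- by move=> n x; have /andP[h0 h1] := threshold_poly_itv n (p01 x); rewrite ger0_norm.
- move=> x; have := cvg_threshold_poly (p01 x).
  rewrite indicE (_ : (x \in _) = (p x < 2^-1))//.
  by apply/idP/idP; rewrite inE.
Qed.

Section dense_comp.
Variable phi : T -> T.
Hypothesis phi_dense : forall A, measurable A -> L2dense (\1_(phi @^-1` A) : T -> R).

Import HBNNSimple.

Lemma dense_comp_sfun (f : {nnsfun T >-> R}) : L2dense (f \o phi).
Proof.
have -> : f \o phi = fun x => \sum_(y <- finmap.enum_fset (fset_set (range f)))
    (y * \1_(phi @^-1` (f @^-1` [set y])) x).
  apply/funext => x /=; rewrite (fimfunE f) fsbig_finite//=.
apply: dense_sum => y; have := dense_lin y (phi_dense (measurable_funPTI f (measurable_set1 y))) (dense_P (P_lin (-1) P_one P_one)).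
by congr L2dense; apply/funext => x; rewrite mulN1r addNr addr0.
Qed.

(** The simple approximations of g may fail to be invariant under phi, but composed with phi they
    still converge to g (phi x) = g x, and their level sets are preimages under phi. *)
Lemma dense_comp_ge0 g : sqint g -> (forall x, 0 <= g x) ->
  (forall x, g (phi x) = g x) -> L2dense g.
Proof.
move=> gs g0 gphi.
have mg : measurable_fun setT (EFin \o g) by apply/measurable_EFinP; exact: gs.1.
pose u n := nnsfun_approx measurableT mg n.
have ucvg x : (u n x) @[n --> \oo] --> g x.
  have := @cvg_nnsfun_approx _ T R setT measurableT _ mg (fun x _ => g0 x) x Logic.I.
  by move=> /fine_cvg.
have ule n x : `|u n x| <= g x.
  rewrite ger0_norm; last exact: fun_ge0.
  apply: (cvgr_to_ge (ucvg x)); exists n => // m /= nm.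
  by have /(_ _ _ nm)/asboolP/(_ x) := @nd_nnsfun_approx _ T R setT measurableT _ mg.
apply: (@dense_lim (fun n => u n \o phi) g g) => //; first exact: gs.1.
- by move=> n; exact: dense_comp_sfun.
- by move=> n x; rewrite -[leRHS]gphi; exact: ule.
- by move=> x; rewrite -[X in _ --> X]gphi; exact: ucvg.
Qed.

Lemma dense_comp g : sqint g -> (forall x, g (phi x) = g x) -> L2dense g.
Proof.
move=> gs gphi.
pose gp x := Num.max (g x) 0; pose gn x := Num.max (- g x) 0.
have h (f : T -> R) : sqint f -> sqint (fun x => Num.max (f x) 0).
  move=> fs; have mf := fs.1.
  apply: le_sqint fs; first exact: measurable_maxr.
  by move=> x; rewrite ger0_norm ?le_max ?lexx ?orbT// ge_max ler_norm normr_ge0.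
have gps : sqint gp by exact: h.
have gns : sqint gn.
  by apply: h; have := sqintZ (-1) gs; congr sqint; apply/funext => x; rewrite mulN1r.
have dp : L2dense gp.
  by apply: dense_comp_ge0 => // x; rewrite /gp ?gphi// le_max lexx orbT.
have dn : L2dense gn.
  by apply: dense_comp_ge0 => // x; rewrite /gn ?gphi// le_max lexx orbT.
have := dense_lin (-1) dn dp; congr L2dense; apply/funext => x.
rewrite /gp /gn mulN1r; case: (ltP (g x) 0) => gx.
  by rewrite (max_l (y := 0)) ?oppr_ge0 ?ltW// opprK addr0.
by rewrite (max_r (x := - g x)) ?oppr_le0// oppr0 add0r.
Qed.

End dense_comp.

End dense_algebra.

(** * Cosine products on the torus *)

Section torus_integral.
Context (R : realType) (d : nat) (L : R).
Hypothesis L0 : 0 < L.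
Local Notation T := 'rV[R]_d.
Local Notation mu := (torus_measure L d).
Local Notation periodic := (@Defs.periodic R d L).
Implicit Types (f g u v : T -> R) (x y e a : T) (i : 'I_d).

Lemma Rintegral_affine e a f : signs e -> measurable_fun setT f -> periodic f ->
  \int[mu]_x f (affine e a x) = \int[mu]_x f x.
Proof.
move=> se mf fL; congr fine.
apply: (@torus_integral_affine R L L0 d e a (EFin \o f)) => //.
- exact/measurable_EFinP.
- by move=> i x /=; rewrite fL.
Qed.

Lemma measurable_comp_affine e a f : measurable_fun setT f ->
  measurable_fun setT (f \o affine e a).
Proof. by move=> mf; apply: measurableT_comp => //; exact: measurable_affine. Qed.

Lemma affine_integrable e a f : signs e -> periodic f -> measurable_fun setT f ->
  mu.-integrable setT (EFin \o f) -> mu.-integrable setT (EFin \o (f \o affine e a)).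
Proof.
move=> se fL mf fi; apply/integrableP; split.
  by apply/measurable_EFinP; exact: measurable_comp_affine.
move/integrableP : fi => [_]; congr (_ < _)%E.
pose w x := `|(f x)%:E|%E.
apply: esym; apply: (@torus_integral_affine_ge0 R L L0 d e a w) => //.
- by apply: measurableT_comp => //; exact/measurable_EFinP.
- by move=> x; exact: abse_ge0.
- by move=> i x; rewrite /w fL.
Qed.

Lemma affine_sqint e a f : signs e -> periodic f -> sqint mu f ->
  sqint mu (f \o affine e a).
Proof.
move=> se fL [mf f2]; split; first exact: measurable_comp_affine.
apply: (@affine_integrable e a (fun x => f x ^+ 2)) => //.
- by move=> i x; rewrite fL.
- exact: measurable_funX.
Qed.

(** The tool for simplifying a product of cosines one coordinate at a time: averaging over a measure
    preserving map does not change the integral. *)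
Lemma Rintegral_average e a f g : signs e -> periodic f -> measurable_fun setT f ->
  mu.-integrable setT (EFin \o f) ->
  (forall x, f x + f (affine e a x) = 2 * g x) ->
  \int[mu]_x f x = \int[mu]_x g x.
Proof.
move=> se fL mf fi fg; have fa := affine_integrable a se fL mf fi.
have -> : g = fun x => 2^-1 * (f x + f (affine e a x)).
  by apply/funext => x; rewrite fg mulrA mulVf ?mul1r.
rewrite RintegralZl//; last exact: integrableRD.
rewrite RintegralD// Rintegral_affine//.
by field.
Qed.

(** Read off from the invariance of the integral of |u - v|, which vanishes exactly when u = v
    almost everywhere. *)
Lemma ae_affine e a u v : signs e -> measurable_fun setT u -> measurable_fun setT v ->
  periodic u -> periodic v -> {ae mu, forall x, u x = v x} ->
  {ae mu, forall x, u (affine e a x) = v (affine e a x)}.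
Proof.
move=> se mu_ mv uL vL uv.
pose w x := `|(u x - v x)%:E|%E.
have mw : measurable_fun setT w.
  by apply: measurableT_comp => //; apply/measurable_EFinP; exact: measurable_funB.
have w0 : (\int[mu]_x w x = 0)%E.
  rewrite (@ae_eq_integral _ _ _ mu _ (cst 0%E)) ?integral0//.
  by apply: filterS uv => x uvx _; rewrite /w uvx subrr abse0.
pose wa := EFin \o (fun x => u (affine e a x) - v (affine e a x)).
have wa0 : (\int[mu]_x `|wa x| = 0)%E.
  rewrite -w0 -(@torus_integral_affine_ge0 R L L0 d e a w) //.
    by move=> x; exact: abse_ge0.
  by move=> i x; rewrite /w uL vL.
have mwa : measurable_fun setT wa.
  apply/measurable_EFinP; apply: measurable_funB; exact: measurable_comp_affine.
have /(ae_eq_integral_abs mu measurableT mwa) := wa0.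
by apply: filterS => x /(_ Logic.I) [] /eqP; rewrite subr_eq0 => /eqP.
Qed.

Definition refl x y : T := x - y.

Lemma reflE x : refl x = affine (const_mx (-1)) x.
Proof. by apply/funext => y; apply/rowP => i; rewrite !mxE mulN1r addrC. Qed.

Lemma signsN1 : signs (const_mx (-1) : T).
Proof. by move=> i; right; rewrite mxE. Qed.

Lemma transE a : (fun x => x + a) = affine (const_mx 1) a :> (T -> T).
Proof. by apply/funext => y; apply/rowP => i; rewrite !mxE mul1r. Qed.

Lemma signs1 : signs (const_mx 1 : T).
Proof. by move=> i; left; rewrite mxE. Qed.

Definition flip_signs i : T := \row_j (if j == i then -1 else 1).

Lemma flipE i : flip i = affine (flip_signs i) 0.
Proof.
apply/funext => y; apply/rowP => j; rewrite !mxE addr0.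
by case: ifP; rewrite ?mulN1r ?mul1r.
Qed.

Lemma signs_flip i : signs (flip_signs i).
Proof. by move=> j; rewrite mxE; case: ifP => _; [right|left]. Qed.

Lemma flipK i : involutive (@flip R d i).
Proof. by move=> x; apply/rowP => j; rewrite !mxE; case: (j == i); rewrite ?opprK. Qed.

Lemma flipB i x y : flip i (x - y) = flip i x - flip i y.
Proof. by apply/rowP => j; rewrite !mxE; case: ifP => // _; rewrite opprD. Qed.

Lemma flip_unit i j : flip i (L *: unit_vec R j) =
  (if j == i then -1 else 1) *: (L *: unit_vec R j) :> T.
Proof.
apply/rowP => k; rewrite !mxE /=; case: (eqVneq k j) => [->|_].
  by case: ifP => _; rewrite ?mulN1r ?mul1r.
by rewrite !mulr0 oppr0; case: ifP.
Qed.

Lemma flipD i x y : flip i (x + y) = flip i x + flip i y.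
Proof. by apply/rowP => j; rewrite !mxE; case: ifP => // _; rewrite opprD. Qed.

Lemma periodicN f i x : periodic f -> f (x - L *: unit_vec R i) = f x.
Proof. by move=> fL; rewrite -[RHS](fL i) -[LHS](fL i) subrK. Qed.

Lemma periodic_int f x (z : 'rV[int]_d) : periodic f ->
  f (x + L *: map_mx intr z) = f x.
Proof.
move=> fL; have fLz i (k : int) w : f (w + L *: (k%:~R *: unit_vec R i)) = f w.
  have fLn (n : nat) w' : f (w' + L *: (n%:R *: unit_vec R i)) = f w'.
    elim: n => [|n IH]; first by rewrite scale0r scaler0 addr0.
    by rewrite -natr1 scalerDl scale1r scalerDr addrA fL.
  case: k => n; first exact: fLn.
  rewrite NegzE mulrNz scaleNr scalerN -[in RHS](subrK (L *: (n.+1%:R *: unit_vec R i)) w).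
  by rewrite fLn.
have -> : map_mx intr z = \sum_i ((z ord0 i)%:~R *: unit_vec R i) :> T.
  rewrite [LHS]row_sum_delta; apply: eq_bigr => i _.
  by rewrite mxE.
rewrite scaler_sumr; elim/big_rec : _ x => [x|i w _ IH x]; first by rewrite addr0.
by rewrite addrA IH fLz.
Qed.

Lemma periodic_flip f i : periodic f -> periodic (f \o flip i).
Proof.
move=> fL j x; rewrite /= flipD flip_unit.
by case: ifP => _; rewrite ?scaleN1r ?scale1r ?periodicN// fL.
Qed.

End torus_integral.

Section cosine_products.
Context (R : realType) (d : nat) (L : R).
Hypothesis L0 : 0 < L.
Local Notation T := 'rV[R]_d.
Local Notation mu := (torus_measure L d).
Local Notation periodic := (@Defs.periodic R d L).
Implicit Types (f g : T -> R) (x y : T) (i : 'I_d) (k j : {ffun 'I_d -> nat}).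

Definition ang (n : nat) (t : R) : R := 2 * pi * n%:R / L * t.

Lemma cos_angD n t : cos (ang n (t + L)) = cos (ang n t).
Proof.
rewrite /ang mulrDr -(periodicn (@cosD2pi R) n (_ * t)); congr (cos (_ + _)).
by rewrite -mulrA mulVf ?gt_eqF// mulr1 -[RHS]mulr_natr -[pi *+ 2]mulr_natl.
Qed.

Lemma cos_angN n t : cos (ang n (- t)) = cos (ang n t).
Proof. by rewrite /ang mulrN cosN. Qed.

Lemma angD n s t : ang n (s + t) = ang n s + ang n t.
Proof. exact: mulrDr. Qed.

Lemma angN n t : ang n (- t) = - ang n t.
Proof. exact: mulrN. Qed.

Definition coord_even f := forall i x, f (flip i x) = f x.

Definition cosprod k x : R := \prod_i cos (ang (k i) (x ord0 i)).

Lemma measurable_cos_coord n i (c : R) :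
  measurable_fun setT (fun x : T => cos (ang n (c + x ord0 i))).
Proof.
apply: (@measurableT_comp _ _ _ _ _ _ (cos : measurableTypeR R -> measurableTypeR R)).
  by apply: continuous_measurable_fun; exact: continuous_cos.
apply: measurable_funM => //; apply: measurable_funD => //.
exact: measurable_coord_rV.
Qed.

Lemma measurable_cosprod k : measurable_fun setT (cosprod k).
Proof.
apply: measurable_prod => i _.
have := @measurable_cos_coord (k i) i 0.
by congr measurable_fun; apply/funext => x; rewrite add0r.
Qed.

Lemma normr_prod_le1 (F : 'I_d -> R) : (forall i, `|F i| <= 1) -> `|\prod_i F i| <= 1.
Proof. by move=> F1; rewrite normr_prod; apply: prodr_ile1 => i _; rewrite normr_ge0 F1. Qed.

Lemma cosprod_le1 k : bounded_by (cosprod k) 1.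
Proof. by move=> x; apply: normr_prod_le1 => i; exact: cos_max. Qed.

Lemma cosprod_sqint k : sqint mu (cosprod k).
Proof. exact: bounded_sqint (measurable_cosprod k) (cosprod_le1 k). Qed.

Lemma prod_coord_periodic (F : 'I_d -> R -> R) :
  (forall i t, F i (t + L) = F i t) -> periodic (fun x => \prod_i F i (x ord0 i)).
Proof.
move=> FL i x; apply: eq_bigr => j _; rewrite !mxE /=.
by case: eqP => _; rewrite ?mulr1 ?FL// mulr0 addr0.
Qed.

Lemma cosprod_periodic k : periodic (cosprod k).
Proof.
apply: (@prod_coord_periodic (fun i t => cos (ang (k i) t))) => i t.
exact: cos_angD.
Qed.

Lemma cosprod_even k : coord_even (cosprod k).
Proof.
move=> i x; apply: eq_bigr => j _; rewrite !mxE.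
by case: ifP => // _; rewrite cos_angN.
Qed.

Let refl_factor k x (b : bool) i (t : R) : R :=
  if b then cos (ang (k i) (x ord0 i)) * cos (ang (k i) t)
  else cos (ang (k i) (x ord0 i - t)).

(** Interpolates from cosprod k (x - y) at n = 0 to cosprod k x * cosprod k y at n = d: the factors
    of index less than n are already averaged. *)
Let refl_prod k x n y : R := \prod_(i < d) refl_factor k x (i < n)%N i (y ord0 i).

Let measurable_refl_prod k x n : measurable_fun setT (refl_prod k x n).
Proof.
apply: (measurable_prod (h := fun i y => refl_factor k x (i < n)%N i (y ord0 i))).
move=> i _; rewrite /refl_factor; case: (i < n)%N.
  apply: measurable_funM => //; have := @measurable_cos_coord (k i) i 0.
  by congr measurable_fun; apply/funext => y; rewrite add0r.
have := @measurable_cos_coord (k i) i (- x ord0 i); congr measurable_fun.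
by apply/funext => y; rewrite -cos_angN opprD opprK.
Qed.

Let refl_prod_le1 k x n : bounded_by (refl_prod k x n) 1.
Proof.
move=> y; apply: normr_prod_le1 => i; rewrite /refl_factor; case: ifP => _.
  by rewrite normrM mulr_ile1// cos_max.
exact: cos_max.
Qed.

Let refl_prod_periodic k x n : periodic (refl_prod k x n).
Proof.
apply: (@prod_coord_periodic (fun i t => refl_factor k x (i < n)%N i t)) => i t.
rewrite /refl_factor; case: (i < n)%N.
  by rewrite cos_angD.
by rewrite opprD addrA -[LHS]cos_angD subrK.
Qed.

Let refl_prod_flip k x (i : 'I_d) y :
  refl_prod k x i y + refl_prod k x i (flip i y) = 2 * refl_prod k x i.+1 y.
Proof.
have split_at m z : refl_prod k x m z = refl_factor k x (i < m)%N i (z ord0 i) *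
    \prod_(j < d | j != i) refl_factor k x (j < m)%N j (z ord0 j).
  by rewrite /refl_prod (bigD1 i).
rewrite !split_at.
have -> : \prod_(j < d | j != i) refl_factor k x (j < i)%N j (flip i y ord0 j) =
    \prod_(j < d | j != i) refl_factor k x (j < i)%N j (y ord0 j).
  by apply: eq_bigr => j ji; rewrite mxE (negbTE ji).
have -> : \prod_(j < d | j != i) refl_factor k x (j < i.+1)%N j (y ord0 j) =
    \prod_(j < d | j != i) refl_factor k x (j < i)%N j (y ord0 j).
  apply: eq_bigr => j ji; rewrite ltnS leq_eqVlt.
  by rewrite (_ : (j : nat) == i = false)//; apply/negbTE.
rewrite mxE eqxx /refl_factor ltnn ltnSn -mulrDl mulrA; congr (_ * _).
by rewrite opprK !angD angN !cosD cosN sinN; ring.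
Qed.

(* Averaging over the reflections of the coordinates turns each factor
   [cos (u - v)] into [cos u * cos v]. *)
Lemma cosprod_convolution k f x : sqint mu f -> periodic f -> coord_even f ->
  \int[mu]_y (cosprod k (x - y) * f y) = cosprod k x * \int[mu]_y (cosprod k y * f y).
Proof.
move=> fs fL fe.
have step n : (n <= d)%N -> \int[mu]_y (cosprod k (x - y) * f y) =
    \int[mu]_y (refl_prod k x n y * f y).
  elim: n => [_|n IH nd].
    apply: eq_Rintegral => y _; congr (_ * _).
    by apply: eq_bigr => i _; rewrite /refl_factor !mxE.
  rewrite (IH (ltnW nd)); pose i := Ordinal nd.
  have Hs : sqint mu (refl_prod k x n).
    exact: bounded_sqint (measurable_refl_prod k x n) (refl_prod_le1 k x n).
  apply: (@Rintegral_average R d L L0 (flip_signs R i) 0 (fun y => refl_prod k x n y * f y)).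
  - exact: signs_flip.
  - by move=> j y; rewrite fL refl_prod_periodic.
  - exact: measurable_funM Hs.1 fs.1.
  - exact: sqint_mul_integrable.
  - move=> y; rewrite -flipE fe -mulrDl.
    by rewrite (@refl_prod_flip k x i y) mulrA.
rewrite (step d (leqnn _)) -RintegralZl//; last first.
  by apply: sqint_mul_integrable => //; exact: cosprod_sqint.
apply: eq_Rintegral => y _; rewrite mulrA; congr (_ * _).
rewrite /cosprod -big_split/=; apply: eq_bigr => i _.
by rewrite /refl_factor ltn_ord.
Qed.

Let sq_factor k (b : bool) i (t : R) : R :=
  if b then (if k i == 0%N then 1 else 2^-1) else cos (ang (k i) t) ^+ 2.

(** The same interpolation for the square of [cosprod k], each factor being replaced in turn by its
    mean, 1 or 1/2. *)
Let sq_prod k n y : R := \prod_(i < d) sq_factor k (i < n)%N i (y ord0 i).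

Lemma ip_cosprod_diag k :
  ip mu (cosprod k) (cosprod k) = L ^+ d * \prod_i (if k i == 0%N then 1 else 2^-1).
Proof.
have step n : (n <= d)%N -> ip mu (cosprod k) (cosprod k) = \int[mu]_y sq_prod k n y.
  elim: n => [_|n IH nd].
    apply: eq_Rintegral => y _; rewrite /cosprod -big_split/=.
    by apply: eq_bigr => i _; rewrite /sq_factor expr2.
  rewrite (IH (ltnW nd)); pose i := Ordinal nd.
  have split_at m y : sq_prod k m y = sq_factor k (i < m)%N i (y ord0 i) *
      \prod_(j < d | j != i) sq_factor k (j < m)%N j (y ord0 j).
    by rewrite /sq_prod (bigD1 i).
  have rest y : \prod_(j < d | j != i) sq_factor k (j < n.+1)%N j (y ord0 j) =
      \prod_(j < d | j != i) sq_factor k (j < n)%N j (y ord0 j).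
    apply: eq_bigr => j ji; rewrite ltnS leq_eqVlt.
    by rewrite (_ : (j : nat) == n = false)//; apply/negbTE.
  have mS : measurable_fun setT (sq_prod k n).
    apply: (measurable_prod (h := fun (l : 'I_d) y => sq_factor k (l < n)%N l (y ord0 l))).
    move=> j _; rewrite /sq_factor; case: (j < n)%N => //.
    apply: measurable_funX; have := @measurable_cos_coord (k j) j 0.
    by congr measurable_fun; apply/funext => y; rewrite add0r.
  have bS : bounded_by (sq_prod k n) 1.
    move=> y; apply: normr_prod_le1 => j; rewrite /sq_factor; case: ifP => _.
      case: ifP => _; rewrite ger0_norm//.
      by rewrite invf_le1// ler1n.
    by rewrite normrX exprn_ile1// cos_max.
  have [k0|k0] := eqVneq (k i) 0%N.
    apply: eq_Rintegral => y _; rewrite !split_at rest; congr (_ * _).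
    by rewrite /sq_factor /= ltnn ltnSn k0 eqxx /ang mulr0 !mul0r cos0 expr1n.
  have kR : (k i)%:R != 0 :> R by rewrite pnatr_eq0.
  (* A quarter of the period of the factor: the angle grows by pi / 2, and cos^2 + sin^2 = 1. *)
  apply: (@Rintegral_average R d L L0 (const_mx 1) ((L / (4 * (k i)%:R)) *: unit_vec R i)).
  - exact: signs1.
  - apply: (@prod_coord_periodic (fun (l : 'I_d) t => sq_factor k (l < n)%N l t)) => j t.
    rewrite /sq_factor; case: (j < n)%N => //.
    by rewrite cos_angD.
  - exact: mS.
  - exact: bounded_integrable mS bS.
  - move=> y; rewrite -transE !split_at rest.
    rewrite [X in _ + _ * X = _](_ : _ = \prod_(j < d | j != i)
      sq_factor k (j < n)%N j (y ord0 j)); last first.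
      by apply: eq_bigr => j ji; rewrite !mxE /= (negbTE ji) mulr0 addr0.
    rewrite -mulrDl mulrA; congr (_ * _).
    rewrite /sq_factor /= ltnn ltnSn (negbTE k0) divff// !mxE !eqxx /= mulr1.
    rewrite (_ : ang (k i) (y ord0 i + _) = ang (k i) (y ord0 i) + pi / 2); last first.
      rewrite /ang mulrDr; congr (_ + _); move: (@pi R) => p; field.
      by rewrite kR gt_eqF.
    by rewrite cosDpihalf sqrrN cos2Dsin2.
rewrite (step d (leqnn _)); under eq_Rintegral => y _.
  rewrite /sq_prod; under eq_bigr => i _ do rewrite /sq_factor ltn_ord.
  over.
by rewrite Rintegral_cst//= torus_measureT//= mulrC.
Qed.

Lemma cosprod_neq k j : k != j -> exists x, cosprod k x != cosprod j x.
Proof.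
move=> kj; have [i kji] : exists i, k i != j i.
  apply/existsP; apply: contraR kj => /existsPn kj; apply/eqP/ffunP => i.
  by have := kj i; rewrite negbK => /eqP.
wlog ji : k j kj kji / (k i < j i)%N.
  move=> H; have [lt|] := ltnP (k i) (j i); first exact: H.
  rewrite leq_eqVlt eq_sym (negbTE kji)/= => lt.
  have [||x cx] := H j k _ _ lt; [by rewrite eq_sym|by rewrite eq_sym|].
  by exists x; rewrite eq_sym.
have j0 : 0 < (j i)%:R :> R by rewrite ltr0n (leq_trans _ ji).
(* Here the cosine of index j i equals cos pi, the minimum, while k i < j i keeps the other angle
   strictly before pi. *)
exists ((L / (2 * (j i)%:R)) *: unit_vec R i).
have cE k' : cosprod k' ((L / (2 * (j i)%:R)) *: unit_vec R i) =
    cos (pi * ((k' i)%:R / (j i)%:R)).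
  rewrite /cosprod (bigD1 i)//= big1 ?mulr1.
    rewrite !mxE !eqxx mulr1; congr cos; rewrite /ang; move: (@pi R) => p.
    by field; rewrite !gt_eqF.
  by move=> l li; rewrite !mxE (negbTE li) /ang !mulr0 cos0.
rewrite !cE divff; last by rewrite gt_eqF.
rewrite mulr1 neq_lt; apply/orP; right; rewrite ltr_cos.
- by rewrite -[ltRHS]mulr1 ltr_pM2l ?pi_gt0// ltr_pdivrMr// mul1r ltr_nat.
- rewrite in_itv/= mulr_ge0 ?pi_ge0 ?divr_ge0//= -[leRHS]mulr1 ler_wpM2l ?pi_ge0//.
  by rewrite ler_pdivrMr// mul1r ler_nat ltnW.
- by rewrite in_itv/= pi_ge0 lexx.
Qed.

(** Convolution commutes, and each of the two functions is an eigenvector of convolution with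
    itself. Hence (cosprod k x - cosprod j x) times the inner product is 0 for every x, and some x
    separates the two. *)
Lemma ip_cosprod_neq k j : k != j -> ip mu (cosprod k) (cosprod j) = 0.
Proof.
move=> kj; have [x cx] := cosprod_neq kj.
have H k' j' : \int[mu]_y (cosprod k' (x - y) * cosprod j' y) =
    cosprod k' x * ip mu (cosprod k') (cosprod j').
  apply: cosprod_convolution; first exact: cosprod_sqint.
    exact: cosprod_periodic.
  exact: cosprod_even.
have : \int[mu]_y (cosprod k (x - y) * cosprod j y) =
    \int[mu]_y (cosprod j (x - y) * cosprod k y).
  rewrite -(@Rintegral_affine R d L L0 (const_mx (-1)) x (fun y => cosprod j (x - y) * cosprod k y)).
  - apply: eq_Rintegral => y _; rewrite -reflE /refl mulrC; congr (_ * _).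
    by rewrite opprB addrC subrK.
  - exact: signsN1.
  - apply: measurable_funM; last exact: measurable_cosprod.
    have := measurable_comp_affine (const_mx (-1)) x (measurable_cosprod j).
    by rewrite -reflE.
  - move=> i y; rewrite cosprod_periodic; congr (_ * _).
    by rewrite opprD addrA periodicN//; exact: cosprod_periodic.
rewrite !H (ipC mu (cosprod j)) => /eqP; rewrite -subr_eq0 -mulrBl mulf_eq0.
by rewrite subr_eq0 (negbTE cx) => /eqP.
Qed.

End cosine_products.

(** * Density of cosine polynomials among even functions *)

Section cosine_density.
Context (R : realType) (d : nat) (L : R).
Hypothesis L0 : 0 < L.
Local Notation T := 'rV[R]_d.
Local Notation mu := (torus_measure L d).
Local Notation periodic := (@Defs.periodic R d L).
Local Notation cosk := (@cosprod R d L).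
Local Notation angL := (@ang R L).
Implicit Types (f g p q : T -> R) (x y : T) (i : 'I_d) (k j : {ffun 'I_d -> nat}).

Definition cospoly (s : seq (R * {ffun 'I_d -> nat})) x : R :=
  \sum_(c <- s) c.1 * cosk c.2 x.

Definition is_cospoly p := exists s, p = cospoly s.

Lemma is_cospoly_lin (a : R) p q :
  is_cospoly p -> is_cospoly q -> is_cospoly (fun x => a * p x + q x).
Proof.
move=> [s ->] [t ->]; exists ([seq (a * c.1, c.2) | c <- s] ++ t).
apply/funext => x; rewrite /cospoly big_cat/= big_map mulr_sumr; congr (_ + _).
by apply: eq_bigr => c _; rewrite mulrA.
Qed.

Lemma is_cospoly_cosprod k : is_cospoly (cosk k).
Proof. by exists [:: (1, k)]; apply/funext => x; rewrite /cospoly big_seq1 mul1r. Qed.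

Lemma cosprod0 x : cosk [ffun=> 0%N] x = 1.
Proof. by rewrite /cosprod big1// => i _; rewrite ffunE /ang mulr0 !mul0r cos0. Qed.

Lemma is_cospoly1 : is_cospoly (fun=> 1).
Proof.
by have := is_cospoly_cosprod [ffun=> 0%N]; congr is_cospoly; apply/funext => x; rewrite cosprod0.
Qed.

Lemma is_cospoly0 : is_cospoly (fun=> 0).
Proof. by exists [::]; apply/funext => x; rewrite /cospoly big_nil. Qed.

Lemma is_cospoly_sum (I : Type) (s : seq I) (F : I -> T -> R) :
  (forall l, is_cospoly (F l)) -> is_cospoly (fun x => \sum_(l <- s) F l x).
Proof.
move=> FP; elim: s => [|l s IH].
  by have := is_cospoly0; congr is_cospoly; apply/funext => x; rewrite big_nil.
have := is_cospoly_lin 1 (FP l) IH; congr is_cospoly; apply/funext => x.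
by rewrite big_cons mul1r.
Qed.

Lemma is_cospoly_scale (a : R) p : is_cospoly p -> is_cospoly (fun x => a * p x).
Proof.
move=> Pp; have := is_cospoly_lin a Pp is_cospoly0; congr is_cospoly.
by apply/funext => x; rewrite addr0.
Qed.

(** Subtraction on nat being truncated, m - n + (n - m) is |m - n|. *)
Lemma cos_ang_mul (m n : nat) (t : R) : cos (angL m t) * cos (angL n t) =
  \sum_(b : bool) 2^-1 * cos (angL (if b then m + n else m - n + (n - m))%N t).
Proof.
rewrite big_bool/=.
have angDn (a b : nat) : angL (a + b)%N t = angL a t + angL b t.
  by rewrite /ang natrD mulrDr !mulrDl.
have -> : cos (angL (m - n + (n - m))%N t) = cos (angL m t - angL n t).
  have [mn|/ltnW nm] := leqP m n.
    rewrite (eqP mn) add0n -[in RHS](subnKC mn) angDn opprD addrA subrr sub0r cosN.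
    by [].
  by rewrite (eqP nm) addn0 -[in RHS](subnKC nm) angDn addrAC subrr add0r.
by rewrite angDn cosD cosB; field.
Qed.

Lemma is_cospoly_cosprod_mul k j : is_cospoly (fun x => cosk k x * cosk j x).
Proof.
pose m (b : {ffun 'I_d -> bool}) : {ffun 'I_d -> nat} :=
  [ffun i => if b i then k i + j i else k i - j i + (j i - k i)]%N.
have -> : (fun x => cosk k x * cosk j x) =
    fun x => \sum_(b : {ffun 'I_d -> bool}) 2^-1 ^+ d * cosk (m b) x.
  apply/funext => x; rewrite /cosprod -big_split/=.
  under eq_bigr => i _ do rewrite cos_ang_mul.
  rewrite bigA_distr_bigA/=; apply: eq_bigr => b _.
  rewrite big_split/= prodr_const card_ord; congr (_ * _).
  by apply: eq_bigr => i _; rewrite ffunE.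
by apply: is_cospoly_sum => b; apply: is_cospoly_scale; exact: is_cospoly_cosprod.
Qed.

Lemma is_cospoly_mul p q : is_cospoly p -> is_cospoly q ->
  is_cospoly (fun x => p x * q x).
Proof.
move=> [s ->] [t ->].
have -> : (fun x => cospoly s x * cospoly t x) = fun x => \sum_(c <- s)
    (\sum_(c' <- t) (c.1 * c'.1) * (cosk c.2 x * cosk c'.2 x)).
  apply/funext => x; rewrite /cospoly mulr_suml; apply: eq_bigr => c _.
  by rewrite mulr_sumr; apply: eq_bigr => c' _; ring.
apply: is_cospoly_sum => c; apply: is_cospoly_sum => c'.
by apply: is_cospoly_scale; exact: is_cospoly_cosprod_mul.
Qed.

Lemma is_cospoly_meas p : is_cospoly p -> measurable_fun setT p.
Proof.
move=> [s ->]; apply: (@measurable_sum _ T R setT _ s (fun c x => c.1 * cosk c.2 x)) => c.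
by apply: measurable_funM => //; exact: measurable_cosprod.
Qed.

Lemma is_cospoly_bnd p : is_cospoly p -> exists B, bounded_by p B.
Proof.
move=> [s ->]; exists (\sum_(c <- s) `|c.1|) => x.
rewrite (le_trans (ler_norm_sum _ _ _))//; apply: ler_sum => c _.
by rewrite normrM ler_piMr// cosprod_le1.
Qed.

Local Notation L2dense := (@L2dense _ _ _ mu is_cospoly).

Lemma dense_indic_measurable (A : set T) : L2dense (\1_A : T -> R) -> measurable A.
Proof.
move=> [[mA _] _]; rewrite (_ : A = (\1_A : T -> R) @^-1` [set 1]).
  by rewrite -[X in measurable X]setTI; apply: mA.
apply/seteqP; split => x /=; first by move=> Ax; rewrite indicE mem_set.
rewrite indicE; case: (boolP (x \in A)) => [/set_mem//|_ /eqP].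
by rewrite eq_sym oner_eq0.
Qed.

(** Stated for an arbitrary map h because it serves twice: for [torus_fold], to reduce to one
    coordinate, then for that folded coordinate, to reduce to half-lines. *)
Lemma sigma_algebra_dense (X : Type) (h : T -> X) :
  sigma_algebra setT [set Y : set X | L2dense (\1_(h @^-1` Y) : T -> R)].
Proof.
have lin := is_cospoly_lin; have mul := is_cospoly_mul; have one := is_cospoly1.
have meas := is_cospoly_meas; have bnd := is_cospoly_bnd.
split => /=.
- rewrite preimage_set0 -setCT; apply: dense_indicC => //.
  by rewrite indicT; exact: dense_P.
- by move=> A dA; rewrite setTD preimage_setC; exact: dense_indicC.
- move=> F dF; rewrite preimage_bigcup; apply: dense_indic_bigcup => // n.
  exact: dense_indic_measurable.
Qed.

(* the representative in [0, L / 2] of the orbit of t under t -> - t and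
   t -> t + L *)
Definition fold_circle (t : R) : R := acos (cos (angL 1 t)) * L / (2 * pi).

Let pi0 : 0 < pi :> R := pi_gt0 R.

Let cos_itv (t : R) : -1 <= cos t <= 1.
Proof. by rewrite cos_geN1 cos_le1. Qed.

Lemma ang_fold (t : R) : angL 1 (fold_circle t) = acos (cos (angL 1 t)).
Proof.
rewrite {1}/ang /fold_circle; move: (acos _) (pi) pi0 => a p p0; field.
by rewrite !gt_eqF.
Qed.

Lemma fold_circleP (t : R) : exists (b : bool) (z : int),
  fold_circle t = (if b then - t else t) + L * z%:~R.
Proof.
have cz (n : int) s : cos (angL 1 (s + L * n%:~R)) = cos (angL 1 s).
  have cn (m : nat) s' : cos (angL 1 (s' + L * m%:R)) = cos (angL 1 s').
    elim: m => [|m IH]; first by rewrite mulr0 addr0.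
    by rewrite -natr1 mulrDr mulr1 addrA cos_angD.
  case: n => n; first exact: cn.
  by rewrite NegzE mulrNz mulrN -[LHS](cn n.+1) subrK.
(* On [0, L / 2] the angle lies in [0, pi], where acos inverts cos. Every other t is brought there
   by t -> - t and t -> t + L, which leave the cosine unchanged. *)
have fid s : 0 <= s <= L / 2 -> fold_circle s = s.
  move=> /andP[s0 s1]; rewrite /fold_circle cosK.
    by rewrite /ang; move: (pi) pi0 => p p0; field; rewrite !gt_eqF.
  rewrite in_itv/= /ang mulr1; apply/andP; split.
    by rewrite !mulr_ge0// ?invr_ge0 ltW.
  rewrite mulrAC ler_pdivrMr// mulrAC -[leRHS]mulrC.
  have := ler_wpM2r (ltW pi0) s1; lra.
pose z := Num.floor (t / L); pose r := t - L * z%:~R.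
have /andP[r0 rL] : 0 <= r < L.
  have /andP[z1 z2] := floor_itv (t / L); rewrite /r.
  rewrite subr_ge0 ltrBlDl -[X in _ < _ + X]mulr1 -mulrDr.
  by rewrite -ler_pdivlMl// mulrC z1/= mulrC -ltr_pdivrMr// -intrD1.
have cr : cos (angL 1 r) = cos (angL 1 t) by rewrite -(cz z r) subrK.
have [r2|/ltW r2] := leP r (L / 2).
  exists false, (- z); rewrite mulrNz mulrN -/r -[RHS]fid ?r0//.
  by rewrite /fold_circle cr.
exists true, (z + 1); rewrite intrD mulrDr mulr1.
have -> : - t + (L * z%:~R + L) = L - r by rewrite /r; ring.
rewrite -[RHS]fid; last by apply/andP; split; lra.
rewrite /fold_circle addrC cos_angD// cos_angN cr//.
Qed.

(** As cos decreases on [0, pi], a sublevel set of the fold is a superlevel set of a single cosine,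
    the kind of set that [dense_indic_lt] handles. *)
Lemma fold_circle_lt (a t : R) : 0 < a <= L / 2 ->
  (fold_circle t < a) = (cos (angL 1 a) < cos (angL 1 t)).
Proof.
move=> /andP[a0 a2].
have c0 : 0 < 2 * pi * 1 / L :> R by rewrite mulr1 divr_gt0// mulr_gt0.
have -> : (fold_circle t < a) = (angL 1 (fold_circle t) < angL 1 a).
  by rewrite /ang ltr_pM2l.
have A1 : angL 1 a \in `[0, pi].
  rewrite in_itv/= /ang mulr1; apply/andP; split; first by rewrite !mulr_ge0 ?invr_ge0 ?ltW.
  rewrite mulrAC ler_pdivrMr//; have := ler_wpM2l (ltW pi0) a2; lra.
have A2 : acos (cos (angL 1 t)) \in `[0, pi].
  by rewrite in_itv/= acos_ge0// acos_lepi.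
by rewrite ang_fold -[in RHS](acosK (x := cos (angL 1 t))) ?in_itv//= ltr_cos.
Qed.

Lemma fold_circle_itv (t : R) : 0 <= fold_circle t <= L / 2.
Proof.
rewrite /fold_circle; have a0 := acos_ge0 (cos_itv (angL 1 t)).
have a1 := acos_lepi (cos_itv (angL 1 t)).
apply/andP; split; first by rewrite divr_ge0 ?(mulr_ge0 a0) ?ltW ?mulr_gt0.
rewrite ler_pdivrMr ?mulr_gt0//.
have := ler_wpM2r (ltW L0) a1; lra.
Qed.

Definition torus_fold x : T := \row_i fold_circle (x ord0 i).

Lemma dense_fold_coord_lt i (a : R) :
  L2dense (\1_[set x : T | fold_circle (x ord0 i) < a] : T -> R).
Proof.
have lin := is_cospoly_lin; have mul := is_cospoly_mul; have one := is_cospoly1.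
have meas := is_cospoly_meas; have bnd := is_cospoly_bnd.
have d1 : L2dense (\1_[set: T] : T -> R) by rewrite indicT; exact: dense_P.
have [a0|a0] := leP a 0.
  rewrite (_ : [set x : T | _] = ~` setT); first exact: dense_indicC.
  apply/seteqP; rewrite setCT; split => x //=; apply/negP; rewrite -leNgt (le_trans a0)//.
  by have /andP[] := fold_circle_itv (x ord0 i).
have [a2|a2] := leP a (L / 2); last first.
  rewrite (_ : [set x : T | _] = setT)//.
  apply/seteqP; split => x //= _; rewrite (le_lt_trans _ a2)//.
  by have /andP[] := fold_circle_itv (x ord0 i).
pose tau := cos (angL 1 a).
pose k : {ffun 'I_d -> nat} := [ffun j => (j == i) : nat].
have ck x : cosk k x = cos (angL 1 (x ord0 i)).
  rewrite /cosprod (bigD1 i)//= ffunE eqxx big1 ?mulr1// => j ji.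
  by rewrite ffunE (negbTE ji) /ang mulr0 !mul0r cos0.
(* p = 1/2 + (tau - cos) / 4 takes values in [0, 1], two cosines differing by at most 2, and p < 1/2
   means that the cosine exceeds tau. *)
pose p x := - 4^-1 * cosk k x + ((2^-1 + tau / 4) * 1).
rewrite (_ : [set x : T | _] = [set x | p x < 2^-1]); last first.
  apply/seteqP; split => x /=; rewrite fold_circle_lt ?a0// -ck -/tau /p; lra.
apply: dense_indic_lt => //.
  apply: is_cospoly_lin; first exact: is_cospoly_cosprod.
  by apply: is_cospoly_scale; exact: is_cospoly1.
move=> x; have /andP[t1 t2] := cos_itv (angL 1 a).
have /andP[c1 c2] := cos_itv (angL 1 (x ord0 i)).
by rewrite /p ck /tau; apply/andP; split; lra.
Qed.

Lemma dense_indic_fold (A : set T) : measurable A -> L2dense (\1_(torus_fold @^-1` A) : T -> R).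
Proof.
move=> mA; pose G := [set Y : set T | L2dense (\1_(torus_fold @^-1` Y) : T -> R)].
suff : measurable `<=` G by apply.
apply: smallest_sub; first exact: sigma_algebra_dense.
rewrite -bigcup_seq; apply: bigcup_sub => i _ _ [Y mY <-]; rewrite setTI /G/=.
pose H := [set Z : set R | L2dense (\1_((fun x : T => fold_circle (x ord0 i)) @^-1` Z) : T -> R)].
have HY : H Y.
  move: mY; rewrite -[measurable]/((@ocitv R).-sigma.-measurable) RGenInftyO.measurableE.
  move: Y; apply: smallest_sub; first exact: sigma_algebra_dense.
  move=> _ [a ->]; rewrite /H /=.
  rewrite (_ : _ @^-1` _ = [set x : T | fold_circle (x ord0 i) < a]).
    exact: dense_fold_coord_lt.
  by apply/seteqP; split => x /=; rewrite in_itv.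
rewrite (_ : _ @^-1` _ = (fun x : T => fold_circle (x ord0 i)) @^-1` Y)//.
by apply/seteqP; split => x /=; rewrite mxE.
Qed.

End cosine_density.

Section folding.
Context (R : realType) (d : nat) (L : R).
Hypothesis L0 : 0 < L.
Local Notation T := 'rV[R]_d.
Local Notation mu := (torus_measure L d).
Local Notation periodic := (@Defs.periodic R d L).
Local Notation torus_fold := (@torus_fold R d L).
Implicit Types (f g : T -> R) (x y : T) (i : 'I_d).

Definition flips (s : seq 'I_d) x : T := foldl (fun y i => flip i y) x s.

Lemma flips_coord (s : seq 'I_d) x j : uniq s ->
  flips s x ord0 j = if j \in s then - x ord0 j else x ord0 j.
Proof.
elim: s x => [//|i s IH] x /= /andP[is_ us]; rewrite -[LHS]/(flips s (flip i x) ord0 j).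
rewrite IH// in_cons mxE; case: (eqVneq j i) => [->|_]//=.
by rewrite (negbTE is_).
Qed.

Lemma even_flips f (s : seq 'I_d) x : coord_even f -> f (flips s x) = f x.
Proof.
by move=> fe; elim: s x => [//|i s IH] x; rewrite -[flips _ _]/(flips s (flip i x)) IH fe.
Qed.

Lemma foldP x : exists (A : {set 'I_d}) (z : 'rV[int]_d),
  torus_fold x = flips (enum A) x + L *: map_mx intr z.
Proof.
have /choice[h hP] i : exists p : bool * int,
    fold_circle L (x ord0 i) = (if p.1 then - x ord0 i else x ord0 i) + L * p.2%:~R.
  by have [b [z e]] := fold_circleP L0 (x ord0 i); exists (b, z).
exists [set i | (h i).1]%SET, (\row_i (h i).2); apply/rowP => i.
by rewrite !mxE flips_coord ?enum_uniq// mem_enum inE hP.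
Qed.

Lemma comp_fold f x : periodic f -> coord_even f -> f (torus_fold x) = f x.
Proof.
by move=> fL fe; have [A [z ->]] := foldP x; rewrite periodic_int// even_flips.
Qed.

(** An even periodic function is invariant under [torus_fold], hence a limit of simple functions of
    the fold, whose level sets are already in the closure. *)
Lemma cosine_dense g : sqint mu g -> periodic g -> coord_even g ->
  L2dense mu (@is_cospoly R d L) g.
Proof.
move=> gs gL ge; apply: (@dense_comp _ _ _ mu _ _ _ _ _ torus_fold) => //.
- exact: is_cospoly_meas.
- exact: is_cospoly_bnd.
- by move=> k p q; exact: is_cospoly_lin.
- exact: is_cospoly1.
- exact: dense_indic_fold.
- by move=> x; exact: comp_fold.
Qed.

Lemma measurable_fold : measurable_fun setT torus_fold.
Proof.
by move=> _ A mA; rewrite setTI; apply: dense_indic_measurable; exact: dense_indic_fold.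
Qed.

Lemma fold_periodic f : periodic (f \o torus_fold).
Proof.
move=> i x /=; congr f; apply/rowP => j; rewrite !mxE /=.
case: eqP => _; last by rewrite mulr0 addr0.
by rewrite mulr1 /fold_circle cos_angD.
Qed.

Lemma fold_even f : coord_even (f \o torus_fold).
Proof.
move=> i x /=; congr f; apply/rowP => j; rewrite !mxE.
by case: ifP => // _; rewrite /fold_circle cos_angN.
Qed.

(** At each x the fold is one of finitely many families of sign changes followed by a lattice
    translation, so finitely many almost everywhere identities suffice. This yields a representative
    of W that is even at every point. *)
Lemma ae_fold f : measurable_fun setT f -> periodic f ->
  (forall i, {ae mu, forall x, f (flip i x) = f x}) ->
  {ae mu, forall x, f (torus_fold x) = f x}.
Proof.
move=> mf fL fe.
have mp (s : seq 'I_d) : measurable_fun setT (f \o flips s) /\ periodic (f \o flips s).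
  elim: s => [|i s [ms ps]]; first by [].
  split; last exact: (periodic_flip i ps).
  rewrite -[_ \o _]/((f \o flips s) \o flip i) flipE; exact: measurable_comp_affine.
have fs (s : seq 'I_d) : {ae mu, forall x, f (flips s x) = f x}.
  elim: s => [|i s IH]; first exact: nearW.
  have [ms ps] := mp s.
  have := ae_affine L0 0 (signs_flip R i) ms mf ps fL IH.
  rewrite -flipE => h; move: h (fe i); apply: filterS2 => x h1 h2.
  by rewrite -[LHS]/((f \o flips s) (flip i x)) h1 h2.
have fA : \forall x \ae mu, forall A : {set 'I_d}, f (flips (enum A) x) = f x.
  by apply: filter_forall => A; exact: fs.
apply: filterS fA => x fA; have [A [z ->]] := foldP x.
by rewrite periodic_int.
Qed.

End folding.

(** * Square integrability in terms of the L^2 norm *)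

Section square_integrable_norm.
Context d (T : measurableType d) (R : realType).
Variable mu : {finite_measure set T -> \bar R}.
Implicit Types (f : T -> R).

Lemma integral_sqrE f : (\int[mu]_x (`|(EFin \o f) x| `^ 2))%E =
  (\int[mu]_x `|((f x) ^+ 2)%:E|)%E.
Proof.
apply: eq_integral => x _; rewrite /= normrX -powR_mulrn//.
Qed.

Lemma sqint_Lfun f : f \in Lfun mu 2%:E <-> sqint mu f.
Proof.
split=> [/andP[mf nf]|[mf /integrableP[_ f2]]].
  have {}mf : measurable_fun setT f by move: mf; rewrite inE.
  split => //; apply/integrableP; split.
    by apply/measurable_EFinP; exact: measurable_funX.
  have := nf; rewrite inE /= /finite_norm unlock/= integral_sqrE.
  by apply: lty_poweRy; rewrite invr_neq0.
apply/andP; split; first by rewrite inE.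
rewrite inE /= /finite_norm unlock/= integral_sqrE.
by rewrite poweR_lty.
Qed.

Lemma Lnorm2_le f (B : R) : measurable_fun setT f -> bounded_by f B -> 0 <= B ->
  ('N[mu]_2%:E[EFin \o f] <= (B * Num.sqrt (fine (mu setT)))%:E)%E.
Proof.
move=> mf fB B0; rewrite unlock/= integral_sqrE.
have h : (\int[mu]_x `|((f x) ^+ 2)%:E| <= (B ^+ 2 * fine (mu setT))%:E)%E.
  rewrite EFinM fineK ?fin_num_measure// -integral_cst//; apply: ge0_le_integral => //.
  - apply/measurable_EFinP; apply: measurableT_comp => //; exact: measurable_funX.
    - by move=> x _; rewrite lee_fin normrX lerXn2r// nnegrE.
apply: (le_trans (gt0_ler_poweR (r := 2^-1) _ _ _ h)).
- by rewrite invr_ge0.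
- by rewrite in_itv/= leey andbT; exact: integral_ge0.
- by rewrite in_itv/= leey andbT lee_fin mulr_ge0 ?sqr_ge0// fine_ge0.
rewrite /= lee_fin powR12_sqrt ?mulr_ge0 ?sqr_ge0 ?fine_ge0//.
by rewrite sqrtrM ?sqr_ge0// sqrtr_sqr ger0_norm.
Qed.

End square_integrable_norm.

(** * Convolution with an even kernel *)

Section bounded_pairing.
Context d (T : measurableType d) (R : realType).
Variable mu : {finite_measure set T -> \bar R}.

Lemma Rintegral_le_bounded (f : T -> R) (B : R) : measurable_fun setT f ->
  bounded_by f B -> `|\int[mu]_x f x| <= B * fine (mu setT).
Proof.
move=> mf fB; apply: (le_trans (le_normr_Rintegral _ _)) => //.
  exact: bounded_integrable mf fB.
rewrite -Rintegral_cst//; apply: le_Rintegral => //.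
- apply: (@bounded_integrable _ _ _ _ (fun x => `|f x|) B).
    exact: measurableT_comp.
  by move=> x; rewrite normr_id.
- exact: finite_measure_integrable_cst.
Qed.

Lemma ip_bounded (f g : T -> R) (B C : R) : measurable_fun setT f ->
  measurable_fun setT g -> bounded_by f B -> bounded_by g C ->
  `|ip mu f g| <= B * C * fine (mu setT).
Proof.
move=> mf mg fB gC; apply: Rintegral_le_bounded; first exact: measurable_funM.
by move=> x; rewrite normrM ler_pM.
Qed.

End bounded_pairing.

Section even_kernel.
Context (R : realType) (d : nat) (L : R).
Hypothesis L0 : 0 < L.
Local Notation T := 'rV[R]_d.
Local Notation mu := (torus_measure L d).
Local Notation periodic := (@Defs.periodic R d L).
Local Notation om := (@omega R d L).
Local Notation Theta := (@Theta R d).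
Local Notation cosk := (@cosprod R d L).
Implicit Types (f g : T -> R) (x y : T) (i : 'I_d) (k j : {ffun 'I_d -> nat}).

Definition even_periodic f := [/\ measurable_fun setT f, periodic f & coord_even f].

Lemma omegaE k : om k = fun x => Theta k / L `^ (d%:R / 2) * cosk k x.
Proof. by []. Qed.

Lemma Theta_gt0 k : 0 < Theta k.
Proof.
apply: prodr_gt0 => i _; rewrite sqrtr_gt0.
by case: (k i == 0%N); rewrite /= ?subr0// -natrB.
Qed.

Lemma Ld_gt0 : 0 < L `^ (d%:R / 2).
Proof. exact: powR_gt0. Qed.

Lemma Ld_sqr : L `^ (d%:R / 2) ^+ 2 = L ^+ d.
Proof.
rewrite -powR_mulrn ?powR_ge0// -powRrM -powR_mulrn ?ltW//; congr (_ `^ _).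
by rewrite divfK.
Qed.

Lemma even_periodic_cosprod k : even_periodic (cosk k).
Proof.
split; [exact: measurable_cosprod|exact: cosprod_periodic|exact: cosprod_even].
Qed.

Lemma even_scale (a : R) f : even_periodic f -> even_periodic (fun x => a * f x).
Proof.
by move=> [mf fL fe]; split; [exact: measurable_funM|move=> i x; rewrite fL|move=> i x; rewrite fe].
Qed.

Lemma even_periodic_omega k : even_periodic (om k).
Proof. by rewrite omegaE; apply: even_scale; exact: even_periodic_cosprod. Qed.

Definition omega_bound k : R := Theta k / L `^ (d%:R / 2).

Lemma omega_bound_gt0 k : 0 < omega_bound k.
Proof. by rewrite divr_gt0 ?Theta_gt0 ?Ld_gt0. Qed.

Lemma omega_bounded k : bounded_by (om k) (omega_bound k).
Proof.
have b0 := omega_bound_gt0 k; move=> x; rewrite omegaE -/(omega_bound k) normrM gtr0_norm//.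
by rewrite ler_piMr ?(ltW b0)// cosprod_le1.
Qed.

Lemma omega_sqint k : sqint mu (om k).
Proof.
have [m _ _] := even_periodic_omega k; exact: bounded_sqint m (@omega_bounded k).
Qed.

Lemma ip_omega k j : ip mu (om k) (om j) = (k == j)%:R.
Proof.
rewrite !omegaE ipZl; [|exact: cosprod_sqint|exact: omega_sqint].
rewrite ipC ipZl; [|exact: cosprod_sqint|exact: cosprod_sqint].
case: eqVneq => [<-|kj]; last by rewrite ip_cosprod_neq ?mulr0// eq_sym.
rewrite (ip_cosprod_diag L0); set p := \prod_i _.
have -> : p = (Theta k ^+ 2)^-1.
  rewrite /p /Defs.Theta -prodrXl -prodfV; apply: eq_bigr => i _.
  rewrite sqr_sqrtr; first by case: (k i == 0%N); rewrite /= ?subr0 // -natrB//= invr1.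
  by case: (k i == 0%N); rewrite /= ?subr0// -natrB.
rewrite -[RHS]/1; have := Theta_gt0 k; have := Ld_gt0; have := Ld_sqr.
set l := L `^ _; move: (Theta k) => t <- l0 t0; field.
by rewrite !gt_eqF.
Qed.

Lemma omega_convolution k f x : sqint mu f -> periodic f -> coord_even f ->
  \int[mu]_y (om k (x - y) * f y) =
  L `^ (d%:R / 2) / Theta k * ip mu f (om k) * om k x.
Proof.
move=> fs fL fe; rewrite ipC omegaE.
have t0 := Theta_gt0 k; have l0 := Ld_gt0.
rewrite ipZl//; last exact: cosprod_sqint.
transitivity (Theta k / L `^ (d%:R / 2) * \int[mu]_y (cosk k (x - y) * f y)).
  rewrite -RintegralZl//; first by apply: eq_Rintegral => y _; rewrite mulrA.
  apply: sqint_mul_integrable => //.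
  have := affine_sqint L0 x (@signsN1 R d) (@cosprod_periodic R d L L0 k) (cosprod_sqint L k).
  by rewrite -reflE.
rewrite cosprod_convolution// /ip; field; rewrite !gt_eqF//.
Qed.

Variable K : T -> R.
Hypothesis Ks : sqint mu K.
Hypothesis Kg : even_periodic K.

Definition torus_conv f x : R := \int[mu]_y (K (x - y) * f y).

(* eigenvalue of [torus_conv K] on even functions for the eigenvector [omega k] *)
Definition multiplier k : R := L `^ (d%:R / 2) / Theta k * ip mu K (om k).

Definition truncation (S : seq {ffun 'I_d -> nat}) f x : R :=
  \sum_(k <- S) multiplier k * ip mu f (om k) * om k x.

Lemma refl_sqint f x : sqint mu f -> periodic f -> sqint mu (f \o refl x).
Proof. by move=> fs fL; rewrite reflE; apply: (affine_sqint L0) => //; exact: signsN1. Qed.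

Lemma ip_refl f x : measurable_fun setT f -> periodic f ->
  ip mu (f \o refl x) (f \o refl x) = ip mu f f.
Proof.
move=> mf fL; rewrite reflE.
apply: (@Rintegral_affine R d L L0 _ _ (fun y => f y * f y)); first exact: signsN1.
  exact: measurable_funM.
by move=> i y; rewrite fL.
Qed.

Lemma conv_bounded : exists C : R, forall f (B : R), 0 <= B -> even_periodic f ->
  bounded_by f B -> bounded_by (torus_conv f) (C * B).
Proof.
have [mK KL _] := Kg; set m := fine (mu setT).
(* [ip_le_bounded] asks for e > 0 with ip K K <= e^2; this choice takes no square root. *)
pose e := ip mu K K + 1; exists (e * (m + 1) / 2) => f B B0 [mf _ _] fB x.
rewrite mulrC mulrA mulrA; apply: ip_le_bounded => //.
- exact: (refl_sqint x Ks KL).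
- by rewrite ltr_wpDl// ip_ge0.
- rewrite -[X in ip _ X _]/(K \o refl x) -[X in ip _ _ X]/(K \o refl x) ip_refl//.
  have := ip_ge0 mu K; rewrite /e; nra.
Qed.

Lemma conv_lin (a : R) f g : sqint mu f -> sqint mu g ->
  torus_conv (fun y => a * f y + g y) = fun x => a * torus_conv f x + torus_conv g x.
Proof.
move=> fs gs; have [mK KL _] := Kg; apply/funext => x.
have Kx := refl_sqint x Ks KL.
rewrite -[LHS]/(ip mu (K \o refl x) _) ipC ipDl//; last exact: sqintZ.
by rewrite ipZl// ipC [X in _ + X]ipC.
Qed.

Definition partial_kernel (S : seq {ffun 'I_d -> nat}) x : R :=
  \sum_(k <- S) ip mu K (om k) * om k x.

Lemma partial_kernel_sqint S : sqint mu (partial_kernel S).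
Proof. by apply: sqint_sum => k; apply: sqintZ; exact: omega_sqint. Qed.

(** Best approximation: K - partial_kernel S is orthogonal to the modes in S, hence to its
    difference with the polynomial, and Pythagoras applies. *)
Lemma truncation_residual (S : seq {ffun 'I_d -> nat}) (s : seq (R * {ffun 'I_d -> nat})) :
  uniq S -> {subset [seq c.2 | c <- s] <= S} ->
  dist2 mu K (partial_kernel S) <= dist2 mu K (cospoly L s).
Proof.
move=> US sS; pose rho x := K x - partial_kernel S x.
rewrite -[leLHS]/(ip mu rho rho); have Ss := partial_kernel_sqint S.
have rs : sqint mu rho by exact: sqintB.
have r0 k : k \in S -> ip mu (om k) rho = 0.
  move=> kS; rewrite ipC ipBl//; last exact: omega_sqint.
  rewrite ip_suml; [|by move=> j; apply: sqintZ; exact: omega_sqint|exact: omega_sqint].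
  rewrite (bigD1_seq k)//= ipZl; try exact: omega_sqint.
  rewrite ip_omega eqxx mulr1 big1 ?addr0 ?subrr// => j jk.
  by rewrite ipZl; try exact: omega_sqint; rewrite ip_omega (negbTE jk) mulr0.
have r1 k : k \in S -> ip mu (cosk k) rho = 0.
  move=> kS; have := r0 k kS; rewrite omegaE ipZl//; last exact: cosprod_sqint.
  by move/eqP; rewrite mulf_eq0 gt_eqF ?divr_gt0 ?Theta_gt0 ?Ld_gt0//= => /eqP.
pose q x := partial_kernel S x - cospoly L s x.
have ps : sqint mu (cospoly L s).
  by apply: sqint_sum => c; apply: sqintZ; exact: cosprod_sqint.
have qs : sqint mu q by exact: sqintB.
have q0 : ip mu q rho = 0.
  rewrite ipBl// !ip_suml//.
  - rewrite big_seq big1; last first.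
      by move=> k kS; rewrite ipZl ?r0 ?mulr0//; exact: omega_sqint.
    rewrite big_seq big1 ?subr0// => c cs.
    by rewrite ipZl ?r1 ?mulr0//; [apply: sS; exact: map_f|exact: cosprod_sqint].
  - by move=> c; apply: sqintZ; exact: cosprod_sqint.
  - by move=> k; apply: sqintZ; exact: omega_sqint.
have E : (fun x => K x - cospoly L s x) = fun x => rho x + q x.
  by apply/funext => x; rewrite /rho /q addrA subrK.
have rqs : sqint mu (fun x => rho x + q x) by exact: (sqintD rs qs).
rewrite /dist2 !E (ipDl rs qs rqs) [X in X + _]ipC [X in _ + X]ipC (ipDl rs qs rs) (ipDl rs qs qs).
rewrite q0 addr0 [ip mu rho q]ipC q0 add0r.
by rewrite lerDl ip_ge0.
Qed.

(** The tail of the kernel is small in L^2, and so are all its reflections y -> x - y; paired with a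
    bounded function they are small uniformly in x. Projecting on more modes only improves the tail,
    so S may contain prescribed ones. *)
Lemma conv_truncation (e : R) (S0 : seq {ffun 'I_d -> nat}) : 0 < e ->
  exists S, [/\ uniq S, {subset S0 <= S} & forall f (B : R), 0 <= B -> even_periodic f ->
    bounded_by f B -> bounded_by (fun x => torus_conv f x - truncation S f x) (e * B)].
Proof.
move=> e0; have [mK KL Ke] := Kg; set m := fine (mu setT).
have m1 : 0 < m + 1 by rewrite ltr_wpDl// fine_ge0.
(* Chosen so that the bound B * h * (m + 1) / 2 of [ip_le_bounded] equals e * B. *)
pose h := e * 2 / (m + 1); have h0 : 0 < h by rewrite divr_gt0// mulr_gt0.
have [_ /(_ (h ^+ 2))] := cosine_dense L0 Ks KL Ke.
rewrite exprn_gt0// => /(_ isT)[_ [s ->] sh].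
pose S := undup (S0 ++ [seq c.2 | c <- s]); exists S.
have US : uniq S by exact: undup_uniq.
split => //; first by move=> k kS; rewrite mem_undup mem_cat kS.
move=> f B B0 [mf fL fe] fB x; have fs := bounded_sqint mu mf fB.
pose rho x := K x - partial_kernel S x; have Ss := partial_kernel_sqint S.
have rs : sqint mu rho by exact: sqintB.
have SL : periodic (partial_kernel S).
  move=> i y; apply: eq_bigr => k _; congr (_ * _).
  by have [_ oL _] := even_periodic_omega k; exact: oL.
have rL : periodic rho by move=> i y; rewrite /rho KL SL.
have -> : torus_conv f x - truncation S f x = ip mu (rho \o refl x) f.
  have Kx := refl_sqint x Ks KL; have Sx := refl_sqint x Ss SL.
  rewrite -[rho \o refl x]/(fun y => (K \o refl x) y - (partial_kernel S \o refl x) y).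
  rewrite ipBl//; congr (_ - _).
  have Ox k : sqint mu (om k \o refl x).
    by have [_ oL _] := even_periodic_omega k; apply: refl_sqint => //; exact: omega_sqint.
  rewrite [RHS](@ip_suml _ _ _ mu _ S (fun k y => ip mu K (om k) * (om k \o refl x) y))//.
    apply: eq_bigr => k _; rewrite ipZl// -[X in _ = _ * X]/(\int[mu]_y (om k (x - y) * f y)).
    by rewrite omega_convolution// /multiplier; ring.
  by move=> k; exact: sqintZ.
apply: (le_trans (ip_le_bounded (refl_sqint x rs rL) mf fB h0 B0 _)).
  have [mr _] := rs; rewrite ip_refl//; apply: le_trans sh.
  by apply: truncation_residual => // k ks; rewrite mem_undup mem_cat ks orbT.
by rewrite -/m /h le_eqVlt; apply/orP; left; apply/eqP; field; rewrite gt_eqF.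
Qed.

Lemma even_periodic_truncation S f : even_periodic (truncation S f).
Proof.
split.
- apply: (@measurable_sum _ T R setT _ S (fun k x => multiplier k * ip mu f (om k) * om k x)) => k.
  by apply: measurable_funM => //; have [] := even_periodic_omega k.
- by move=> i x; apply: eq_bigr => k _; congr (_ * _); have [_ oL _] := even_periodic_omega k; exact: oL.
- by move=> i x; apply: eq_bigr => k _; congr (_ * _); have [_ _ oe] := even_periodic_omega k; exact: oe.
Qed.

Lemma even_lim (u : nat -> T -> R) f : (forall n, even_periodic (u n)) ->
  (forall x, u n x @[n --> \oo] --> f x) -> even_periodic f.
Proof.
move=> ug uf; split.
- apply: (measurable_fun_cvg (h := u)); first by move=> n; have [] := ug n.
  by move=> x _; exact: uf.
- move=> i x; apply: (cvg_unique _ (uf _)) => //; have := uf x.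
  by rewrite (_ : (fun n => u n x) = fun n => u n (x + L *: unit_vec R i))//; apply/funext => n; have [_ -> _] := ug n.
- move=> i x; apply: (cvg_unique _ (uf _)) => //; have := uf x.
  by rewrite (_ : (fun n => u n x) = fun n => u n (flip i x))//; apply/funext => n; have [_ _ ->] := ug n.
Qed.

(** The convolution is a uniform limit of truncations, which are finite sums of cosine products:
    measurability, periodicity and evenness all pass to the limit. *)
Lemma even_periodic_conv f (B : R) : 0 <= B -> even_periodic f -> bounded_by f B -> even_periodic (torus_conv f).
Proof.
move=> B0 fg fB.
have /choice[S SP] n : exists S, bounded_by (fun x => torus_conv f x - truncation S f x) (n.+1%:R^-1 * B).
  have n0 : 0 < n.+1%:R^-1 :> R by rewrite invr_gt0.
  by have [S [_ _ h]] := conv_truncation [::] n0; exists S; exact: h.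
apply: (@even_lim (fun n => truncation (S n) f)) => [n|x]; first exact: even_periodic_truncation.
apply/cvgrPdist_le => e e0; near=> n; rewrite (le_trans (SP n x))//.
rewrite mulrC ler_pdivrMr//; near: n.
exists (Num.trunc (B / e)).+1 => // n /= nB.
rewrite -ler_pdivrMl// mulrC ltW//.
have := truncnS_gt (B / e); move=> /lt_le_trans; apply; rewrite ler_nat.
exact: leq_trans nB (leqnSn _).
Unshelve. all: by end_near. Qed.

(** The identity is exact for a truncation whose set of modes contains k, and truncations converge
    uniformly to the convolution. *)
Lemma ip_conv f (B : R) k : 0 <= B -> even_periodic f -> bounded_by f B ->
  ip mu (torus_conv f) (om k) = multiplier k * ip mu f (om k).
Proof.
move=> B0 fg fB; have [mf fL fe] := fg; have [mc _ _] := even_periodic_conv B0 fg fB.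
have [mo _ _] := even_periodic_omega k.
have [C CP] := conv_bounded; have cs := bounded_sqint mu mc (CP f B B0 fg fB).
set m := fine (mu setT); have m0 : 0 <= m by rewrite fine_ge0.
pose D := B * omega_bound k * m.
have D0 : 0 <= D.
  by apply: mulr_ge0 => //; apply: mulr_ge0 => //; exact: ltW (omega_bound_gt0 k).
apply/eqP; rewrite -subr_eq0 -normr_le0; apply/ler_addgt0Pl => e e0; rewrite addr0.
have eD : 0 < e / (D + 1) by rewrite divr_gt0// ltr_wpDl.
have [S [US kS SP]] := conv_truncation [:: k] eD.
have [mt _ _] := even_periodic_truncation S f.
have ts : sqint mu (truncation S f).
  by apply: sqint_sum => j; apply: sqintZ; exact: omega_sqint.
have -> : multiplier k * ip mu f (om k) = ip mu (truncation S f) (om k).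
  rewrite ip_suml; [|by move=> j; apply: sqintZ; exact: omega_sqint|exact: omega_sqint].
  rewrite (bigD1_seq k)//=; last by apply: kS; rewrite mem_head.
  rewrite ipZl; try exact: omega_sqint.
  rewrite ip_omega eqxx mulr1 big1 ?addr0// => j jk.
  by rewrite ipZl; try exact: omega_sqint; rewrite ip_omega (negbTE jk) mulr0.
rewrite -ipBl//; last exact: omega_sqint.
apply: (le_trans (ip_bounded mu _ mo (SP f B B0 fg fB) (@omega_bounded k))).
  exact: measurable_funB.
rewrite -/m (_ : _ * _ * m = e * (D / (D + 1))); last by rewrite /D; field; rewrite gt_eqF// ltr_wpDl.
have D1 : 0 < D + 1 by rewrite ltr_wpDl.
by rewrite ler_piMr ?(ltW e0)// ler_pdivrMr// mul1r lerDl.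
Qed.

End even_kernel.

(** * The averaged kernel of the four component model *)

Section model_kernel.
Context (R : realType) (d : nat) (L : R).
Hypothesis L0 : 0 < L.
Local Notation T := 'rV[R]_d.
Local Notation mu := (torus_measure L d).
Local Notation periodic := (@Defs.periodic R d L).
Local Notation om := (@omega R d L).
Local Notation cosk := (@cosprod R d L).
Variables (W : T -> R) (r : 'I_4 -> T).
Hypothesis WS : L2S L W.
Hypothesis re : coordinatewise_even L r.
Implicit Types (f g : T -> R) (x y : T) (i : 'I_d) (k : {ffun 'I_d -> nat}) (b : 'I_4).

(* W is even only almost everywhere *)
Let Wf : T -> R := W \o torus_fold L.

Definition model_kernel x : R := 4^-1 * \sum_(b < 4) Wf (x - r b).

Let WL : periodic W.
Proof. by have [[]] := WS. Qed.

Let Ws : sqint mu W.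
Proof. by have [[_ /sqint_Lfun]] := WS. Qed.

Let Wae : {ae mu, forall x, Wf x = W x}.
Proof. by apply: ae_fold => //; [have [] := Ws|have [] := WS]. Qed.

Let mWf : measurable_fun setT Wf.
Proof. by apply: measurableT_comp; [have [] := Ws|exact: measurable_fold]. Qed.

Let WfL : periodic Wf.
Proof. exact: fold_periodic. Qed.

Let Wfe : coord_even Wf.
Proof. exact: fold_even. Qed.

Lemma ae_eq_RintegralT f g : measurable_fun setT f -> measurable_fun setT g ->
  {ae mu, forall x, f x = g x} -> \int[mu]_x f x = \int[mu]_x g x.
Proof.
move=> mf mg fg; congr fine; apply: ae_eq_integral => //; try exact/measurable_EFinP.
by apply: filterS fg => x /= -> _.
Qed.

Let Wfs : sqint mu Wf.
Proof.
split => //; have [mW /integrableP[m2 W2]] := Ws; apply/integrableP; split.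
  by apply/measurable_EFinP; exact: measurable_funX.
move: W2; congr (_ < _)%E; apply: ae_eq_integral => //.
- exact: measurableT_comp.
- by apply: measurableT_comp => //; apply/measurable_EFinP; exact: measurable_funX.
- by apply: filterS Wae => x /= -> _.
Qed.

Let trans_sqint a : sqint mu (fun x => Wf (x - a)).
Proof.
have := affine_sqint L0 (- a) (@signs1 R d) WfL Wfs.
by rewrite -transE.
Qed.

Lemma model_kernel_sqint : sqint mu model_kernel.
Proof. by apply: sqintZ; apply: sqint_sum => b; exact: trans_sqint. Qed.

(** A sign change permutes the four shifts modulo the lattice, and [Wf] is even and periodic, so the
    sum is merely reindexed. *)
Lemma even_periodic_model_kernel : even_periodic L model_kernel.
Proof.
split; first by have [] := model_kernel_sqint.
  by move=> i x; congr (_ * _); apply: eq_bigr => b _; rewrite addrAC WfL.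
move=> i x; congr (_ * _); have [s sP] := re i.
rewrite [RHS](reindex_inj (@perm_inj _ s))/=; apply: eq_bigr => b _.
have [z zP] := sP b.
rewrite -[X in _ - X](flipK i) -flipB Wfe zP opprD addrA.
have -> : - (L *: map_mx intr z) = L *: map_mx intr (- z) :> T.
  by rewrite -scalerN; congr (_ *: _); apply/matrixP => p q; rewrite !mxE mulrNz.
by rewrite periodic_int.
Qed.

Lemma cosprodN k x : cosk k (- x) = cosk k x.
Proof. by apply: eq_bigr => i _; rewrite mxE cos_angN. Qed.

Lemma ip_model_kernel k : ip mu model_kernel (om k) =
  cos_coef L W k * (4^-1 * \sum_(b < 4) cosk k (r b)).
Proof.
have cW : cos_coef L W k = ip mu Wf (om k).
  have [mo _ _] := even_periodic_omega L0 k; have [mW _] := Ws.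
  apply: ae_eq_RintegralT; try exact: measurable_funM.
  by apply: filterS Wae => x /= ->.
rewrite /model_kernel ipZl; try exact: omega_sqint; last first.
  by apply: sqint_sum => b; exact: trans_sqint.
rewrite [in LHS](@ip_suml _ _ _ mu _ _ (fun b x => Wf (x - r b)))//; last exact: omega_sqint.
rewrite mulrCA; congr (_ * _); rewrite mulr_sumr; apply: eq_bigr => b _.
rewrite cW /ip.
transitivity (\int[mu]_x (Wf x * om k (x + r b))).
  rewrite -(@Rintegral_affine R d L L0 (const_mx 1) (- r b) (fun x => Wf x * om k (x + r b))).
  - by rewrite -transE; apply: eq_Rintegral => x _; rewrite subrK.
  - exact: signs1.
  - apply: measurable_funM => //; have [mo _ _] := even_periodic_omega L0 k.
    have := measurable_comp_affine (const_mx 1) (r b) mo; by rewrite -transE.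
  - move=> i x; rewrite WfL addrAC; congr (_ * _); have [_ oL _] := even_periodic_omega L0 k; exact: oL.
(* As [omega k] is even, pairing [Wf] with its translate is a convolution at - r b, which
   [omega_convolution] evaluates. *)
transitivity (\int[mu]_x (om k (- r b - x) * Wf x)).
  apply: eq_Rintegral => x _; rewrite mulrC /omega -!/(cosk k _) -opprD cosprodN.
  by rewrite [x + _]addrC.
rewrite omega_convolution// omegaE cosprodN.
have t0 := Theta_gt0 R k; have l0 := Ld_gt0 d L0.
rewrite /ip; set I := \int[mu]_x _.
by move: I (cosk k (r b)) => I c; field; rewrite !gt_eqF.
Qed.

Lemma multiplier_model_kernel k : multiplier L model_kernel k =
  L `^ (d%:R / 2) * (cos_coef L W k / Theta R k * (4^-1 * \sum_(b < 4) cosk k (r b))).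
Proof. by rewrite /multiplier ip_model_kernel; ring. Qed.

Lemma model_convolution f x : sqint mu f ->
  4^-1 * \sum_(b < 4) convolution L (fun z => W (z - r b)) f x = torus_conv L model_kernel f x.
Proof.
move=> fs; have [mW _] := Ws; have [mf _] := fs.
have E b : convolution L (fun z => W (z - r b)) f x = ip mu (fun y => Wf (x - y - r b)) f.
  have em g : measurable_fun setT g -> measurable_fun setT (fun y => g (x - y - r b)).
    move=> mg; have := measurable_comp_affine (const_mx (-1)) (x - r b) mg; congr measurable_fun.
    by rewrite -reflE; apply/funext => y; rewrite /= /refl addrAC.
  apply: ae_eq_RintegralT.
  - by apply: measurable_funM => //; exact: em.
  - by apply: measurable_funM => //; exact: em.
  - have Wae' : {ae mu, forall x, W x = Wf x} by apply: filterS Wae => y /esym.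
    have := ae_affine L0 (x - r b) (@signsN1 R d) mW mWf WL WfL Wae'.
    by rewrite -reflE; apply: filterS => y; rewrite /refl [x - r b - y]addrAC => ->.
under eq_bigr => b _ do rewrite E.
have Es b : sqint mu (fun y => Wf (x - y - r b)).
  have := affine_sqint L0 (x - r b) (@signsN1 R d) WfL Wfs.
  by rewrite -reflE; congr sqint; apply/funext => y; rewrite /= /refl addrAC.
rewrite -(@ip_suml _ _ _ mu _ _ (fun b y => Wf (x - y - r b)))// -ipZl//.
by apply: sqint_sum.
Qed.

Lemma conv_model_kernel1 x : torus_conv L model_kernel (fun=> 1) x = W0 L W.
Proof.
rewrite -model_convolution; last exact: sqint1.
have E b : convolution L (fun z => W (z - r b)) (fun=> 1) x = W0 L W.
  have [mW _] := Ws; rewrite /W0 -(@Rintegral_affine R d L L0 (const_mx (-1)) (x - r b) W)//; last exact: signsN1.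
  by apply: eq_Rintegral => y _; rewrite mulr1 -reflE /refl addrAC.
under eq_bigr => b _ do rewrite E.
by rewrite sumr_const card_ord -[X in _ * X]mulr_natl mulrA mulVf ?mul1r.
Qed.

End model_kernel.

(** * Preconditioned curves *)

Lemma sum_bounds (R : realType) (c u v : R) : 0 <= c -> 0 <= u -> 0 <= v ->
  [/\ u <= c + v + u + (c + c), v <= c + v + u + (c + c) & c + c <= c + v + u + (c + c)].
Proof. by move=> c0 u0 v0; split; lra. Qed.

Section preconditioned_curve.
Context (R : realType) (I : Type).
Local Notation Y := (I -> R).
Implicit Types (s k D q : R) (y z : Y) (i : I).

Variable good : Y -> Prop.
Hypothesis good_lim : forall (u : nat -> Y) (l : Y), (forall n, good (u n)) ->
  (forall i, u n i @[n --> \oo] --> l i) -> good l.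
Hypothesis good_lin : forall k z z', good z -> good z' ->
  good (fun i => k * z i + z' i).

(** Linearity is required on bounded members of the class only: the operators are integrals,
    additive where the integrands are integrable. *)
Definition bounded_linear (c : R) (O : Y -> Y) := forall z D, 0 <= D -> good z ->
  bounded_by z D -> [/\ good (O z), bounded_by (O z) (c * D) &
    forall k z', good z' -> bounded_by z' D ->
      forall i, O (fun i => k * z i + z' i) i = k * O z i + O z' i].

(* The unknown solves [y = y0 + O (nu s y) + E y]: [O] inverts the linearization
   away from a small remainder [E], and the linear part [m] of [nu] vanishes at
   [(0, y0)]. *)
Variables (O E : Y -> Y) (y0 : Y) (nu a : R -> Y -> Y) (m : R -> Y -> Y -> Y).
Variables (q1 C : R).
Hypotheses (q10 : 0 < q1) (C0 : 0 <= C) (good_y0 : good y0).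
Hypotheses (O_blin : bounded_linear C O) (E_blin : bounded_linear 4^-1 E).
Hypothesis y0C : bounded_by y0 C.
Hypothesis Ey0 : forall i, E y0 i = 0.

Definition near1 q s y := [/\ `|s| <= q, good y & dist_le y y0 q].

Hypothesis nu_good : forall s y, near1 q1 s y -> good (nu s y) /\ bounded_by (nu s y) C.
Hypothesis a_good : forall s y, near1 q1 s y -> good (a s y) /\ bounded_by (a s y) C.
Hypothesis m_good : forall s y z D, near1 q1 s y -> good z -> 0 <= D ->
  bounded_by z D -> good (m s y z).
Hypothesis m_lin : forall s y k z z', near1 q1 s y ->
  forall i, m s y (fun i => k * z i + z' i) i = k * m s y z i + m s y z' i.
Hypothesis m_small : forall q s y z D, q <= q1 -> near1 q s y -> good z -> 0 <= D ->
  bounded_by z D -> bounded_by (m s y z) (C * q * D).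
Hypothesis nu_expand : forall s s' y y' D, near1 q1 s y -> near1 q1 s' y' ->
  0 <= D -> dist_le y' y D ->
  forall i, `|nu s' y' i - nu s y i - (s' - s) * a s y i -
              m s y (fun i => y' i - y i) i| <= C * (`|s' - s| + D) ^+ 2.
Hypothesis a_lip0 : forall s s' y y' D, near1 q1 s y -> near1 q1 s' y' ->
  0 <= D -> dist_le y' y D -> dist_le (a s' y') (a s y) (C * (`|s' - s| + D)).
Hypothesis m_lip0 : forall s s' y y' z D X, near1 q1 s y -> near1 q1 s' y' ->
  0 <= D -> dist_le y' y D -> good z -> 0 <= X -> bounded_by z X ->
  dist_le (m s' y' z) (m s y z) (C * (`|s' - s| + D) * X).
Hypothesis nu_base : forall i, nu 0 y0 i = 0.

Let Psi s y : Y := fun i => y0 i + (O (nu s y) i + E y i).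
Let A s y := O (a s y).
Let M s y z : Y := fun i => O (m s y z) i + E z i.

Let good_add z z' : good z -> good z' -> good (fun i => z i + z' i).
Proof.
move=> gz gz'; have := good_lin 1 gz gz'; congr good.
by apply/funext => i; rewrite mul1r.
Qed.

Lemma bounded_linearB c X z z' D : bounded_linear c X -> 0 <= D -> good z -> good z' ->
  bounded_by z D -> bounded_by z' D ->
  forall i, X (fun i => z i - z' i) i = X z i - X z' i.
Proof.
move=> Xb D0 gz gz' zD z'D i; have [_ _ /(_ (-1) z gz zD i)] := Xb z' D D0 gz' z'D.
rewrite mulN1r addrC => <-; congr (X _ i); apply/funext => j.
by rewrite mulN1r addrC.
Qed.

Lemma bounded_linear_dist c X z z' D D' : bounded_linear c X -> 0 <= D -> 0 <= D' ->
  good z -> good z' -> bounded_by z D -> bounded_by z' D -> dist_le z z' D' ->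
  dist_le (X z) (X z') (c * D').
Proof.
move=> Xb D0 D'0 gz gz' zD z'D zz' i.
rewrite -(bounded_linearB Xb D0 gz gz' zD z'D).
by have [_ h _] := Xb _ D' D'0 (good_sub good_lin gz gz') zz'; exact: h.
Qed.

(** q makes the Lipschitz constant 3 q C^2 of O after nu at most 1/4, which together with the 1/4 of
    E gives the contraction factor 1/2; e makes the displacement 2 e C^2 of the base point at most q
    / 2. *)
Let q := Num.min q1 (12 * (C ^+ 2 + 1))^-1.
Let e := q / (4 * (C ^+ 2 + 1)).

Let K0 : 0 < C ^+ 2 + 1.
Proof. by rewrite ltr_wpDl// sqr_ge0. Qed.

Let q0 : 0 < q.
Proof. by rewrite /q lt_min q10 invr_gt0 mulr_gt0. Qed.

Let qq1 : q <= q1.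
Proof. by rewrite /q ge_min lexx. Qed.

Let qK : q * (12 * (C ^+ 2 + 1)) <= 1.
Proof. by rewrite -ler_pdivlMr ?mulr_gt0// div1r /q ge_min lexx orbT. Qed.

Let e0 : 0 < e.
Proof. by rewrite /e divr_gt0// mulr_gt0. Qed.

Let eq_ : e * (4 * (C ^+ 2 + 1)) = q.
Proof. by rewrite /e divfK// gt_eqF// mulr_gt0. Qed.

Let e_le_q : e <= q.
Proof. by rewrite -eq_ ler_peMr ?(ltW e0)//; have := sqr_ge0 C; lra. Qed.

Let e_le1 : e <= 1.
Proof.
apply: (le_trans e_le_q); apply: le_trans qK.
by rewrite ler_peMr ?(ltW q0)//; have := sqr_ge0 C; lra.
Qed.

Let near_base1 s y : near_base good y0 e q s y -> near1 q s y.
Proof. by move=> [se gy yq]; split => //; exact: le_trans e_le_q. Qed.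

Let near1W s y : near1 q s y -> near1 q1 s y.
Proof.
move=> [sq gy yq]; split => //; first exact: le_trans qq1.
by move=> i; exact: le_trans (yq i) qq1.
Qed.

Let near_bounded s y : near1 q1 s y -> bounded_by y (C + q1).
Proof.
move=> [_ _ yq] i; rewrite -[y i](subrK (y0 i)) addrC (le_trans (ler_normD _ _))//.
exact: lerD.
Qed.

Let D1 : 0 <= C + q1.
Proof. by rewrite addr_ge0// ltW. Qed.

Let bounded0 z D : bounded_by z D -> I -> 0 <= D.
Proof. by move=> zD i; exact: le_trans (zD i). Qed.

Lemma preconditioned_curve : exists e q, [/\ 0 < e, 0 < q, q <= q1, e <= q &
 exists y y' : R -> Y, exists K, [/\ 0 <= K,
  forall s, `|s| <= e -> [/\ near_base good y0 e q s (y s),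
    forall i, y0 i + (O (nu s (y s)) i + E (y s) i) = y s i, good (y' s) & bounded_by (y' s) K],
  forall s z, near_base good y0 e q s z ->
    (forall i, y0 i + (O (nu s z) i + E z i) = z i) -> z = y s &
  forall s s' i, `|s| <= e -> `|s'| <= e ->
    `|y s' i - y s i - (s' - s) * y' s i| <= K * (s' - s) ^+ 2 /\
    `|y' s' i - y' s i| <= K * `|s' - s|]].
Proof.
exists e, q; split => //.
have sq := sqr_ge0 C.
have Cq : C * (C * (3 * q)) <= 4^-1 by rewrite mulrA -expr2; move: qK q0; move: (q) => p; nra.
apply: (@fixed_curve R I good good_lim good_lin Psi A M y0 e q (C * C)
  (ltW e0) (ltW q0) (mulr_ge0 C0 C0) good_y0).
- move=> s y /near_base1/near1W ny; have [gn bn] := nu_good ny.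
  have [_ gy _] := ny; have [gO _ _] := O_blin C0 gn bn.
  have [gE _ _] := E_blin D1 gy (near_bounded ny).
  by apply: good_add => //; exact: good_add.
- move=> s y /near_base1/near1W ny; have [ga ba] := a_good ny.
  by have [] := O_blin C0 ga ba.
- move=> s y z D /near_base1 ny gz zD.
  (* An index is needed to see that D >= 0; if there is none, all functions on I coincide. *)
  have [i|noI] := pselect (exists i : I, True); last first.
    suff -> : M s y z = z by []. by apply/funext => i; exfalso; apply: noI; exists i.
  case: i => i _; have D0 := bounded0 zD i.
  have gm := m_good (near1W ny) gz D0 zD.
  have bm := m_small qq1 ny gz D0 zD.
  have [gO _ _] := O_blin (bounded0 bm i) gm bm.
  have [gE _ _] := E_blin D0 gz zD.
  exact: good_add.
- move=> s y /near_base1/near1W ny; have [ga ba] := a_good ny.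
  by have [] := O_blin C0 ga ba.
- move=> s y k z z' D /near_base1 ny gz gz' zD z'D i; have D0 := bounded0 zD i.
  have gm := m_good (near1W ny) gz D0 zD; have bm := m_small qq1 ny gz D0 zD.
  have gm' := m_good (near1W ny) gz' D0 z'D; have bm' := m_small qq1 ny gz' D0 z'D.
  have [_ _ hO] := O_blin (bounded0 bm i) gm bm.
  have [_ _ hE] := E_blin D0 gz zD.
  rewrite /M (_ : m s y _ = fun i => k * m s y z i + m s y z' i); last first.
    by apply/funext => j; exact: m_lin (near1W ny) j.
  by rewrite hO// hE//; ring.
- move=> s y z D /near_base1 ny gz D0 zD i.
  have gm := m_good (near1W ny) gz D0 zD; have bm := m_small qq1 ny gz D0 zD.
  have [_ hO _] := O_blin (bounded0 bm i) gm bm.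
  have [_ hE _] := E_blin D0 gz zD.
  rewrite (le_trans (ler_normD _ _))// (le_trans (lerD (hO i) (hE i)))//.
  have := ler_wpM2r D0 Cq; have := mulr_ge0 (mulr_ge0 C0 C0) (mulr_ge0 (ltW q0) D0); nra.
- move=> s y y' D /near_base1 ny /near_base1 ny' D0 yy' i.
  (* Two points of the ball are within 2 q of each other, so the quadratic error C D^2 is at most 2
     q C D. *)
  wlog Dq : D D0 yy' / D <= 2 * q.
    move=> H; have [Dq|Dq] := leP D (2 * q); first exact: H.
    have d2 : dist_le y y' (2 * q).
      move=> j; have [_ _ /(_ j) h] := ny; have [_ _ /(_ j) h'] := ny'.
      rewrite distrC in h'; rewrite -(subrK (y0 j) (y j)) -addrA (le_trans (ler_normD _ _))//; lra.
    have h : `|Psi s y i - Psi s y' i| <= 2 * q / 2.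
      by apply: H => //; rewrite mulr_ge0 ?(ltW q0).
    by apply: (le_trans h); rewrite ler_wpM2r// ltW.
  have [gn bn] := nu_good (near1W ny); have [gn' bn'] := nu_good (near1W ny').
  have [_ gy _] := ny; have [_ gy' _] := ny'.
  have hE := bounded_linear_dist E_blin D1 D0 gy gy' (near_bounded (near1W ny))
    (near_bounded (near1W ny')) yy'.
  have nn : dist_le (nu s y) (nu s y') (C * (3 * q) * D).
    move=> j; have := nu_expand (near1W ny') (near1W ny) D0 yy' j.
    rewrite subrr mul0r subr0 normr0 add0r => h1.
    have h2 := m_small qq1 ny' (good_sub good_lin gy gy') D0 yy' j.
    rewrite -[nu s y j - _](subrK (m s y' (fun i => y i - y' i) j)).
    rewrite (le_trans (ler_normD _ _))// (le_trans (lerD h1 h2))//.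
    have := ler_wpM2l (mulr_ge0 C0 D0) Dq; lra.
  have n0 : 0 <= C * (3 * q) * D by rewrite !mulr_ge0 ?(ltW q0).
  have hO := bounded_linear_dist O_blin C0 n0 gn gn' bn bn' nn.
  rewrite /Psi opprD addrACA subrr add0r opprD addrACA (le_trans (ler_normD _ _))//.
  rewrite (le_trans (lerD (hO i) (hE i)))//.
  have := ler_wpM2r D0 Cq; lra.
- move=> s s' y y' D /near_base1 ny /near_base1 ny' D0 yy' i.
  have [n1 n1'] := (near1W ny, near1W ny').
  have [gn bn] := nu_good n1; have [gn' bn'] := nu_good n1'.
  have [_ gy _] := ny; have [_ gy' _] := ny'.
  have [ga ba] := a_good n1.
  have gd := good_sub good_lin gy' gy.
  have gm := m_good n1 gd D0 yy'; have bm := m_small qq1 ny gd D0 yy'.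
  have bE := bounded_linearB E_blin D1 gy' gy (near_bounded n1') (near_bounded n1) i.
  have [u uE] : exists u, u = C * q * D by exists (C * q * D).
  have [v vE] : exists v, v = `|s' - s| * C by exists (`|s' - s| * C).
  have u0 : 0 <= u by rewrite uE !mulr_ge0 ?(ltW q0).
  have v0 : 0 <= v by rewrite vE mulr_ge0.
  rewrite -uE in bm; set X := C + v + u + (C + C).
  have bX z D' : D' <= X -> bounded_by z D' -> bounded_by z X.
    by move=> DX zD j; exact: le_trans (zD j) DX.
  have X0 : 0 <= X by rewrite /X !addr_ge0.
  have [uX vX CX] : [/\ u <= X, v <= X & C + C <= X].
    exact: sum_bounds.
  have CX1 : C <= X by apply: le_trans CX; rewrite lerDl.
  have nX : bounded_by (nu s y) X by exact: bX bn.
  have nX' : bounded_by (nu s' y') X by exact: bX bn'.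
  have dX : bounded_by (fun i => nu s' y' i - nu s y i) X.
    apply: (@bX _ (C + C)) => //.
    by move=> j; rewrite (le_trans (ler_normB _ _))// lerD.
  have aX : bounded_by (fun i => (s' - s) * a s y i) X.
    apply: (@bX _ v) => //.
    by move=> j; rewrite normrM vE ler_wpM2l.
  have mX : bounded_by (m s y (fun i => y' i - y i)) X by exact: bX bm.
  have gas := good_scale good_lin (s' - s) ga.
  have gdn := good_sub good_lin gn' gn.
  have Oa : O (fun i => (s' - s) * a s y i) i = (s' - s) * O (a s y) i.
    have g0 := good_zero good_lin gy.
    have b0 : bounded_by (fun _ : I => 0 : R) C by move=> j /=; rewrite normr0.
    have [_ _ h] := O_blin C0 ga ba.
    have := h 0 _ ga ba i; have := h (s' - s) _ g0 b0 i; have := h 0 _ g0 b0 i.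
    have -> : (fun i => 0 * a s y i + 0) = fun=> 0 by apply/funext => j; rewrite mul0r add0r.
    rewrite mul0r add0r => _.
    have -> : (fun i => (s' - s) * a s y i + 0) = fun i => (s' - s) * a s y i.
      by apply/funext => j; rewrite addr0.
    have bz : bounded_by (fun _ : I => 0 : R) 0 by move=> j /=; rewrite normr0.
    have [_ h0 _] := O_blin (lexx 0) g0 bz.
    have := h0 i; rewrite mulr0 normr_le0 => /eqP -> -> _.
    by rewrite addr0.
  set dn := fun i => nu s' y' i - nu s y i in gdn dX *.
  have h1 := bounded_linearB O_blin X0 gn' gn nX' nX i.
  have X2 : 0 <= X + X by rewrite addr_ge0.
  have h2 := bounded_linearB O_blin X0 gdn gas dX aX i.
  have g2 := good_sub good_lin gdn gas.
  have b2 : bounded_by (fun i => dn i - (s' - s) * a s y i) (X + X).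
    by move=> j; rewrite (le_trans (ler_normB _ _))// lerD.
  have mX2 : bounded_by (m s y (fun i => y' i - y i)) (X + X).
    by move=> j; rewrite (le_trans (mX j))// lerDl.
  have h3 := bounded_linearB O_blin X2 g2 gm b2 mX2 i.
  have g3 := good_sub good_lin g2 gm.
  have S0 : 0 <= C * (`|s' - s| + D) ^+ 2 by rewrite mulr_ge0 ?sqr_ge0.
  have [_ h4 _] := O_blin S0 g3 (nu_expand n1 n1' D0 yy').
  have := h4 i; rewrite h3 h2 h1 Oa -mulrA; congr (_ <= _); congr `|_|.
  rewrite /Psi /A /M bE; ring.
- move=> s s' y y' D /near_base1/near1W ny /near_base1/near1W ny' D0 yy'.
  have [ga ba] := a_good ny; have [ga' ba'] := a_good ny'; rewrite -mulrA.
  apply: (bounded_linear_dist O_blin C0 _ ga' ga ba' ba); first by rewrite mulr_ge0 ?addr_ge0.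
  exact: a_lip0.
- move=> s s' y y' z D X /near_base1 ny /near_base1 ny' D0 yy' gz X0 zX i.
  have [n1 n1'] := (near1W ny, near1W ny').
  have gm := m_good n1 gz X0 zX; have bm := m_small qq1 ny gz X0 zX.
  have gm' := m_good n1' gz X0 zX; have bm' := m_small qq1 ny' gz X0 zX.
  have S0 : 0 <= C * (`|s' - s| + D) * X by rewrite !mulr_ge0 ?addr_ge0.
  have h := bounded_linear_dist O_blin (bounded0 bm i) S0 gm' gm bm' bm
    (m_lip0 n1 n1' D0 yy' gz X0 zX) i.
  by rewrite /M opprD addrACA subrr addr0 (le_trans h)// !mulrA.
- move=> s se i; rewrite /Psi Ey0 addr0 addrAC subrr add0r.
  have n0 : near1 q1 0 y0.
    by split => //; [rewrite normr0 ltW|move=> j; rewrite subrr normr0 ltW].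
  have ns : near1 q1 s y0.
    split => //; first by rewrite (le_trans se)// (le_trans e_le_q).
    by move=> j; rewrite subrr normr0 ltW.
  have [gn bn] := nu_good ns; have [ga ba] := a_good n0.
  have bs : bounded_by (nu s y0) (C * (2 * e)).
    move=> j; have yy : dist_le y0 y0 0 by move=> l; rewrite subrr normr0.
    have := nu_expand n0 ns (lexx 0) yy j; rewrite !subr0 addr0 nu_base subr0 => h.
    have mz : m 0 y0 (fun i => y0 i - y0 i) j = 0.
      have z0 : bounded_by (fun i => y0 i - y0 i) 0 by move=> l; rewrite subrr normr0.
      have n0' : near1 q 0 y0.
        by split => //; [rewrite normr0 ltW|move=> l; rewrite subrr normr0 ltW].
      have := m_small qq1 n0' (good_sub good_lin good_y0 good_y0) (lexx 0) z0 j.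
      by rewrite mulr0 normr_le0 => /eqP.
    rewrite mz subr0 in h; rewrite -[nu s y0 j](subrK (s * a 0 y0 j)).
    rewrite (le_trans (ler_normD _ _))//.
    have h2 : `|s * a 0 y0 j| <= e * C by rewrite normrM ler_pM.
    have h3 : `|s| ^+ 2 <= e by rewrite expr2 (le_trans (ler_pM _ _ se (le_trans se e_le1)))// mulr1.
    have := ler_wpM2l C0 h3; rewrite (_ : C * (2 * e) = C * e + e * C); last by ring.
    by move=> h4; apply: lerD h2; exact: le_trans h h4.
  have b0 : 0 <= C * (2 * e) by apply: mulr_ge0 => //; apply: mulr_ge0 => //; exact: ltW e0.
  have [_ h _] := O_blin b0 gn bs; rewrite (le_trans (h i))//.
  by rewrite -eq_; move: (ltW e0); move: (e) => p p0; nra.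
Qed.

End preconditioned_curve.

(* An unknown [y] packs three components: [y None] is the offset of the square
   root of kappa, [y (Some None)] the correction to the homogeneous state, and
   [y (Some (Some x))] the value at [x] of the perturbation. A point of [V] is
   the curve parameter followed by the values of these components. *)
Section nemytskii_curve.
Context (R : realType) (T : Type).
Local Notation I := (option (option T)).
Local Notation V := (R^o * (R^o * (R^o * R^o)))%type.
Implicit Types (s k D q : R) (y z : I -> R) (f : T -> R) (x : T) (p h : V).

Definition vnorm (p : V) : R := `|p.1| + `|p.2.1| + `|p.2.2.1| + `|p.2.2.2|.

Variable G : (T -> R) -> Prop.
Hypothesis G_lim : forall (u : nat -> T -> R) f, (forall n, G (u n)) ->
  (forall x, u n x @[n --> \oo] --> f x) -> G f.
Hypothesis G_lin : forall k f f', G f -> G f' -> G (fun x => k * f x + f' x).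
Hypothesis G_mul : forall f f', G f -> G f' -> G (fun x => f x * f' x).
Hypothesis G_comp : forall (h : R -> R) f (b c : R), G f -> bounded_by f b ->
  (forall u v, `|u| <= b -> `|v| <= b -> `|h v - h u| <= c * `|v - u|) ->
  G (fun x => h (f x)).

Variables (f1 f2 : V -> R) (g1 g2 : V -> V -> R) (om : T -> R).
Variables (A E : (T -> R) -> T -> R) (ell : (T -> R) -> R) (c delta b C : R).

Definition box : set V := [set p | [/\ `|p.1| <= delta, `|p.2.1| <= delta,
  `|p.2.2.1| <= delta & `|p.2.2.2| <= b]].

Hypotheses (delta0 : 0 < delta) (delta1 : delta <= 1) (C1 : 1 <= C) (b0 : 0 <= b).
Hypotheses (f1C : C11_with vnorm C box f1 g1) (f2C : C11_with vnorm C box f2 g2).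
Hypothesis f1_base : forall w, `|w| <= b -> f1 (0, (0, (0, w))) = 0.
Hypothesis f2_base : f2 (0, (0, (0, 0))) = 0.
Hypothesis g1_base : forall w (ha hn hw : R), `|w| <= b ->
  g1 (0, (0, (0, w))) (0, (ha, (hn, hw))) = c * w * ha.
Hypothesis g2_base : forall (ha hn : R),
  g2 (0, (0, (0, 0))) (0, (ha, (hn, 0))) = 0.
Hypotheses (G_om : G om) (om_b : forall x, `|om x| + delta <= b) (om_C : bounded_by om C)
  (com_C : forall x, `|c * om x| <= C).
Hypotheses (A_blin : bounded_linear G C A) (E_blin : bounded_linear G 4^-1 E).
Hypothesis Eom : forall x, E om x = 0.
Hypothesis ell_le : forall f D, 0 <= D -> G f -> bounded_by f D -> `|c^-1 * ell f| <= C * D.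
Hypothesis ell_lin : forall k f f' D, 0 <= D -> G f -> G f' -> bounded_by f D ->
  bounded_by f' D -> ell (fun x => k * f x + f' x) = k * ell f + ell f'.

Let C0 : 0 <= C.
Proof. exact: le_trans C1. Qed.

Let goodY y := G (fun x => y (Some (Some x))).

Definition mkY (u v : R) f : I -> R := fun i =>
  match i with None => u | Some None => v | Some (Some x) => f x end.

(** The offset of alpha solves the solvability condition ell f + c * offset = 0 on the critical
    mode; [A] inverts the equation on the others. *)
Definition lift_resolvent z := mkY (- (c^-1 * ell (fun x => z (Some (Some x))))) (z (Some None))
  (A (fun x => z (Some (Some x)))).
Definition lift_small z := mkY 0 0 (E (fun x => z (Some (Some x)))).
Definition pt s y x : V := (s, (y None, (y (Some None), y (Some (Some x))))).
(** The last coordinate is 0 so that f2 returns a single number and not a function of x. *)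
Definition pt0 s y : V := (s, (y None, (y (Some None), 0))).
Definition ds : V := (1, (0, (0, 0))).
(** Subtracting c * om x * y None cancels the derivative of f1 with respect to alpha at the base
    point, where w = om. This is what makes [mY] vanish there; the term removed is accounted for by
    the first component of [lift_resolvent]. *)
Definition nuY s y := mkY 0 (f2 (pt0 s y)) (fun x => f1 (pt s y x) - c * om x * y None).
Definition aY s y := mkY 0 (g2 (pt0 s y) ds) (fun x => g1 (pt s y x) ds).
Definition mY s y z := mkY 0 (g2 (pt0 s y) (pt0 0 z))
  (fun x => g1 (pt s y x) (pt 0 z x) - c * om x * z None).
Definition baseY := mkY 0 0 om.

Lemma bounded_byY z D : bounded_by z D -> bounded_by (fun x => z (Some (Some x))) D.
Proof. by move=> zD x; exact: zD. Qed.

Let nb q s y := near1 goodY baseY q s y.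

Lemma pt_box s y x : near1 goodY baseY delta s y -> box (pt s y x).
Proof.
move=> [sd _ yd]; split => //=.
- by have := yd None; rewrite /= subr0.
- by have := yd (Some None); rewrite /= subr0.
- have := yd (Some (Some x)) => /= h; have := om_b x.
  by apply: le_trans; rewrite -[y _](subrK (om x)) (le_trans (ler_normD _ _))// addrC lerD.
Qed.

Let nb_box := pt_box.

Let nb_box0 s y : nb delta s y -> box (pt0 s y).
Proof.
move=> [sd _ yd]; split => //=; last by rewrite normr0.
- by have := yd None; rewrite /= subr0.
- by have := yd (Some None); rewrite /= subr0.
Qed.

Let base_box w : `|w| <= b -> box (0, (0, (0, w))).
Proof. by move=> wb; split; rewrite /= ?normr0// ltW. Qed.

Let om_le x : `|om x| <= b.
Proof. by have := om_b x; apply: le_trans; rewrite lerDl ltW. Qed.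

Let ptB s s' y y' x : pt s' y' x - pt s y x = (s' - s) *: ds + pt 0 (fun i => y' i - y i) x.
Proof. by rewrite /pt /ds; congr (_, (_, (_, _))); rewrite /= ?scaler0 ?add0r//; rewrite addr0; exact: (esym (mulr1 _)). Qed.

Let pt0B s s' y y' : pt0 s' y' - pt0 s y = (s' - s) *: ds + pt0 0 (fun i => y' i - y i).
Proof. by rewrite /pt0 /ds; congr (_, (_, (_, _))); rewrite /= ?subrr ?scaler0 ?add0r//; rewrite addr0; exact: (esym (mulr1 _)). Qed.

Let pt_norm s z D x : bounded_by z D -> vnorm (pt s z x) <= `|s| + 3 * D.
Proof.
move=> zD; have h1 := zD None; have h2 := zD (Some None); have h3 := zD (Some (Some x)).
by rewrite /vnorm /=; lra.
Qed.

Let pt0_norm s z D : 0 <= D -> bounded_by z D -> vnorm (pt0 s z) <= `|s| + 3 * D.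
Proof.
move=> D0 zD; have h1 := zD None; have h2 := zD (Some None).
by rewrite /vnorm /= normr0; lra.
Qed.

Let ptB_norm s s' y y' D x : dist_le y' y D ->
  vnorm (pt s' y' x - pt s y x) <= `|s' - s| + 3 * D.
Proof. by move=> yD; exact: (@pt_norm (s' - s) (fun i => y' i - y i)). Qed.

Let pt0B_norm s s' y y' D : 0 <= D -> dist_le y' y D ->
  vnorm (pt0 s' y' - pt0 s y) <= `|s' - s| + 3 * D.
Proof.
move=> D0 yD; have := @pt0_norm (s' - s) (fun i => y' i - y i) D D0 yD.
by rewrite /vnorm /= subr0.
Qed.

Let ds_norm : vnorm ds = 1.
Proof. by rewrite /vnorm /= !normr0 normr1 !addr0. Qed.

Lemma vnorm_ge0 p : 0 <= vnorm p.
Proof. by rewrite /vnorm !addr_ge0. Qed.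

Let vnorm_nonneg := vnorm_ge0.

Let lip_w s y (u v : R) : nb delta s y -> `|u| <= b -> `|v| <= b ->
  [/\ box (s, (y None, (y (Some None), u))), box (s, (y None, (y (Some None), v))) &
   vnorm ((s, (y None, (y (Some None), v))) - (s, (y None, (y (Some None), u))) : V) = `|v - u|].
Proof.
move=> n ub vb; have [h1 h2 h3 _] := nb_box0 n; split; [by []|by []|].
by rewrite /vnorm /= !subrr !normr0 !add0r.
Qed.

Let y_b s y : nb delta s y -> bounded_by (fun x => y (Some (Some x))) b.
Proof. by move=> n x; have [] := nb_box x n. Qed.

Let G_f1 s y : nb delta s y -> G (fun x => f1 (pt s y x)).
Proof.
move=> n; have [_ gy _] := n.
apply: (@G_comp (fun w => f1 (s, (y None, (y (Some None), w)))) _ b C gy (y_b n)) => u v ub vb.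
have [bu bv <-] := lip_w n ub vb; have [_ _ _ f] := f1C.
by have [] := f _ _ bu bv.
Qed.

Let G_g1 s y h : nb delta s y -> G (fun x => g1 (pt s y x) h).
Proof.
move=> n; have [_ gy _] := n.
apply: (@G_comp (fun w => g1 (s, (y None, (y (Some None), w))) h) _ b (C * vnorm h) gy (y_b n)) => u v ub vb.
have [bu bv e] := lip_w n ub vb; have [_ _ _ f] := f1C.
have [_ _ /(_ h)] := f _ _ bu bv; rewrite e => H; apply: (le_trans H).
by rewrite -!mulrA ler_wpM2l// mulrC.
Qed.

Let G_scale k f : G f -> G (fun x => k * f x).
Proof. exact: (good_scale (good := G) G_lin). Qed.

Let G_com k : G (fun x => c * om x * k).
Proof.
have := G_scale (c * k) G_om; congr G; apply/funext => x; ring.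
Qed.

(** The direction varies with x through z; linearity splits off z times the derivative in the last
    coordinate, a product of two members of G. *)
Let G_pt s y z : nb delta s y -> goodY z -> G (fun x => g1 (pt s y x) (pt 0 z x)).
Proof.
move=> n gz; have h1 := G_g1 (0, (z None, (z (Some None), 0))) n.
have h2 := G_g1 (0, (0, (0, 1))) n.
have := G_lin 1 (G_mul gz h2) h1; congr G; apply/funext => x.
have [_ gl _ _] := f1C; rewrite mul1r -gl; last exact: nb_box.
congr (g1 _ _); rewrite /pt; congr (_, (_, (_, _))); rewrite /= ?scaler0 ?add0r//.
by rewrite addr0; exact: (mulr1 _).
Qed.

(** 12 is the constant common to the whole section. It comes from the bound on [mY]: a displacement
    of the point along 4 coordinates times a direction with 3 nonzero coordinates. *)
Lemma lift_resolvent_blin : bounded_linear goodY (12 * C) lift_resolvent.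
Proof.
move=> z D D0 gz zD; have [gA bA lA] := A_blin D0 gz (bounded_byY zD).
have C12 : C * D <= 12 * C * D by have := mulr_ge0 C0 D0; lra.
have CD : D <= 12 * C * D by apply: le_trans C12; rewrite ler_peMl.
split => //.
- move=> [[x|]|] /=; [exact: le_trans (bA x) C12|exact: le_trans (zD _) CD|].
  by rewrite normrN (le_trans _ C12)// ell_le// => x; exact: zD.
- move=> k z' gz' z'D [[x|]|] /=.
  + by rewrite lA//; exact: bounded_byY.
  + by [].
  + rewrite (ell_lin k D0 gz gz' (bounded_byY zD) (bounded_byY z'D)); ring.
Qed.

Lemma lift_small_blin : bounded_linear goodY 4^-1 lift_small.
Proof.
move=> z D D0 gz zD; have [gA bA lA] := E_blin D0 gz (bounded_byY zD).
have D4 : 0 <= 4^-1 * D by rewrite mulr_ge0.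
split => //.
- by move=> [[x|]|] //=; rewrite normr0.
- move=> k z' gz' z'D [[x|]|] /=; rewrite ?mulr0 ?addr0//.
  by rewrite lA//; exact: bounded_byY.
Qed.

Lemma nuY_good s y : near1 goodY baseY delta s y ->
  goodY (nuY s y) /\ bounded_by (nuY s y) (12 * C).
Proof.
have C12 : 0 <= 12 * C by rewrite mulr_ge0.
move=> n; have [_ _ fb1 _] := f1C; have [_ _ fb2 _] := f2C; split.
  have := G_lin (-1) (G_com (y None)) (G_f1 n); congr G; apply/funext => x /=.
  by rewrite mulN1r addrC.
move=> [[x|]|] /=; rewrite ?normr0//.
  have [h1 _] := fb1 _ (nb_box x n); have [_ h2 _ _] := nb_box x n; rewrite /= in h2.
  rewrite (le_trans (ler_normB _ _))// normrM.
  have h3 := ler_pM (normr_ge0 _) (normr_ge0 _) (com_C x) (le_trans h2 delta1).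
  rewrite mulr1 in h3; rewrite (le_trans (lerD h1 h3))//; lra.
by have [h1 _] := fb2 _ (nb_box0 n); rewrite (le_trans h1)//; lra.
Qed.

(** The bounds on f1 and f2 hold with one constant on the box, hence uniformly in x, and become sup
    bounds for the superposition operators. [g1_base] and [g2_base] give the smallness of [mY] near
    the base point. *)
Lemma nemytskii_curve : exists e q, [/\ 0 < e, 0 < q, q <= delta, e <= q &
 exists y y' : R -> I -> R, exists K, [/\ 0 <= K,
  forall s, `|s| <= e -> [/\ near_base goodY baseY e q s (y s),
    forall i, baseY i + (lift_resolvent (nuY s (y s)) i + lift_small (y s) i) = y s i,
    goodY (y' s) & bounded_by (y' s) K],
  forall s z, near_base goodY baseY e q s z ->
    (forall i, baseY i + (lift_resolvent (nuY s z) i + lift_small z i) = z i) -> z = y s &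
  forall s s' i, `|s| <= e -> `|s'| <= e ->
    `|y s' i - y s i - (s' - s) * y' s i| <= K * (s' - s) ^+ 2 /\
    `|y' s' i - y' s i| <= K * `|s' - s|]].
Proof.
have [_ gl1 fb1 fe1] := f1C; have [_ gl2 fb2 fe2] := f2C.
have C12 : 0 <= 12 * C by rewrite mulr_ge0.
have nb_d q s y : q <= delta -> nb q s y -> nb delta s y.
  move=> qd [sq gy yq]; split => //; first exact: le_trans qd.
  by move=> i; exact: le_trans (yq i) qd.
apply: (@preconditioned_curve R I goodY _ _ lift_resolvent lift_small baseY nuY aY mY delta (12 * C)
  delta0 C12 G_om lift_resolvent_blin lift_small_blin).
- by move=> u l ug ul; apply: (@G_lim (fun n x => u n (Some (Some x)))) => // x; exact: ul.
- by move=> k z z' gz gz'; exact: G_lin.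
- by move=> [[x|]|] /=; rewrite ?normr0// (le_trans (om_C x))//; lra.
- by move=> [[x|]|] /=.
- exact: nuY_good.
- move=> s y n; split; first exact: G_g1.
  move=> [[x|]|] /=; rewrite ?normr0//.
    by have [_ /(_ ds)] := fb1 _ (nb_box x n); rewrite ds_norm mulr1 => h1; rewrite (le_trans h1)//; lra.
  by have [_ /(_ ds)] := fb2 _ (nb_box0 n); rewrite ds_norm mulr1 => h1; rewrite (le_trans h1)//; lra.
- move=> s y z D n gz D0 zD.
  have := G_lin (-1) (G_com (z None)) (G_pt n gz); congr G; apply/funext => x /=.
  by rewrite mulN1r addrC.
- move=> s y k z z' n [[x|]|] /=; last by rewrite mulr0 addr0.
    have -> : pt 0 (fun i => k * z i + z' i) x = k *: pt 0 z x + pt 0 z' x.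
      by rewrite /pt; congr (_, (_, (_, _))); rewrite /= ?scaler0 ?add0r.
    by rewrite gl1; [ring|exact: nb_box].
  rewrite -gl2; last exact: nb_box0.
  by congr (g2 _ _); rewrite /pt0; congr (_, (_, (_, _))); rewrite /= ?scaler0 ?add0r.
- move=> q s y z D qd n gz D0 zD; have [sq _ yq] := n; have nd := nb_d _ _ _ qd n.
  have q0 : 0 <= q := le_trans (normr_ge0 s) sq.
  have qD : 0 <= 12 * C * q * D by rewrite !mulr_ge0.
  have key p p' h : vnorm (p - p') <= 4 * q -> vnorm h <= 3 * D ->
      C * vnorm (p - p') * vnorm h <= 12 * C * q * D.
    move=> h1 h2; have -> : 12 * C * q * D = C * (4 * q) * (3 * D) by ring.
    by rewrite ler_pM ?mulr_ge0// ler_wpM2l.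
  move=> [[x|]|] /=; rewrite ?normr0//.
    have -> : c * om x * z None = g1 (0, (0, (0, om x))) (pt 0 z x).
      by rewrite g1_base.
    have [_ _ h] := fe1 _ _ (base_box (om_le x)) (nb_box x nd).
    apply: (le_trans (h _)); apply: key.
      have -> : pt s y x - (0, (0, (0, om x))) = pt s y x - pt 0 baseY x by [].
      by rewrite (le_trans (ptB_norm _ _ _ yq))// subr0; lra.
    by have := pt_norm 0 x zD; rewrite normr0 add0r.
  rewrite -[X in `|X|]subr0 -[X in _ - X](g2_base (z None) (z (Some None))).
  have z0 : `|0 : R| <= b by rewrite normr0.
  have [_ _ h] := fe2 _ _ (base_box z0) (nb_box0 nd).
  apply: (le_trans (h _)); apply: key.
    have -> : pt0 s y - (0, (0, (0, 0))) = pt0 s y - pt0 0 baseY by [].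
    by rewrite (le_trans (pt0B_norm _ _ q0 yq))// subr0; lra.
  by have := pt0_norm 0 D0 zD; rewrite normr0 add0r.
- move=> s s' y y' D n n' D0 yD.
  have key p p' : vnorm (p' - p) <= `|s' - s| + 3 * D ->
      C * vnorm (p' - p) ^+ 2 <= 12 * C * (`|s' - s| + D) ^+ 2.
    move=> h; have s0 := normr_ge0 (s' - s).
    have h1 : vnorm (p' - p) ^+ 2 <= (3 * (`|s' - s| + D)) ^+ 2.
      by rewrite lerXn2r ?nnegrE//; [rewrite mulr_ge0// addr_ge0|rewrite (le_trans h)//; lra].
    apply: (le_trans (ler_wpM2l C0 h1)); rewrite exprMn.
    by have := mulr_ge0 C0 (sqr_ge0 (`|s' - s| + D)); lra.
  move=> [[x|]|] /=; last first.
  + by rewrite subrr mulr0 !subr0 normr0 mulr_ge0 ?sqr_ge0.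
  + have [_ h _] := fe2 _ _ (nb_box0 n) (nb_box0 n'); rewrite pt0B gl2 in h; last exact: nb_box0.
    rewrite opprD addrA in h; apply: (le_trans h); rewrite -pt0B; apply: key.
    exact: pt0B_norm.
  + have [_ h _] := fe1 _ _ (nb_box x n) (nb_box x n').
    have hk := key _ _ (ptB_norm s s' x yD).
    apply: le_trans hk; apply: le_trans h; rewrite ptB gl1; last exact: nb_box.
    rewrite le_eqVlt; apply/orP; left; apply/eqP; congr `|_|; ring.
- move=> s s' y y' D n n' D0 yD.
  have key p p' : vnorm (p' - p) <= `|s' - s| + 3 * D ->
      C * vnorm (p' - p) * vnorm ds <= 12 * C * (`|s' - s| + D).
    move=> h; rewrite ds_norm mulr1 (le_trans (ler_wpM2l C0 h))//.
    have := mulr_ge0 C0 (normr_ge0 (s' - s)); have := mulr_ge0 C0 D0; lra.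
  move=> [[x|]|] /=; last first.
  + by rewrite subrr normr0 mulr_ge0 ?addr_ge0.
  + have [_ _ h] := fe2 _ _ (nb_box0 n) (nb_box0 n'); apply: (le_trans (h _)).
    by apply: key; exact: pt0B_norm.
  + have [_ _ h] := fe1 _ _ (nb_box x n) (nb_box x n'); apply: (le_trans (h _)).
    by apply: key; exact: ptB_norm.
- move=> s s' y y' z D X n n' D0 yD gz X0 zX.
  have key p p' h : vnorm (p' - p) <= `|s' - s| + 3 * D -> vnorm h <= 3 * X ->
      C * vnorm (p' - p) * vnorm h <= 12 * C * (`|s' - s| + D) * X.
    move=> h1 h2; have s0 := normr_ge0 (s' - s).
    have h3 : C * vnorm (p' - p) <= C * (3 * (`|s' - s| + D)).
      by rewrite ler_wpM2l// (le_trans h1)//; lra.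
    have h4 : 0 <= C * vnorm (p' - p) by rewrite mulr_ge0.
    apply: (le_trans (ler_pM h4 (vnorm_ge0 h) h3 h2)).
    by have := mulr_ge0 (mulr_ge0 C0 (addr_ge0 s0 D0)) X0; lra.
  move=> [[x|]|] /=; last first.
  + by rewrite subrr normr0 !mulr_ge0 ?addr_ge0.
  + have [_ _ h] := fe2 _ _ (nb_box0 n) (nb_box0 n'); apply: (le_trans (h _)).
    apply: key; first exact: pt0B_norm.
    by have := pt0_norm 0 X0 zX; rewrite normr0 add0r.
  + have [_ _ h] := fe1 _ _ (nb_box x n) (nb_box x n').
    rewrite opprB addrA subrK; apply: (le_trans (h _)).
    apply: key; first exact: ptB_norm.
    by have := pt_norm 0 x zX; rewrite normr0 add0r.
- by move=> [[x|]|] /=; [rewrite mulr0 subr0; exact: f1_base (om_le x)|exact: f2_base|].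
Qed.

End nemytskii_curve.

(** * The response function *)

Section integral01_extra.
Context (R : realType).

Lemma int01_FTC (H h : R -> R) : lip01 h ->
  (forall t : R, 0 <= t <= 1 -> is_derive t 1 H (h t)) -> int01 h = H 1 - H 0.
Proof.
move=> [C hC] Hh.
have Hc t : 0 <= t <= 1 -> {for t, continuous H}.
  by move=> t01; exact: is_derive_continuous (Hh t t01).
have hc : {within `[0 : R, 1], continuous h}.
  apply/subspace_continuousP => t; rewrite /= in_itv/= => t01.
  apply/cvgrPdist_lt => e e0; rewrite near_withinE; near=> t' => /=.
  rewrite in_itv/= => t'01; rewrite (le_lt_trans (hC _ _ t'01 t01))//.
  have C1 : 0 < `|C| + 1 by rewrite ltr_wpDl.
  rewrite (le_lt_trans (ler_wpM2r (normr_ge0 _) (le_trans (ler_norm C) (_ : _ <= `|C| + 1))))//.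
    by rewrite lerDl.
  rewrite mulrC -ltr_pdivlMr//; near: t'.
  by apply: cvgr_dist_lt => //; rewrite divr_gt0.
have := @continuous_FTC2 R h H 0 1 ltr01 hc.
rewrite /int01 /Rintegral => -> //.
- split => [t|  |].
  + by rewrite in_itv/= => /andP[t0 t1]; have [] := Hh t; rewrite ?ltW.
  + by apply: cvg_at_right_filter; apply: Hc; rewrite lexx ler01.
  + by apply: cvg_at_left_filter; apply: Hc; rewrite lexx ler01.
- move=> t; rewrite in_itv/= => /andP[t0 t1]; rewrite derive1E.
  by apply: derive_val; apply: Hh; rewrite !ltW.
Unshelve. all: by end_near. Qed.

Lemma C11_snd (V : lmodType R) (N : V -> R) (U : set V) f g :
  (forall h, 0 <= N h) -> C11 N U f g ->
  C11 (fun th : R^o * V => `|th.1| + N th.2) [set tp : R^o * V | 0 <= tp.1 <= 1 /\ U tp.2]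
    (fun tp => f tp.2) (fun tp h => g tp.2 h.2).
Proof.
move=> N0 [C [C0 gl fb fl]].
have le_N (h : R^o * V) : N h.2 <= `|h.1| + N h.2 by rewrite lerDr.
have ge0 (h : R^o * V) : 0 <= `|h.1| + N h.2 by rewrite addr_ge0.
exists C; split => //.
- by move=> p k h h' [_ Up]; exact: gl.
- move=> p [_ Up]; have [h1 h2] := fb _ Up; split => // h.
  by rewrite (le_trans (h2 _))// ler_wpM2l.
- move=> p p' [_ Up] [_ Up']; have [h1 h2 h3] := fl _ _ Up Up'; split => [||h].
  + by apply: (le_trans h1); rewrite ler_wpM2l//; exact: (le_N (p' - p)).
  + apply: (le_trans h2); rewrite ler_wpM2l// lerXn2r ?nnegrE//; exact: (le_N (p' - p)).
  + apply: (le_trans (h3 _)); rewrite ler_pM ?mulr_ge0// ler_wpM2l//.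
    exact: (le_N (p' - p)).
Qed.

Lemma C11_fst (V : lmodType R) (N : V -> R) (U : set V) : (forall h, 0 <= N h) ->
  C11 (fun th : R^o * V => `|th.1| + N th.2) [set tp : R^o * V | 0 <= tp.1 <= 1 /\ U tp.2]
    (fun tp => tp.1) (fun _ h => h.1).
Proof.
move=> N0; apply: (@C11_linear _ _ _ _ _ _ 1).
- by move=> h; rewrite addr_ge0.
- by move=> k h h'.
- by move=> h; rewrite mul1r lerDl.
- by move=> p [/andP[p0 p1] _]; rewrite ger0_norm.
Qed.

End integral01_extra.

Section response.
Context (R : realType).
Variables (Phi : R -> R) (B W0 Lam : R).
Implicit Types (al m s t u v x : R).

(* the stationary average for the input [Phi (m + B)], with [al] the square root
   of kappa and [Lam = L ^+ d]; see [stat_avgE] *)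
Definition resp al m : R := tmean (al * Phi (m + B)) / (al * Lam).

(** Derivative of [resp al]: the alpha produced by the chain rule cancels the one in the
    denominator. *)
Definition dresp al m : R := dtmean (al * Phi (m + B)) * (Phi^`())%classic (m + B) / Lam.

Hypothesis Phi_cont : continuous Phi.
Hypothesis Phi_incr : forall s t : R, 0 <= s -> s < t -> Phi s < Phi t.
Hypothesis Phi_neg : forall s : R, s <= 0 -> Phi s = 0.
Hypotheses (B0 : 0 < B) (W00 : W0 < 0) (Lam0 : 0 < Lam).

Lemma Phi_ge0 s : 0 <= Phi s.
Proof.
have [s0|s0] := leP s 0; first by rewrite Phi_neg.
by rewrite -(Phi_neg (lexx 0)) ltW// Phi_incr.
Qed.

Lemma Phi_gt0 s : 0 < s -> 0 < Phi s.
Proof. by move=> s0; rewrite -(Phi_neg (lexx 0)) Phi_incr. Qed.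

Lemma Phi_le s t : s <= t -> Phi s <= Phi t.
Proof.
move=> st; have [s0|s0] := leP s 0; first by rewrite Phi_neg// Phi_ge0.
by move: st; rewrite le_eqVlt => /predU1P[->//|st]; rewrite ltW// Phi_incr// ltW.
Qed.

Lemma tmean_le u v : 0 <= u -> u <= v -> tmean u <= tmean v.
Proof.
move=> u0; rewrite le_eqVlt => /predU1P[->//|uv].
have [||z zuv e] := @MVT R (@tmean R) (@dtmean R) u v uv.
- by move=> z _; exact: is_derive_tmean.
- by apply: continuous_subspaceT; exact: tmean_continuous.
rewrite -subr_ge0 e; apply: mulr_ge0; last by rewrite subr_ge0 ltW.
apply: dtmean_ge0.
by move: zuv; rewrite in_itv/= => /andP[uz _]; rewrite (le_trans u0)// ltW.
Qed.

Lemma tmean_gt0 u : 0 <= u -> 0 < tmean u.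
Proof. by move=> u0; exact: le_lt_trans (tmean_gt_id u). Qed.

Lemma resp_gt0 al m : 0 < al -> 0 < resp al m.
Proof.
by move=> al0; rewrite divr_gt0 ?mulr_gt0// tmean_gt0// mulr_ge0 ?Phi_ge0// ltW.
Qed.

Lemma resp_le al m m' : 0 < al -> m <= m' -> resp al m <= resp al m'.
Proof.
move=> al0 mm; apply: ler_wpM2r; first by rewrite invr_ge0 mulr_ge0 ?(ltW al0) ?(ltW Lam0).
apply: tmean_le; first by rewrite mulr_ge0 ?Phi_ge0// (ltW al0).
by rewrite ler_wpM2l ?(ltW al0)// Phi_le// lerD2r.
Qed.

Lemma resp_continuous al : continuous (resp al).
Proof.
move=> m; rewrite /resp; apply: cvgM; last exact: cvg_cst.
apply: (continuous_comp (f := fun m : R => al * Phi (m + B))); last exact: tmean_continuous.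
apply: cvgM; first exact: cvg_cst.
apply: (continuous_comp (f := fun y : R => y + B)); last exact: Phi_cont.
by apply: cvgD; [exact: cvg_id|exact: cvg_cst].
Qed.

(** As W0 < 0, the map W0 * resp al is nonincreasing while the identity increases. *)
Lemma resp_fixed_unique al m m' : 0 < al -> m = W0 * resp al m ->
  m' = W0 * resp al m' -> m = m'.
Proof.
move=> al0; wlog mm : m m' / m <= m'.
  move=> H e e'; have [mm|/ltW mm] := leP m m'; first exact: H.
  by apply/esym; exact: H.
move=> e e'; apply/eqP; rewrite eq_le mm/= e e' ler_wnM2l ?(ltW W00)//.
exact: resp_le.
Qed.

Lemma resp_fixed_exists al : 0 < al -> exists m, m = W0 * resp al m.
Proof.
move=> al0; pose f m := W0 * resp al m - m.
(* Below - B the input is nonpositive, where Phi is 0 and [resp] is constant, so m0 lies below its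
   image. *)
pose m0 := Num.min (- B) (W0 * resp al (- B)).
have m00 : m0 <= 0.
  by rewrite /m0 ge_min oppr_le0 (ltW B0).
have fc : {within `[m0, 0], continuous f}.
  apply: continuous_subspaceT => m; apply: cvgB; last exact: cvg_id.
  by apply: cvgM; [exact: cvg_cst|exact: resp_continuous].
have fm0 : 0 <= f m0.
  rewrite subr_ge0; have -> : resp al m0 = resp al (- B).
    rewrite /resp addNr [Phi 0]Phi_neg// Phi_neg//.
    by rewrite -lerBrDr sub0r /m0 ge_min lexx.
  by rewrite /m0 ge_min lexx orbT.
have f0 : f 0 <= 0.
  by rewrite /f subr0 mulr_le0_ge0 ?(ltW W00)// ltW// resp_gt0.
have [|m _ fm] := IVT m00 fc (v := 0).
  by rewrite ge_min le_max f0 fm0 orbT.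
by exists m; apply/esym/eqP; rewrite -subr_eq0; apply/eqP.
Qed.

Hypothesis Phi_C3 : class_C 3 Phi [set s | s != 0].

Lemma Phi_is_derive (k : nat) (x : R) : (k < 3)%N -> x != 0 ->
  is_derive x 1 (Phi^`(k))%classic ((Phi^`(k.+1))%classic x).
Proof.
move=> k3 x0; have [/(_ k k3) h _] := Phi_C3 x0.
by apply: DeriveDef; [exact: h|rewrite derive1nS derive1E].
Qed.

Lemma Phi_derive_continuous (k : nat) (x : R) : (0 < k < 4)%N -> x != 0 ->
  {for x, continuous (Phi^`(k))%classic}.
Proof.
move=> /andP[k0 k4] x0; have [h c] := Phi_C3 x0.
have [->//|k3] := eqVneq k 3%N.
have kk : (k < 3)%N by rewrite ltn_neqAle k3.
exact: is_derive_continuous (Phi_is_derive kk x0).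
Qed.

Lemma C11_Phi (k : nat) (u v : R) : (k < 2)%N -> 0 < u -> u <= v ->
  C11_scalar [set x | u <= x <= v] (Phi^`(k))%classic (Phi^`(k.+1))%classic.
Proof.
move=> k2 u0 uv; have n0 x : u <= x <= v -> x != 0.
  by move=> /andP[ux _]; rewrite gt_eqF// (lt_le_trans u0).
apply: (@C11_scalar_itv R (Phi^`(k))%classic (Phi^`(k.+1))%classic (Phi^`(k.+2))%classic u v uv).
- by move=> x /n0 x0; exact: Phi_is_derive (ltn_trans k2 _) x0.
- by move=> x /n0 x0; exact: (@Phi_is_derive k.+1 x k2 x0).
- by move=> x /n0 x0; exact: (@Phi_derive_continuous k.+2).
Qed.

Definition ddtmean (mu : R) : R := tmean mu + (mu - 2 * tmean mu) * dtmean mu.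

Lemma dtmean_continuous : continuous (@dtmean R).
Proof. by move=> x; exact: is_derive_continuous (is_derive_dtmean x). Qed.

Lemma is_derive_ddtmean (mu : R) : is_derive mu 1 ddtmean
  (dtmean mu + ((1 + - 2 * dtmean mu) * dtmean mu + (mu - 2 * tmean mu) * ddtmean mu)).
Proof.
have h1 := is_derive_addR (is_derive_id mu (1 : R)) (is_derive_scaleR (- 2) (is_derive_tmean mu)).
have := is_derive_addR (is_derive_tmean mu) (is_derive_mulR h1 (is_derive_dtmean mu)).
have -> : (fun y => tmean y + (y + - 2 * tmean y) * dtmean y) = ddtmean.
  by apply/funext => y; rewrite /ddtmean mulNr.
by move=> h; apply: (is_derive_eq h); rewrite /ddtmean /dtmean; ring.
Qed.

Lemma C11_tmean (u v : R) : u <= v ->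
  C11_scalar [set x | u <= x <= v] (@tmean R) (@dtmean R).
Proof.
move=> uv; apply: (@C11_scalar_itv R (@tmean R) (@dtmean R) ddtmean u v uv).
- by move=> x _; exact: is_derive_tmean.
- by move=> x _; exact: is_derive_dtmean.
- by move=> x _; exact: is_derive_continuous (is_derive_ddtmean x).
Qed.

Lemma C11_dtmean (u v : R) : u <= v ->
  C11_scalar [set x | u <= x <= v] (@dtmean R) ddtmean.
Proof.
move=> uv; apply: (@C11_scalar_itv R (@dtmean R) ddtmean (fun mu => dtmean mu +
  ((1 + - 2 * dtmean mu) * dtmean mu + (mu - 2 * tmean mu) * ddtmean mu)) u v uv).
- by move=> x _; exact: is_derive_dtmean.
- by move=> x _; exact: is_derive_ddtmean.
- move=> x _; have tc := @tmean_continuous R x; have dc := @dtmean_continuous x.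
  have ddc := is_derive_continuous (is_derive_ddtmean x).
  apply: cvgD => //; apply: cvgD; apply: cvgM => //.
    by apply: cvgD; [exact: cvg_cst|apply: cvgM => //; exact: cvg_cst].
  by apply: cvgB; [exact: cvg_id|apply: cvgM => //; exact: cvg_cst].
Qed.

Lemma C11_inv (u v : R) : 0 < u -> u <= v ->
  C11_scalar [set x : R | u <= x <= v] (fun x => x^-1) (fun x => - (x ^+ 2)^-1).
Proof.
move=> u0 uv; have n0 x : u <= x <= v -> x != 0.
  by move=> /andP[ux _]; rewrite gt_eqF// (lt_le_trans u0).
apply: (@C11_scalar_itv R (fun x => x^-1) (fun x => - (x ^+ 2)^-1) (fun x => 2 * (x ^+ 3)^-1) u v uv).
- move=> x /n0 x0; have := is_derive_invR x0 (is_derive_id x (1 : R)); by rewrite mulN1r.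
- move=> x /n0 x0; have h := is_derive_invR x0 (is_derive_id x (1 : R)).
  have := is_derive_scaleR (-1) (is_derive_mulR h h).
  rewrite (_ : -1 * _ = 2 * (x ^+ 3)^-1); last by field.
  by congr is_derive; apply/funext => y; rewrite mulN1r -invfM expr2.
- by move=> x /n0 x0; apply: cvgM; [exact: cvg_cst|]; apply: cvgV; [rewrite expf_neq0|exact: exprn_continuous].
Qed.

End response.

Lemma is_derive_resp_line (R : realType) (Phi : R -> R) (B Lam al M k t : R) :
  class_C 3 Phi [set s | s != 0] -> 0 < Lam -> 0 < al -> 0 < M + t * k + B ->
  is_derive t 1 (fun t => resp Phi B Lam al (M + t * k)) (k * dresp Phi B Lam al (M + t * k)).
Proof.
move=> Phi_C3 Lam0 al0 x0.
have h2 := is_derive_addR (is_derive_cst (M + B) t (1 : R)) (is_derive_scaleR k (is_derive_id t (1 : R))).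
have hi : is_derive t 1 (fun y : R => M + y * k + B) k.
  rewrite (_ : (fun y : R => M + y * k + B) = fun y : R => M + B + k * y).
    by apply: (is_derive_eq h2); rewrite add0r mulr1.
  by apply/funext => y; ring.
have x1 : M + t * k + B != 0 by rewrite gt_eqF.
have hP : is_derive (M + t * k + B) 1 Phi ((Phi^`())%classic (M + t * k + B)).
  exact: (@Phi_is_derive R Phi Phi_C3 0 _ isT x1).
have h3 := is_derive_compR hi hP.
have h4 := is_derive_compR (is_derive_scaleR al h3) (is_derive_tmean _).
have h5 := is_derive_scaleR (al * Lam)^-1 h4.
rewrite (_ : (fun y => resp Phi B Lam al (M + y * k)) =
  fun y => (al * Lam)^-1 * tmean (al * Phi (M + y * k + B))); last first.
  by apply/funext => y; rewrite /resp mulrC.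
apply: (is_derive_eq h5); rewrite /dresp -/(dtmean _).
by field; rewrite !gt_eqF.
Qed.

Lemma min3P (R : realType) (x y z : R) : 0 < x -> 0 < y -> 0 < z ->
  [/\ 0 < Num.min x (Num.min y z), Num.min x (Num.min y z) <= x,
    Num.min x (Num.min y z) <= y & Num.min x (Num.min y z) <= z].
Proof. by move=> *; rewrite !lt_min !ge_min !lexx !orbT; split => //; apply/and3P. Qed.

(** * The response near the homogeneous state *)

Section local_response.
Context (R : realType).
Variables (Phi : R -> R) (B W0 Lam als Mst b : R).
Implicit Types (s t u v x : R).
Local Notation V := (R^o * (R^o * (R^o * R^o)))%type.
Implicit Types (p h : V).
Local Notation resp := (resp Phi B Lam).
Local Notation dresp := (dresp Phi B Lam).
Local Notation vnorm := (@vnorm R).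

Hypothesis Phi_cont : continuous Phi.
Hypothesis Phi_incr : forall s t : R, 0 <= s -> s < t -> Phi s < Phi t.
Hypothesis Phi_neg : forall s : R, s <= 0 -> Phi s = 0.
Hypotheses (B0 : 0 < B) (W00 : W0 < 0) (Lam0 : 0 < Lam).
Hypothesis Phi_C3 : class_C 3 Phi [set s | s != 0].
Hypotheses (als0 : 0 < als) (MstE : Mst = W0 * resp als Mst) (a0 : 0 < Mst + B).
Hypotheses (b0 : 0 <= b).

Let a := Mst + B.
Let dPhi := (Phi^`(1))%classic.
Let ddPhi := (Phi^`(2))%classic.
Let c := dresp als Mst.
Let mus := als * Phi a.
Hypothesis dPhi0 : 0 < dPhi a.
Hypothesis ddPhi0 : 0 <= ddPhi a.

(** Partial derivative of [resp] in al at the base point. *)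
Definition dresp_al : R := (dtmean mus * mus - tmean mus) / (als ^+ 2 * Lam).
(* derivative in [root_] of the homogeneous state [m = W0 * resp al m] *)
Definition slope : R := W0 * dresp_al / (1 - W0 * c).
(* derivative of [dresp] along the homogeneous branch *)
Definition crossing_speed : R :=
  (ddtmean mus * (als * (dPhi a * slope) + Phi a) * dPhi a + dtmean mus * (ddPhi a * slope)) / Lam.

Definition root_ p : R := als + p.2.1.
Definition state_ p : R := Mst + (slope * p.2.1 + p.2.2.1).
(* One quasi-Newton step for [m = W0 * resp al m] from the guess [state_]: at the
   base point it does not depend to first order on the correction [p.2.2.1]. *)
Definition newton_state p : R := Mst +
  (W0 * resp (root_ p) (state_ p) - Mst - W0 * c * (state_ p - Mst)) / (1 - W0 * c).
(** The equation p.2.2.1 = state_residual p says that [newton_state] fixes [state_ p]. In this form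
    the right-hand side has zero gradient in alpha and in the correction at the base point, as a
    contraction demands. *)
Definition state_residual p : R := newton_state p - Mst - slope * p.2.1.
(* [(resp al (m + s w) - resp al m) / s - c w]; the integral form is regular at
   [s = 0]. *)
Definition increment_rest p : R := p.2.2.2 *
  int01 (fun t => dresp (root_ p) (newton_state p + t * (p.1 * p.2.2.2))) + - c * p.2.2.2.

Let mus0 : 0 < mus.
Proof. by rewrite mulr_gt0// (Phi_gt0 Phi_incr Phi_neg). Qed.

Lemma dresp_base_gt0 : 0 < c.
Proof. by rewrite /c /dresp divr_gt0// mulr_gt0// dtmean_gt0. Qed.

Let D0 : 0 < 1 - W0 * c.
Proof. by rewrite subr_gt0 (lt_trans _ ltr01)// nmulr_rlt0// dresp_base_gt0. Qed.

(** The variance of the conditioned law is at most 1, so dtmean mus * mus <= mus < tmean mus. *)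
Lemma dresp_al_lt0 : dresp_al < 0.
Proof.
have t1 := tmean_gt_id mus; have t0 := tmean_gt0 (ltW mus0).
rewrite /dresp_al ltr_pdivrMr ?mulr_gt0 ?exprn_gt0// mul0r subr_lt0.
apply: (le_lt_trans _ t1); rewrite ler_piMl ?(ltW mus0)//.
have : 0 <= tmean mus * (tmean mus - mus) by rewrite mulr_ge0 ?(ltW t0)// subr_ge0 ltW.
rewrite /dtmean; lra.
Qed.

Lemma slope_gt0 : 0 < slope.
Proof. by rewrite /slope divr_gt0// nmulr_rgt0// dresp_al_lt0. Qed.

(** W0 < 0 and dresp_al < 0 make the homogeneous state rise with alpha, hence also the argument of
    [tmean]; there [ddtmean_gt0] gives a positive first term and Phi'' >= 0 a nonnegative second
    one. *)
Lemma crossing_speed_gt0 : 0 < crossing_speed.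
Proof.
have s0 := slope_gt0; have P0 : 0 < Phi a by exact: Phi_gt0.
have dd : 0 < ddtmean mus by exact: ddtmean_gt0.
have d0 : 0 < dtmean mus by exact: dtmean_gt0.
rewrite /crossing_speed divr_gt0// ltr_wpDr//.
  by rewrite mulr_ge0 ?(ltW d0)// mulr_ge0// ltW.
by rewrite mulr_gt0// mulr_gt0// ltr_wpDl// ?ltW// mulr_gt0// mulr_gt0.
Qed.

Let vnorm_ge0 := @vnorm_ge0 R.

Let vnorm0 : vnorm (0 : V) = 0.
Proof. by rewrite /vnorm /= !normr0 !addr0. Qed.

Let coord_le p : [/\ `|p.1| <= vnorm p, `|p.2.1| <= vnorm p, `|p.2.2.1| <= vnorm p &
  `|p.2.2.2| <= vnorm p].
Proof.
have h1 := normr_ge0 p.1; have h2 := normr_ge0 p.2.1.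
have h3 := normr_ge0 p.2.2.1; have h4 := normr_ge0 p.2.2.2.
by rewrite /vnorm; split; lra.
Qed.

Let C11_coord (l : V -> R) delta : delta <= 1 ->
  (forall k h h', l (k *: h + h') = k * l h + l h') ->
  (forall h, `|l h| <= vnorm h) -> (forall p, box delta b p -> `|l p| <= 1 + b) ->
  C11 vnorm (box delta b) l (fun _ => l).
Proof.
move=> d1 llin lN lb; apply: (@C11_linear _ _ _ _ _ _ (1 + b)) => // h.
by rewrite (le_trans (lN h))// ler_peMl// lerDl.
Qed.

Let coords delta : delta <= 1 -> [/\ C11 vnorm (box delta b) (fun p => p.1) (fun _ h => h.1),
  C11 vnorm (box delta b) (fun p => p.2.1) (fun _ h => h.2.1),
  C11 vnorm (box delta b) (fun p => p.2.2.1) (fun _ h => h.2.2.1) &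
  C11 vnorm (box delta b) (fun p => p.2.2.2) (fun _ h => h.2.2.2)].
Proof.
move=> d1; have db x : `|x| <= delta -> `|x| <= 1 + b.
  by move=> h; rewrite (le_trans h)// (le_trans d1)// lerDl.
split; (apply: C11_coord => //; first by move=> h; have [] := coord_le h).
- by move=> p [h _ _ _]; exact: db.
- by move=> p [_ h _ _]; exact: db.
- by move=> p [_ _ h _]; exact: db.
- by move=> p [_ _ _ h]; rewrite (le_trans h)// lerDr.
Qed.

(** Keeps alpha in [als / 2, 2 als] and the input in [a / 2, 2 a], away from the singularities of
    the inverse and of Phi. *)
Let d1 : R := Num.min 1 (Num.min (als / 2) (a / (2 * (`|slope| + 1)))).

Let S0 : 0 < `|slope| + 1.
Proof. by rewrite ltr_wpDl. Qed.

Let d10 : 0 < d1.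
Proof. by rewrite /d1 !lt_min ltr01 !divr_gt0// mulr_gt0. Qed.

Let al_itv delta p : delta <= d1 -> box delta b p -> als / 2 <= root_ p <= 2 * als.
Proof.
move=> dd [_ h _ _]; have : `|p.2.1| <= als / 2.
  by rewrite (le_trans h)// (le_trans dd)// /d1 !ge_min lexx orbT.
rewrite ler_norml /root_ => /andP[h1 h2]; have := ltW als0; move=> h3.
by apply/andP; split; lra.
Qed.

Let m_itv p : box d1 b p -> a / 2 <= state_ p + B <= 2 * a.
Proof.
move=> [_ h1 h2 _]; have h : `|slope * p.2.1 + p.2.2.1| <= a / 2.
  rewrite (le_trans (ler_normD _ _))// normrM.
  have h3 : d1 * (2 * (`|slope| + 1)) <= a.
    by rewrite -ler_pdivlMr ?mulr_gt0// /d1 !ge_min lexx !orbT.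
  have h4 := ler_wpM2l (normr_ge0 slope) h1.
  by move: h1 h2 h3 h4; set x := d1; set y := `|slope|; nra.
move: h; rewrite ler_norml /state_ -/a => /andP[h5 h6].
have e : Mst + (slope * p.2.1 + p.2.2.1) + B = a + (slope * p.2.1 + p.2.2.1) by rewrite /a; ring.
by have a1 : 0 < a := a0; rewrite e; apply/andP; split; lra.
Qed.

Let C11_bounded (V' : lmodType R) (N : V' -> R) (U : set V') (f : V' -> R)
  (g : V' -> V' -> R) : C11 N U f g ->
  exists X : R, 0 <= X /\ forall q : V', U q -> - X <= f q <= X.
Proof.
by move=> [X [X0 _ fb _]]; exists X; split => // q /fb[+ _]; rewrite ler_norml.
Qed.

Lemma C11_resp : exists2 g, C11 vnorm (box d1 b) (fun p => resp (root_ p) (state_ p)) g &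
  forall w h, g (0, (0, (0, w))) h = dresp_al * h.2.1 + c * (slope * h.2.1 + h.2.2.1).
Proof.
have d11 : d1 <= 1 by rewrite /d1 ge_min lexx.
have [Hs H1 H2 Hw] := coords d11.
have Ha : C11 vnorm (box d1 b) root_ (fun _ h => h.2.1).
  by apply: C11_ext (C11_add (C11_cst vnorm_ge0 (box d1 b) als) H1) => // p h _; rewrite add0r.
have Hm : C11 vnorm (box d1 b) (fun p => state_ p + B) (fun _ h => slope * h.2.1 + h.2.2.1).
  apply: C11_ext (C11_add (C11_cst vnorm_ge0 (box d1 b) (Mst + B)) (C11_add (C11_scale vnorm_ge0 slope H1) H2)).
    by move=> p _; rewrite /state_; ring.
  by move=> p h _; rewrite add0r.
have a1 : 0 < a := a0.
have a2 : a / 2 <= 2 * a by lra.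
have a3 : 0 < a / 2 by rewrite divr_gt0.
have HPhi := C11_comp vnorm_ge0 Hm m_itv (@C11_Phi R Phi Phi_C3 0 _ _ isT a3 a2).
have Hmu := C11_mul vnorm_ge0 Ha HPhi.
have [X [X0 Xb]] := C11_bounded Hmu.
have Htm := C11_comp vnorm_ge0 Hmu Xb (@C11_tmean R _ _ (ge0_cp X0).2).
have al2 : als / 2 <= 2 * als by have := als0; lra.
have al3 : 0 < als / 2 by rewrite divr_gt0.
have Hinv := C11_comp vnorm_ge0 Ha (fun p => @al_itv d1 p (lexx _)) (@C11_inv R _ _ al3 al2).
have Hr := C11_mul vnorm_ge0 Htm (C11_scale vnorm_ge0 Lam^-1 Hinv).
eexists; first apply: C11_ext Hr.
- by move=> p _; rewrite /resp invfM [Lam^-1 * _]mulrC.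
- by move=> p h _.
move=> w h /=; rewrite /root_ /state_ /= mulr0 !addr0 -/a /c /dresp /dresp_al -/a -/mus.
rewrite -[(Phi^`())%classic]derive1n1 -/dPhi /mus.
move: (Phi a) (dPhi a) (tmean _) (dtmean _) => P dP tm dt.
by field; rewrite !gt_eqF.
Qed.

Let w0E w : (root_ (0, (0, (0, w))) = als) * (state_ (0, (0, (0, w))) = Mst).
Proof. by rewrite /root_ /state_ /= mulr0 !addr0. Qed.

Lemma newton_state_base w : newton_state (0, (0, (0, w))) = Mst.
Proof. by rewrite /newton_state !w0E -MstE !subrr mulr0 subrr mul0r addr0. Qed.

Lemma increment_rest_base w : increment_rest (0, (0, (0, w))) = 0.
Proof.
rewrite /increment_rest /= w0E newton_state_base.
have -> : int01 (fun t => dresp als (Mst + t * (0 * w))) = c.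
  by rewrite -[RHS](@int01_cst R); congr int01; apply/funext => t; rewrite mul0r mulr0 addr0.
by rewrite mulrC mulNr subrr.
Qed.

Lemma state_residual_base w : state_residual (0, (0, (0, w))) = 0.
Proof. by rewrite /state_residual newton_state_base /= mulr0 subrr subr0. Qed.

Lemma newton_state_fixed p : newton_state p = state_ p -> state_ p = W0 * resp (root_ p) (state_ p).
Proof.
rewrite /newton_state; set x := W0 * resp _ _; move: (state_ p) x D0 => y x D e.
have e1 : (y - Mst) * (1 - W0 * c) = x - Mst - W0 * c * (y - Mst).
  by rewrite -[in LHS]e addrAC subrr add0r divfK// gt_eqF.
lra.
Qed.

(** The subtracted term W0 c (state_ - Mst) cancels the contribution of [state_] to the gradient at
    the base point; what alpha contributes directly gives [slope]. *)
Lemma C11_newton_state : exists2 g, C11 vnorm (box d1 b) newton_state g &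
  forall w h, g (0, (0, (0, w))) h = slope * h.2.1.
Proof.
have [g Hr gE] := C11_resp; have d11 : d1 <= 1 by rewrite /d1 ge_min lexx.
have [_ H1 H2 _] := coords d11.
have Hm := C11_add (C11_scale vnorm_ge0 slope H1) H2.
have H := C11_add (C11_cst vnorm_ge0 (box d1 b) (Mst - Mst / (1 - W0 * c)))
  (C11_scale vnorm_ge0 (1 - W0 * c)^-1 (C11_add (C11_scale vnorm_ge0 W0 Hr) (C11_scale vnorm_ge0 (- (W0 * c)) Hm))).
eexists; first apply: C11_ext H.
- by move=> p _; rewrite /newton_state /state_; field; rewrite gt_eqF.
- by move=> p h _.
move=> w h /=; rewrite gE add0r /slope; move: D0.
move: dresp_al c => x y y0; field; rewrite gt_eqF//.
Qed.

(** [increment_rest] is built on [newton_state] instead of [state_], so its gradient at the base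
    point ignores the correction hn; and the c w subtracted in it removes the dependence on hw. What
    is left is the transversality term. *)
Lemma local_response : exists (delta : R) (g1 g2 : V -> V -> R),
  [/\ 0 < delta <= 1, C11 vnorm (box delta b) increment_rest g1, C11 vnorm (box delta b) state_residual g2,
   (forall w (ha hn hw : R), g1 (0, (0, (0, w))) (0, (ha, (hn, hw))) = crossing_speed * w * ha /\
      g2 (0, (0, (0, w))) (0, (ha, (hn, hw))) = 0) &
   forall p, box delta b p -> 0 < root_ p /\
     p.1 * (p.2.2.2 * int01 (fun t => dresp (root_ p) (newton_state p + t * (p.1 * p.2.2.2)))) =
     resp (root_ p) (newton_state p + p.1 * p.2.2.2) - resp (root_ p) (newton_state p)].
Proof.
have [gM HM gME] := C11_newton_state; have d11 : d1 <= 1 by rewrite /d1 ge_min lexx.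
have [X [X0 _ _ MX]] := HM.
have X1 : 0 < 12 * (X + 1) by rewrite mulr_gt0// ltr_wpDl.
have b1 : 0 < 4 * (b + 1) by rewrite mulr_gt0// ltr_wpDl.
have a1 : 0 < a := a0.
(* [newton_state] moves by at most 3 X delta and t * (s * w) by at most b delta; the last two terms
   of the minimum make each at most a / 4. *)
have [] := min3P d10 (divr_gt0 a1 X1) (divr_gt0 a1 b1).
set delta := Num.min d1 _ => de0 ded dX db.
have de1 : delta <= 1 := le_trans ded d11.
have deX : delta * (12 * (X + 1)) <= a.
  by rewrite -ler_pdivlMr.
have deb : delta * (4 * (b + 1)) <= a.
  by rewrite -ler_pdivlMr.
have sub p : box delta b p -> box d1 b p.
  by move=> [h1 h2 h3 h4]; split => //; apply: le_trans ded.
have [Hs H1 H2 Hw] := coords de1.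
have Ha : C11 vnorm (box delta b) root_ (fun _ h => h.2.1).
  by apply: C11_ext (C11_add (C11_cst vnorm_ge0 (box delta b) als) H1) => // p h _; rewrite add0r.
have HM' : C11 vnorm (box delta b) newton_state gM := C11_sub sub HM.
have HMB := C11_add HM' (C11_cst vnorm_ge0 (box delta b) B).
pose U' := [set tp : R^o * V | 0 <= tp.1 <= 1 /\ box delta b tp.2].
pose N' (th : R^o * V) : R := `|th.1| + vnorm th.2.
have N'0 th : 0 <= N' th by rewrite addr_ge0.
pose arg (tp : R^o * V) := newton_state tp.2 + B + tp.1 * (tp.2.1 * tp.2.2.2.2).
have arg_itv tp : U' tp -> a / 2 <= arg tp <= 2 * a.
  move=> [/andP[t0 t1] Up]; have Ud := sub _ Up; have [h1 h2 h3 h4] := Up.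
  have Ub : box d1 b ((0, (0, (0, tp.2.2.2.2))) : V).
    by split; rewrite /= ?normr0 ?(ltW d10).
  have [MM _ _] := MX _ _ Ub Ud.
  rewrite newton_state_base in MM.
  have hv : vnorm (tp.2 - (0, (0, (0, tp.2.2.2.2)))) <= 3 * delta.
    by rewrite /vnorm /= !subr0 subrr normr0; lra.
  have M4 : `|newton_state tp.2 - Mst| <= a / 4.
    by apply: (le_trans MM); apply: (le_trans (ler_wpM2l X0 hv)); move: X0 deX de0; set y := delta; nra.
  have w4 : `|tp.1 * (tp.2.1 * tp.2.2.2.2)| <= a / 4.
    rewrite normrM ger0_norm// (le_trans (ler_piMl _ t1))// normrM.
    apply: (le_trans (ler_pM _ _ h1 h4)) => //.
    by move: b0 deb de0; set y := delta; nra.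
  have e : arg tp = a + (newton_state tp.2 - Mst) + tp.1 * (tp.2.1 * tp.2.2.2.2).
    by rewrite /arg /a; ring.
  move: M4 w4; rewrite !ler_norml e => /andP[? ?] /andP[? ?]; apply/andP; split; lra.
have Lt := @C11_fst R V vnorm (box delta b) vnorm_ge0.
have La := C11_snd vnorm_ge0 Ha; have Ls := C11_snd vnorm_ge0 Hs.
have Lw := C11_snd vnorm_ge0 Hw; have LM := C11_snd vnorm_ge0 HMB.
have Harg : C11 N' U' arg _ := C11_add LM (C11_mul N'0 Lt (C11_mul N'0 Ls Lw)).
have a2 : a / 2 <= 2 * a by lra.
have a3 : 0 < a / 2 by rewrite divr_gt0.
have HPhi := C11_comp N'0 Harg arg_itv (@C11_Phi R Phi Phi_C3 0 _ _ isT a3 a2).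
have HdPhi := C11_comp N'0 Harg arg_itv (@C11_Phi R Phi Phi_C3 1 _ _ isT a3 a2).
have Hmu := C11_mul N'0 La HPhi.
have [Y [Y0 Yb]] := C11_bounded Hmu.
have Hdt := C11_comp N'0 Hmu Yb (@C11_dtmean R _ _ (ge0_cp Y0).2).
have HG := C11_mul N'0 (C11_cst N'0 U' Lam^-1) (C11_mul N'0 Hdt HdPhi).
have GE tp : Lam^-1 * (dtmean (root_ tp.2 * (Phi^`(0))%classic (arg tp)) * (Phi^`(1))%classic (arg tp)) =
    dresp (root_ tp.2) (newton_state tp.2 + tp.1 * (tp.2.1 * tp.2.2.2.2)).
  rewrite mulrC /dresp derive1n1 derive1n0.
  by rewrite (_ : arg tp = newton_state tp.2 + tp.1 * (tp.2.1 * tp.2.2.2.2) + B)// /arg addrAC.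
have HI := C11_integral vnorm_ge0 vnorm0 HG.
have Hf1 := C11_add (C11_mul vnorm_ge0 Hw HI) (C11_scale vnorm_ge0 (- c) Hw).
have Hf2 := C11_add HM' (C11_add (C11_cst vnorm_ge0 (box delta b) (- Mst)) (C11_scale vnorm_ge0 (- slope) H1)).
exists delta; eexists; eexists; split.
- by rewrite de0 de1.
- apply: C11_ext Hf1 => [p _|p h _]; last by [].
  rewrite /increment_rest; congr (_ * _ + _); apply: eq_int01 => t _; exact: (GE (t, p)).
- by apply: C11_ext Hf2 => [p _|p h _]; [rewrite /state_residual; ring|].
- move=> w ha hn hw; split; last by rewrite /= gME /= add0r mulNr subrr.
  have argE t : arg (t, (0, (0, (0, w)))) = a by rewrite /arg /= newton_state_base mul0r mulr0 addr0.
  rewrite /=.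
  have -> : int01 (fun t => Lam^-1 * (dtmean (root_ (0, (0, (0, w))) * (Phi^`(0))%classic (arg (t, (0, (0, (0, w)))))) * (Phi^`(1))%classic (arg (t, (0, (0, (0, w))))))) = c.
    rewrite -[RHS](@int01_cst R); congr int01; apply/funext => t.
    by rewrite argE w0E derive1n0 derive1n1 mulrC.
  set J := int01 _; have -> : J = crossing_speed * ha.
    rewrite -[RHS](@int01_cst R) /J; congr int01; apply/funext => t.
    rewrite argE w0E gME /= !(mul0r, mulr0, addr0, add0r).
    by rewrite /crossing_speed /mus /dPhi /ddPhi /=; ring.
  ring.
- move=> p Up; have al0 : 0 < root_ p.
    by have /andP[h _] := al_itv ded Up; rewrite (lt_le_trans _ h)// divr_gt0.
  split => //; have [X' [X'0 _ _ GX]] := HG.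
  (* The increment of [resp] along the segment from the homogeneous state is the integral of the
     derivative of H, which carries the factor s. *)
  pose H t := resp (root_ p) (newton_state p + t * (p.1 * p.2.2.2)).
  have Nt t t' : N' ((t', p) - (t, p)) = `|t' - t|.
    by rewrite /N' -[(_ - _).2]/(p - p) subrr vnorm0 addr0.
  have E : forall t : R, 0 <= t <= 1 -> is_derive t 1 H
      ((p.1 * p.2.2.2) * dresp (root_ p) (newton_state p + t * (p.1 * p.2.2.2))).
    move=> t t01; have /andP[ag _] := arg_itv (t, p) (conj t01 Up).
    apply: is_derive_resp_line => //; rewrite addrAC.
    exact: lt_le_trans a3 ag.
  have L : lip01 (fun t => (p.1 * p.2.2.2) * dresp (root_ p) (newton_state p + t * (p.1 * p.2.2.2))).
    apply: lip01Z; exists X' => t t' t01 t'01.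
    have [+ _ _] := GX (t, p) (t', p) (conj t01 Up) (conj t'01 Up).
    by rewrite !GE Nt.
  have := int01_FTC L E; rewrite /H mul1r mul0r addr0 => <-.
  rewrite mulrA.
  have L1 : lip01 (fun t => dresp (root_ p) (newton_state p + t * (p.1 * p.2.2.2))).
    exists X' => t t' t01 t'01.
    have [+ _ _] := GX (t, p) (t', p) (conj t01 Up) (conj t'01 Up).
    by rewrite !GE Nt.
  have L0 : lip01 (fun _ : R => 0 : R) by exists 0 => t t' _ _; rewrite subrr normr0 mul0r.
  have := int01_linear (p.1 * p.2.2.2) L1 L0; rewrite int01_cst addr0 => <-.
  by apply: eq_int01 => t _; rewrite addr0.
Qed.

End local_response.

(** * Lyapunov-Schmidt reduction *)

Section finite_rank.
Context (R : realType) (d : nat) (L : R).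
Hypothesis L0 : 0 < L.
Local Notation T := 'rV[R]_d.
Local Notation mu := (torus_measure L d).
Local Notation om := (@omega R d L).
Local Notation even_periodic := (@even_periodic R d L).
Local Notation multi := {ffun 'I_d -> nat}.
Implicit Types (f g : T -> R) (x : T) (k j : multi) (a : multi -> R) (S : seq multi).

Lemma even_lin (t : R) f g : even_periodic f -> even_periodic g -> even_periodic (fun x => t * f x + g x).
Proof.
move=> [mf fL fe] [mg gL ge]; split.
- by apply: measurable_funD => //; exact: measurable_funM.
- by move=> i x; rewrite fL gL.
- by move=> i x; rewrite fe ge.
Qed.

Lemma even_mul f g : even_periodic f -> even_periodic g -> even_periodic (fun x => f x * g x).
Proof.
move=> [mf fL fe] [mg gL ge]; split; first exact: measurable_funM.
- by move=> i x; rewrite fL gL.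
- by move=> i x; rewrite fe ge.
Qed.

Lemma even_comp (h : R -> R) f (b c : R) : even_periodic f -> bounded_by f b ->
  (forall u v, `|u| <= b -> `|v| <= b -> `|h v - h u| <= c * `|v - u|) ->
  even_periodic (fun x => h (f x)).
Proof.
move=> [mf fL fe] fb hc; split; last 2 first.
- by move=> i x; rewrite fL.
- by move=> i x; rewrite fe.
have b0 : 0 <= b := le_trans (normr_ge0 _) (fb 0).
(* h is controlled on [- b, b] only; clipping its argument makes it continuous on R, hence Borel,
   and leaves h (f x) unchanged. *)
pose cl (t : R) : R := Num.max (- b) (Num.min b t).
have clb t : `|cl t| <= b.
  rewrite ler_norml /cl le_max lexx/= ge_max ge_min lexx/= andbT.
  by rewrite (le_trans _ b0)// oppr_le0.
have clid t : `|t| <= b -> cl t = t.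
  by rewrite ler_norml /cl => /andP[h1 h2]; rewrite (min_idPr h2) (max_idPr h1).
have clc : continuous cl.
  move=> t; apply: (@continuous_max R _ (fun=> - b) (fun t => Num.min b t)); first exact: cvg_cst.
  by apply: (@continuous_min R _ (fun=> b) id); [exact: cvg_cst|exact: cvg_id].
have hcl : continuous (h \o cl).
  move=> t; apply/cvgrPdist_lt => e e0.
  have c1 : 0 < `|c| + 1 by rewrite ltr_wpDl.
  move/cvgrPdist_lt : (clc t) => /(_ _ (divr_gt0 e0 c1)); apply: filterS => t' tt'.
  rewrite /= (le_lt_trans (hc _ _ (clb t') (clb t)))//.
  rewrite (le_lt_trans (ler_wpM2r (normr_ge0 _) (_ : c <= `|c| + 1)))//.
    by rewrite (le_trans (ler_norm c))// lerDl.
  by rewrite mulrC -ltr_pdivlMr.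
rewrite (_ : (fun x => h (f x)) = (h \o cl) \o f).
  apply: (@measurableT_comp _ _ _ _ _ _ (h \o cl : measurableTypeR R -> measurableTypeR R)) => //.
  exact: continuous_measurable_fun.
by apply/funext => x; rewrite /= clid.
Qed.

Lemma even_sqint f (D : R) : even_periodic f -> bounded_by f D -> sqint mu f.
Proof. by move=> [mf _ _] fD; exact: bounded_sqint mf fD. Qed.

Definition finite_rank a S f x : R := \sum_(k <- S) a k * ip mu f (om k) * om k x.

Lemma even_periodic_finite_rank a S f : even_periodic (finite_rank a S f).
Proof.
rewrite /finite_rank; elim: S => [|k S IH].
  by under eq_fun do rewrite big_nil; split.
under eq_fun do rewrite big_cons; apply: even_lin => //; exact: even_periodic_omega.
Qed.

Lemma finite_rank_blin a S : exists2 c : R, 0 <= c & bounded_linear even_periodic c (finite_rank a S).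
Proof.
set m := fine (mu setT); have m0 : 0 <= m by rewrite fine_ge0.
pose ob := @omega_bound R d L; have ob0 k : 0 <= ob k := ltW (omega_bound_gt0 L0 k).
exists (\sum_(k <- S) `|a k| * (ob k * m) * ob k).
  by apply: sumr_ge0 => k _; apply: mulr_ge0 (ob0 k); apply: mulr_ge0 (normr_ge0 _) _; exact: mulr_ge0.
move=> f D D0 fg fD; split; first exact: even_periodic_finite_rank.
- move=> x; rewrite (le_trans (ler_norm_sum _ _ _))// mulr_suml; apply: ler_sum => k _.
  have [mf _ _] := fg; have [mo _ _] := even_periodic_omega L0 k.
  have h1 := ip_bounded mu mf mo fD (@omega_bounded R d L L0 k).
  have -> : `|a k| * (ob k * m) * ob k * D = `|a k| * (D * ob k * m) * ob k by ring.
  rewrite (normrM _ (om k x)) (normrM (a k)); apply: ler_pM.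
  + exact: mulr_ge0.
  + exact: normr_ge0.
  + exact: ler_wpM2l (normr_ge0 _) _ _ h1.
  + exact: (@omega_bounded R d L L0 k x).
- move=> t g gg gD x; rewrite /finite_rank mulr_sumr -big_split/=; apply: eq_bigr => k _.
  have fs := even_sqint fg fD; have gs := even_sqint gg gD.
  rewrite ipDl//; [|exact: sqintZ|exact: omega_sqint].
  by rewrite ipZl//; [ring|exact: omega_sqint].
Qed.

Lemma ip_finite_rank a S f k : uniq S -> k \in S ->
  ip mu (finite_rank a S f) (om k) = a k * ip mu f (om k).
Proof.
move=> US kS; have os j : sqint mu (om j) by exact: omega_sqint.
rewrite /finite_rank ip_suml//; last by move=> j; exact: sqintZ.
rewrite (bigD1_seq k)//= ipZl// (ip_omega L0) eqxx mulr1 big1 ?addr0// => j jk.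
by rewrite ipZl// (ip_omega L0) (negbTE jk) mulr0.
Qed.

Lemma finite_rank_omega a S k x : uniq S -> k \in S ->
  finite_rank a S (om k) x = a k * om k x.
Proof.
move=> US kS; rewrite /finite_rank (bigD1_seq k)//= (ip_omega L0) eqxx mulr1 big1 ?addr0//.
by move=> j jk; rewrite (ip_omega L0) eq_sym (negbTE jk) mulr0 mul0r.
Qed.

Variable K : T -> R.
Hypothesis Ks : sqint mu K.
Hypothesis Kg : even_periodic K.
Variables (S : seq multi) (e : R).
Hypothesis US : uniq S.
Hypothesis Se : forall f (B : R), 0 <= B -> even_periodic f -> bounded_by f B ->
  bounded_by (fun x => torus_conv L K f x - truncation L K S f x) (e * B).

Definition residual f x : R := torus_conv L K f x - truncation L K S f x.

Lemma even_sub f g : even_periodic f -> even_periodic g -> even_periodic (fun x => f x - g x).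
Proof. exact: (good_sub (good := even_periodic) even_lin). Qed.

Lemma residual_blin : bounded_linear even_periodic e residual.
Proof.
move=> f D D0 fg fD; split.
- by apply: even_sub; [exact: even_periodic_conv fD|exact: even_periodic_finite_rank].
- exact: Se.
- move=> t g gg gD x; rewrite /residual conv_lin//; try exact: even_sqint.
  have [c c0 /(_ f D D0 fg fD)[_ _ h]] := finite_rank_blin (multiplier L K) S.
  have h' : truncation L K S (fun x => t * f x + g x) x =
    t * truncation L K S f x + truncation L K S g x := h t g gg gD x.
  by rewrite h'; ring.
Qed.

Lemma ip_residual f (D : R) k : 0 <= D -> even_periodic f -> bounded_by f D -> k \in S ->
  ip mu (residual f) (om k) = 0.
Proof.
move=> D0 fg fD kS; have [C CP] := conv_bounded L0 Ks Kg.
have cs := even_sqint (even_periodic_conv L0 Ks Kg D0 fg fD) (CP f D D0 fg fD).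
have [c c0 /(_ f D D0 fg fD)[ga ba _]] := finite_rank_blin (multiplier L K) S.
rewrite ipBl//; [|exact: even_sqint ga ba|exact: omega_sqint].
by rewrite (ip_conv L0 Ks Kg k D0 fg fD) ip_finite_rank// subrr.
Qed.

(** Convolution commutes and [omega k] reproduces itself, so on a mode of S the truncation is
    exact. *)
Lemma residual_omega k x : k \in S -> residual (om k) x = 0.
Proof.
move=> kS; have [mK KL Ke] := Kg; have [mo oL oe] := even_periodic_omega L0 k.
have e1 : torus_conv L K (om k) x = \int[mu]_y (om k (x - y) * K y).
  have h := @Rintegral_affine R d L L0 (const_mx (-1)) x (fun y => om k (x - y) * K y).
  rewrite -h; last 3 first.
  - exact: signsN1.
  - apply: measurable_funM => //.
    by have := measurable_comp_affine (const_mx (-1)) x mo; rewrite -reflE.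
  - move=> i y; rewrite KL; congr (_ * _).
    by rewrite opprD addrA; exact: periodicN.
  by apply: eq_Rintegral => y _; rewrite -reflE /refl opprB [x + (y - x)]addrC subrK mulrC.
rewrite /residual e1 (omega_convolution L0 k x Ks KL Ke).
by rewrite [truncation _ _ _ _ _]finite_rank_omega// /multiplier subrr.
Qed.

Lemma conv_split f x : torus_conv L K f x = finite_rank (multiplier L K) S f x + residual f x.
Proof. by rewrite /residual addrC subrK. Qed.

End finite_rank.

(** * From uniform estimates to continuous differentiability *)

Section curve_regularity.
Context (R : realType).

Lemma C11_scalar_is_derive (e : R) (f f' : R -> R) :
  C11_scalar [set s | `|s| <= e] f f' -> forall s : R, `|s| < e -> is_derive s 1 f (f' s).
Proof.
move=> [C [C0 _ _ fl]] s se.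
have H : h^-1 *: (f (h *: (1 : R) + s) - f s) @[h --> 0^'] --> f' s.
  apply/cvgrPdist_le => eps eps0; rewrite near_withinE; apply/nbhs_ballP.
  have C1 : 0 < C + 1 by rewrite ltr_wpDl.
  exists (Num.min (e - `|s|) (eps / (C + 1))) => /=.
    by rewrite lt_min subr_gt0 se divr_gt0.
  move=> h; rewrite /ball/= sub0r normrN lt_min => /andP[h1 h2] h0.
  have sh : `|h *: (1 : R) + s| <= e.
    by rewrite (le_trans (ler_normD _ _))// [_ *: _]mulr1; lra.
  have [_ + _] := fl s (h *: 1 + s) (ltW se) sh.
  rewrite [h *: 1]mulr1 addrK => Hh.
  have -> : f' s - h^-1 *: (f (h + s) - f s) = - (h^-1 * (f (h + s) - f s - f' s * h)).
    by rewrite /GRing.scale/=; field.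
  rewrite normrN normrM normfV ler_pdivrMl ?normr_gt0//.
  apply: (le_trans Hh); rewrite expr2 mulrA mulrC ler_wpM2l//.
  rewrite ltr_pdivlMr// in h2; have := normr_ge0 h; nra.
apply: DeriveDef; first by apply/cvg_ex; exists (f' s).
exact/cvg_lim.
Qed.

Lemma C11_scalar_class_C (e : R) (f f' : R -> R) :
  C11_scalar [set s | `|s| <= e] f f' -> class_C 1 f [set s | `|s| < e].
Proof.
move=> fC s /= se; have fd := C11_scalar_is_derive fC; split.
  by case=> // _; have [] := fd s se.
have [C [C0 _ _ fl]] := fC.
have E t : `|t| < e -> (f^`())%classic t = f' t.
  by move=> te; rewrite derive1E; apply: derive_val; exact: fd.
apply/cvgrPdist_le => eps eps0; apply/nbhs_ballP.
have C1 : 0 < C + 1 by rewrite ltr_wpDl.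
exists (Num.min (e - `|s|) (eps / (C + 1))) => /=.
  by rewrite lt_min subr_gt0 se divr_gt0.
move=> t; rewrite /ball/= distrC lt_min => /andP[h1 h2].
have te : `|t| < e.
  by rewrite -(subrK s t) (le_lt_trans (ler_normD _ _))//; lra.
rewrite !E// distrC; have [_ _ /(_ 1)] := fl s t (ltW se) (ltW te).
rewrite !mulr1 normr1 mulr1 => h3; apply: (le_trans h3).
rewrite ltr_pdivlMr// in h2; have := normr_ge0 (t - s); nra.
Qed.

Lemma cvge0_le (V : Type) (F : set_system V) (X : V -> \bar R) : Filter F ->
  (forall x, 0 <= X x)%E -> (forall e : R, 0 < e -> \forall x \near F, (X x <= e%:E)%E) ->
  X @ F --> 0%E.
Proof.
move=> FF X0 Xe; apply: cvg_EFin.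
  move: (Xe 1 ltr01); apply: filterS => x x1.
  by rewrite ge0_fin_numE// (le_lt_trans x1)// ltry.
apply/cvgrPdist_le => e e0; move: (Xe e e0); apply: filterS => x xe /=.
rewrite sub0r normrN ger0_norm ?fine_ge0// -lee_fin fineK//.
by rewrite ge0_fin_numE// (le_lt_trans xe)// ltry.
Qed.

Variables (d : nat) (L : R).
Hypothesis L0 : 0 < L.
Local Notation T := 'rV[R]_d.
Local Notation mu := (torus_measure L d).
Local Notation even_periodic := (@even_periodic R d L).

Lemma even_periodic_L2S (f : T -> R) (D : R) : even_periodic f -> bounded_by f D -> L2S L f.
Proof.
move=> fg fD; have [mf fL fe] := fg; split.
  by split => //; apply/sqint_Lfun; exact: bounded_sqint mf fD.
by move=> i; apply: nearW => x; exact: fe.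
Qed.

(** On a space of finite measure the sup bound controls the L^2 norm ([Lnorm2_le]), so uniform
    C^{1,1} estimates in s give a C^1 curve in L^2. *)
Lemma curve_C1 (e K : R) (u u' : R -> T -> R) : 0 <= K ->
  (forall s, `|s| <= e -> even_periodic (u s) /\ bounded_by (u s) K) ->
  (forall s, `|s| <= e -> even_periodic (u' s) /\ bounded_by (u' s) K) ->
  (forall s s' x, `|s| <= e -> `|s'| <= e ->
    `|u s' x - u s x - (s' - s) * u' s x| <= K * (s' - s) ^+ 2 /\
    `|u' s' x - u' s x| <= K * `|s' - s|) ->
  C1_L2S L e u u'.
Proof.
move=> K0 uK u'K H s se.
have [us1 us2] := uK s (ltW se); have [u's1 u's2] := u'K s (ltW se).
set c := Num.sqrt (fine (mu setT)); have c0 : 0 <= c by exact: sqrtr_ge0.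
have Kc1 : 0 < K * c + 1 by rewrite ltr_wpDl// mulr_ge0.
have key (eps h : R) : 0 < eps -> `|h| < eps / (K * c + 1) -> K * `|h| * c <= eps.
  move=> eps0; rewrite ltr_pdivlMr// => h1; have := normr_ge0 h; nra.
split; [exact: even_periodic_L2S us1 us2|exact: even_periodic_L2S u's1 u's2| |].
- apply: cvge0_le; first by move=> h; exact: Lnorm_ge0.
  move=> eps eps0; rewrite near_withinE; apply/nbhs_ballP.
  exists (Num.min (e - `|s|) (eps / (K * c + 1))) => /=.
    by rewrite lt_min subr_gt0 se divr_gt0.
  move=> h; rewrite /ball/= sub0r normrN lt_min => /andP[h1 h2] h0.
  have sh : `|s + h| <= e by rewrite (le_trans (ler_normD _ _))//; lra.
  have [ush _] := uK _ sh.
  set f : T -> R := _ - _.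
  have fE x : f x = h^-1 * (u (s + h) x - u s x) - u' s x by [].
  have gf : even_periodic f.
    have g1 := even_scale h^-1 (even_sub ush us1).
    exact: (even_sub g1 u's1).
  have [mf _ _] := gf.
  apply: (@le_trans _ _ (K * `|h| * c)%:E); last by rewrite lee_fin key.
  apply: Lnorm2_le => //; last by rewrite mulr_ge0.
  move=> x; have [+ _] := H s (s + h) x (ltW se) sh.
  have hs : s + h - s = h by ring.
  rewrite hs => Hh.
  have -> : f x = h^-1 * (u (s + h) x - u s x - h * u' s x) by rewrite fE; field.
  rewrite normrM normfV ler_pdivrMl ?normr_gt0// (le_trans Hh)//.
  by rewrite -[h ^+ 2]real_normK ?num_real// expr2 [leRHS]mulrCA.
- apply: cvge0_le; first by move=> h; exact: Lnorm_ge0.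
  move=> eps eps0; apply/nbhs_ballP.
  exists (Num.min (e - `|s|) (eps / (K * c + 1))) => /=.
    by rewrite lt_min subr_gt0 se divr_gt0.
  move=> t; rewrite /ball/= distrC lt_min => /andP[h1 h2].
  have te : `|t| <= e by rewrite -(subrK s t) (le_trans (ler_normD _ _))//; lra.
  have [u't _] := u'K _ te.
  have [mf _ _] := even_sub u't u's1.
  apply: (@le_trans _ _ (K * `|t - s| * c)%:E); last by rewrite lee_fin key.
  apply: Lnorm2_le => //; last by rewrite mulr_ge0.
  by move=> x; have [_] := H s t x (ltW se) te.
Qed.

End curve_regularity.

(** * Splitting off the critical mode *)

Section lyapunov_schmidt.
Context (R : realType) (d : nat) (L : R).
Hypothesis L0 : 0 < L.
Local Notation T := 'rV[R]_d.
Local Notation mu := (torus_measure L d).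
Local Notation om := (@omega R d L).
Local Notation even_periodic := (@even_periodic R d L).
Local Notation multi := {ffun 'I_d -> nat}.
Variable K : T -> R.
Hypothesis Ks : sqint mu K.
Hypothesis Kg : even_periodic K.
Variables (S : seq multi) (e c : R) (k0 : multi).
Hypotheses (US : uniq S) (k0S : k0 \in S).
Hypothesis Se : forall f (B : R), 0 <= B -> even_periodic f -> bounded_by f B ->
  bounded_by (fun x => torus_conv L K f x - truncation L K S f x) (e * B).
Local Notation mult := (multiplier L K).
Local Notation resid := (residual L K S).
Hypothesis k0_res : c * mult k0 = 1.
Hypothesis k0_uniq : forall k, k != k0 -> c * mult k != 1.

(* [resolvent_op] inverts [1 - c * torus_conv K] composed with [torus_conv K] on
   the modes in [S] other than [k0]; the other modes are left to [small_op]. *)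
Definition resolvent_coef k : R := if k == k0 then 0 else mult k / (1 - c * mult k).
Definition resolvent_op f x : R := finite_rank L resolvent_coef S f x + resid f x.
Definition small_op f x : R := c * resid f x.

(** [n] stands for the increment of the response divided by s, and w = K conv n is the equation to
    solve. On a mode of S other than k0 it reads w_k = mult k (f_k + c w_k), solved by the
    resolvent. On k0, where c mult k0 = 1, it reduces to f_k0 + cs * ah = 0, which fixes ah and
    leaves the component of w free, normalized to 1. Outside S the residual acts on f and w, and w
    keeps its implicit form. *)
Lemma lyapunov_schmidt (f w n : T -> R) (D ah cs : R) : 0 <= D -> cs != 0 ->
  even_periodic f -> bounded_by f D -> even_periodic w -> bounded_by w D ->
  ah = - (cs^-1 * ip mu f (om k0)) ->
  (forall x, w x = om k0 x + (resolvent_op f x + small_op w x)) ->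
  (forall x, n x = f x + (c * w x + cs * ah * om k0 x)) ->
  ip mu w (om k0) = 1 /\ forall x, w x = torus_conv L K n x.
Proof.
move=> D0 cs0 fg fD wg wD ahE wE nE.
have og := even_periodic_omega L0 k0; have oD := @omega_bounded R d L L0 k0.
have os k : sqint mu (om k) by exact: omega_sqint.
have fs := even_sqint fg fD; have ws := even_sqint wg wD.
have Rb := residual_blin L0 Ks Kg Se.
have [Rfg RfD Rfl] := Rb f D D0 fg fD; have [Rwg RwD Rwl] := Rb w D D0 wg wD.
have Rfs := even_sqint Rfg RfD; have Rws := even_sqint Rwg RwD.
have frs : sqint mu (finite_rank L resolvent_coef S f).
  have [cc _ /(_ f D D0 fg fD)[h1 h2 _]] := finite_rank_blin L0 resolvent_coef S.
  exact: even_sqint h1 h2.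
have As : sqint mu (resolvent_op f) by exact: sqintD.
have Es : sqint mu (small_op w) by exact: sqintZ.
have wk k : k \in S -> ip mu w (om k) = (k == k0)%:R + resolvent_coef k * ip mu f (om k).
  move=> kS; have -> : w = fun x => om k0 x + (resolvent_op f x + small_op w x) by apply/funext.
  rewrite ipDl//; last exact: sqintD.
  rewrite (ip_omega L0) [k0 == k]eq_sym ipDl// ipDl// ip_finite_rank//.
  rewrite (ip_residual L0 Ks Kg US D0 fg fD kS) ipZl//.
  by rewrite (ip_residual L0 Ks Kg US D0 wg wD kS) mulr0 !addr0.
have w0 : ip mu w (om k0) = 1.
  by rewrite wk// eqxx /resolvent_coef eqxx mul0r addr0.
split => // x.
have csah : cs * ah = - ip mu f (om k0) by rewrite ahE mulrN mulVKf.
have nE' : n = fun x => f x + (c * w x + cs * ah * om k0 x) by apply/funext.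
have cws : sqint mu (fun x => c * w x + cs * ah * om k0 x) by apply: sqintD; exact: sqintZ.
have nk k : k \in S -> mult k * ip mu n (om k) = (k == k0)%:R + resolvent_coef k * ip mu f (om k).
  move=> kS; rewrite nE' ipDl// ipDl//; try exact: sqintZ.
  rewrite (ipZl c ws (os k)) (ipZl (cs * ah) (os k0) (os k)) (ip_omega L0) wk// [k0 == k]eq_sym csah /resolvent_coef.
  have [->|kk0] := eqVneq k k0.
    by rewrite mul0r !addr0 !mulr1 addrCA subrr addr0 mulrC; exact: k0_res.
  have := k0_uniq kk0; rewrite -subr_eq0 -opprB oppr_eq0 => h.
  by rewrite !mulr0 !add0r !addr0; field.
(* The part of n along [omega k0] disappears because k0 is in S. *)
have nR : resid n x = resid f x + c * resid w x.
  have b1 : bounded_by (om k0) (D + omega_bound L k0).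
    by move=> y; rewrite (le_trans (oD y))// lerDr.
  have D1 : 0 <= D + omega_bound L k0 by apply: (le_trans D0); rewrite lerDl ltW// omega_bound_gt0.
  have wD1 : bounded_by w (D + omega_bound L k0).
    by move=> y; rewrite (le_trans (wD y))// lerDl ltW// omega_bound_gt0.
  have [_ _ l1] := Rb _ _ D1 og b1.
  have [_ _ l2] := Rb _ _ D1 wg wD1.
  have g1 : even_periodic (fun x => cs * ah * om k0 x) by exact: even_scale.
  have o0 := ltW (omega_bound_gt0 L0 k0).
  pose D2 := D + (`|c| * D + `|cs * ah| * omega_bound L k0) + omega_bound L k0.
  have D20 : 0 <= D2 by rewrite !addr_ge0// mulr_ge0.
  have fD2 : bounded_by f D2.
    by move=> y; rewrite (le_trans (fD y))// /D2 -!addrA lerDl !addr_ge0// mulr_ge0.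
  have oD2 : bounded_by (om k0) D2.
    by move=> y; rewrite (le_trans (oD y))// /D2 lerDr !addr_ge0// mulr_ge0.
  have wD2 : bounded_by w D2.
    move=> y; rewrite (le_trans (wD y))// /D2 -!addrA lerDl.
    by rewrite !addr_ge0// mulr_ge0.
  have zg : even_periodic (fun=> 0).
    have := even_scale 0 fg; rewrite (_ : (fun x => 0 * f x) = fun=> 0)//.
    by apply/funext => y; rewrite mul0r.
  have z2 : bounded_by (fun _ : T => 0 : R) D2 by move=> y; rewrite normr0.
  have z0 : resid (fun=> 0) x = 0.
    have zz : bounded_by (fun _ : T => 0 : R) 0 by move=> y; rewrite normr0.
    have [_ h _] := Rb _ 0 (lexx 0) zg zz.
    by have := h x; rewrite mulr0 normr_le0 => /eqP.
  have [_ _ lo] := Rb _ _ D20 og oD2; have [_ _ lw] := Rb _ _ D20 wg wD2.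
  have [_ _ lf] := Rb _ _ D20 fg fD2.
  have -> : n = fun x => 1 * f x + (c * w x + cs * ah * om k0 x).
    by rewrite nE'; apply/funext => y; rewrite mul1r.
  have gcw : even_periodic (fun x => c * w x + cs * ah * om k0 x) by exact: even_lin.
  rewrite lf//; last first.
    move=> y; rewrite (@le_trans _ _ (`|c| * D + `|cs * ah| * omega_bound L k0))//.
      rewrite (le_trans (ler_normD _ _))// (normrM c) (normrM (cs * ah)).
      by apply: lerD; apply: ler_wpM2l => //; exact: oD.
    by rewrite /D2; lra.
  rewrite mul1r lw//; last first.
    move=> y; rewrite (normrM (cs * ah)) (@le_trans _ _ (`|cs * ah| * omega_bound L k0))//.
      by apply: ler_wpM2l => //; exact: oD.
    by rewrite /D2; have := mulr_ge0 (normr_ge0 c) D0; lra.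
  have -> : (fun x => cs * ah * om k0 x) = fun x => cs * ah * om k0 x + (fun=> 0) x.
    by apply/funext => y; rewrite addr0.
  by rewrite lo// z0 addr0 (residual_omega L0 Ks Kg US x k0S) mulr0 addr0.
rewrite (conv_split _ _ S) nR wE /resolvent_op /small_op.
have -> : finite_rank L mult S n x = om k0 x + finite_rank L resolvent_coef S f x.
  rewrite /finite_rank big_seq.
  transitivity (\sum_(k <- S) ((k == k0)%:R * om k x + resolvent_coef k * ip mu f (om k) * om k x)).
    by rewrite [RHS]big_seq; apply: eq_bigr => k kS; rewrite nk// mulrDl.
  rewrite big_split/= (bigD1_seq k0)//= eqxx mul1r big1 ?addr0// => k /negbTE ->.
  by rewrite mul0r.
by rewrite !addrA.
Qed.

End lyapunov_schmidt.

(** * The second branch of solutions *)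

Section branch.
Context (R : realType) (d : nat) (L : R).
Hypothesis L0 : 0 < L.
Local Notation T := 'rV[R]_d.
Local Notation mu := (torus_measure L d).
Local Notation om := (@omega R d L).
Local Notation even_periodic := (@even_periodic R d L).
Local Notation multi := {ffun 'I_d -> nat}.
Variable K : T -> R.
Hypothesis Ks : sqint mu K.
Hypothesis Kg : even_periodic K.
Variables (Phi : R -> R) (B W0 Lam als Mst : R) (k0 : multi).
Local Notation resp := (resp Phi B Lam).
Local Notation dresp := (dresp Phi B Lam).
Hypothesis Phi_cont : continuous Phi.
Hypothesis Phi_incr : forall s t : R, 0 <= s -> s < t -> Phi s < Phi t.
Hypothesis Phi_neg : forall s : R, s <= 0 -> Phi s = 0.
Hypotheses (B0 : 0 < B) (W00 : W0 < 0) (Lam0 : 0 < Lam).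
Hypothesis Phi_C3 : class_C 3 Phi [set s | s != 0].
Hypotheses (als0 : 0 < als) (MstE : Mst = W0 * resp als Mst) (a0 : 0 < Mst + B).
Hypothesis dPhi0 : 0 < (Phi^`(1))%classic (Mst + B).
Hypothesis ddPhi0 : 0 <= (Phi^`(2))%classic (Mst + B).
Local Notation c := (dresp als Mst).
Local Notation mult := (multiplier L K).
Hypothesis k0_res : c * mult k0 = 1.
Hypothesis k0_uniq : forall k, k != k0 -> c * mult k != 1.
Hypothesis K1 : forall x, torus_conv L K (fun=> 1) x = W0.

Local Notation F1 := (increment_rest Phi B W0 Lam als Mst).
Local Notation F2 := (state_residual Phi B W0 Lam als Mst).
Local Notation cs := (crossing_speed Phi B W0 Lam als Mst).
Local Notation sl := (slope Phi B W0 Lam als Mst).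
Local Notation I := (option (option T)).
Local Notation Al := (root_ als).
Local Notation MT := (newton_state Phi B W0 Lam als Mst).

Let cs0 : 0 < cs.
Proof. exact: crossing_speed_gt0. Qed.

Let c0 : 0 < c.
Proof. exact: (dresp_base_gt0 (als := als)). Qed.

Lemma bounded_linearW (c1 c2 : R) (O : (T -> R) -> T -> R) : c1 <= c2 ->
  bounded_linear even_periodic c1 O -> bounded_linear even_periodic c2 O.
Proof.
move=> cc Ob z D D0 gz zD; have [h1 h2 h3] := Ob z D D0 gz zD; split => //.
by move=> x; rewrite (le_trans (h2 x))// ler_wpM2r.
Qed.

Lemma bounded_linearD (c1 c2 : R) (O P : (T -> R) -> T -> R) :
  bounded_linear even_periodic c1 O -> bounded_linear even_periodic c2 P ->
  bounded_linear even_periodic (c1 + c2) (fun f x => O f x + P f x).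
Proof.
move=> Ob Pb z D D0 gz zD; have [h1 h2 h3] := Ob z D D0 gz zD.
have [h4 h5 h6] := Pb z D D0 gz zD; split.
- by have := even_lin 1 h1 h4; congr (even_periodic _); apply/funext => x; rewrite mul1r.
- by move=> x; rewrite (le_trans (ler_normD _ _))// mulrDl lerD.
- by move=> k z' gz' z'D x; rewrite h3// h6//; ring.
Qed.

Lemma bounded_linearZ (c1 k : R) (O : (T -> R) -> T -> R) : 0 <= k ->
  bounded_linear even_periodic c1 O -> bounded_linear even_periodic (k * c1) (fun f x => k * O f x).
Proof.
move=> k00 Ob z D D0 gz zD; have [h1 h2 h3] := Ob z D D0 gz zD; split.
- exact: even_scale.
- by move=> x; rewrite normrM ger0_norm// -mulrA ler_wpM2l.
- by move=> t z' gz' z'D x; rewrite h3//; ring.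
Qed.

Lemma branch : exists (e K2 : R) (y y' : R -> I -> R) (S : seq multi),
  let w s x := y s (Some (Some x)) in
  let nu s x := F1 (pt s (y s) x) - cs * om k0 x * y s None in
  [/\ 0 < e <= 1, 0 <= K2, y 0 = baseY (om k0),
   forall s, `|s| <= e -> [/\ [/\ even_periodic (w s), bounded_by (y s) K2,
       even_periodic (fun x => y' s (Some (Some x))) & bounded_by (y' s) K2],
     even_periodic (nu s) /\ bounded_by (nu s) K2,
     [/\ y s None = - (cs^-1 * ip mu (nu s) (om k0)), y s (Some None) = F2 (pt0 s (y s)),
       ip mu (w s) (om k0) = 1 &
       forall x, w s x = torus_conv L K (fun x => nu s x + (c * w s x + cs * y s None * om k0 x)) x] &
     forall x, 0 < Al (pt s (y s) x) /\
       s * (w s x * int01 (fun t => dresp (Al (pt s (y s) x)) (MT (pt s (y s) x) + t * (s * w s x)))) =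
       resp (Al (pt s (y s) x)) (MT (pt s (y s) x) + s * w s x) -
       resp (Al (pt s (y s) x)) (MT (pt s (y s) x))] &
   forall s s' i, `|s| <= e -> `|s'| <= e ->
    `|y s' i - y s i - (s' - s) * y' s i| <= K2 * (s' - s) ^+ 2 /\
    `|y' s' i - y' s i| <= K2 * `|s' - s|].
Proof.
pose ob := omega_bound L k0; have ob0 : 0 < ob := omega_bound_gt0 L0 k0.
have omb : bounded_by (om k0) ob := @omega_bounded R d L L0 k0.
(* Room for |om| + delta <= b with delta <= 1. *)
pose b := ob + 1; have b0 : 0 <= b by rewrite addr_ge0// ltW.
have [delta [g1 [g2 [/andP[de0 de1] f1C f2C gE FTC]]]] :=
  local_response Phi_incr Phi_neg W00 Lam0 Phi_C3 als0 MstE a0 b0 dPhi0.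
(* [small_op] carries a factor c, so this tolerance gives it norm at most 1/4. *)
have e00 : 0 < (4 * c)^-1 by rewrite invr_gt0 mulr_gt0.
have [S [US kS Se]] := conv_truncation L0 Ks Kg [:: k0] e00.
have k0S : k0 \in S by apply: kS; rewrite mem_head.
pose A := resolvent_op L K S c k0; pose E := small_op L K S c.
have Rb := residual_blin L0 Ks Kg Se.
have [cA cA0 FRb] := finite_rank_blin L0 (resolvent_coef L K c k0) S.
have Ab : bounded_linear even_periodic (cA + (4 * c)^-1) A := bounded_linearD FRb Rb.
have Eb : bounded_linear even_periodic 4^-1 E.
  have := bounded_linearZ (ltW c0) Rb; congr (bounded_linear _ _ _).
  by field; rewrite gt_eqF.
have [C1 f1C'] := f1C; have [C2 f2C'] := f2C.
have C10 : 0 <= C1 by have [] := f1C'.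
have C20 : 0 <= C2 by have [] := f2C'.
pose m := fine (mu setT); have m0 : 0 <= m by rewrite fine_ge0.
pose ce := cs^-1 * (ob * m); have ce0 : 0 <= ce.
  by apply: mulr_ge0; [rewrite invr_ge0 ltW|apply: mulr_ge0 => //; exact: ltW].
pose cob := cs * ob; have cob0 : 0 <= cob by apply: mulr_ge0; exact: ltW.
pose C := 1 + C1 + C2 + (cA + (4 * c)^-1) + ce + cob + ob.
have e01 := ltW e00; have ob1 := ltW ob0.
have [CC1 CC2 CC3 CC4] : [/\ 1 <= C, C1 <= C, C2 <= C & cA + (4 * c)^-1 <= C].
  by rewrite /C; move: e01; set v := (4 * c)^-1 => v0; split; lra.
have [CC5 CC6 CC7] : [/\ ce <= C, cob <= C & ob <= C].
  by rewrite /C; move: e01; set v := (4 * c)^-1 => v0; split; lra.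
have og := even_periodic_omega L0 k0.
have om_b x : `|om k0 x| + delta <= b by rewrite lerD.
have com_C x : `|cs * om k0 x| <= C.
  rewrite normrM gtr0_norm// (le_trans _ CC6)//; apply: ler_wpM2l; last exact: omb.
  exact: ltW.
have f1CC := C11_withW (@vnorm_ge0 R) CC2 f1C'.
have f2CC := C11_withW (@vnorm_ge0 R) CC3 f2C'.
have Eom x : E (om k0) x = 0.
  by rewrite /E /small_op (residual_omega L0 Ks Kg US x k0S) mulr0.
have ell_le f D : 0 <= D -> even_periodic f -> bounded_by f D -> `|cs^-1 * ip mu f (om k0)| <= C * D.
  move=> D0 [mf _ _] fD; have [mo _ _] := og.
  have h := ip_bounded mu mf mo fD omb.
  rewrite normrM gtr0_norm ?invr_gt0//.
  apply: (@le_trans _ _ (ce * D)); last by apply: ler_wpM2r.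
  have -> : ce * D = cs^-1 * (D * ob * m) by rewrite /ce; ring.
  by apply: ler_wpM2l => //; rewrite invr_ge0 ltW.
have ell_lin k f f' D : 0 <= D -> even_periodic f -> even_periodic f' -> bounded_by f D -> bounded_by f' D ->
    ip mu (fun x => k * f x + f' x) (om k0) = k * ip mu f (om k0) + ip mu f' (om k0).
  move=> D0 gf gf' fD f'D; have fs := even_sqint gf fD; have fs' := even_sqint gf' f'D.
  rewrite ipDl//; [|exact: sqintZ|exact: omega_sqint].
  by rewrite ipZl//; exact: omega_sqint.
have [e [q [ee0 q0 qd eq_ [y [y' [KK [KK0 yP yU yE]]]]]]] :=
  nemytskii_curve (G := even_periodic) (@even_lim R d L) (@even_lin R d L) (@even_mul R d L)
  (@even_comp R d L) de0 de1 CC1 b0 f1CC f2CC (fun w _ => increment_rest_base MstE w)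
  (state_residual_base MstE 0) (fun w ha hn hw _ => (gE w ha hn hw).1) (fun ha hn => (gE 0 ha hn 0).2)
  og om_b (fun x => le_trans (omb x) CC7) com_C (bounded_linearW CC4 Ab) Eb Eom ell_le ell_lin.
have nb s : `|s| <= e -> near1 (fun y : I -> R => even_periodic (fun x => y (Some (Some x)))) (baseY (om k0)) delta s (y s).
  move=> se; have [[h1 h2 h3] _ _ _] := yP s se; split => //.
    by rewrite (le_trans h1)// (le_trans eq_).
  by move=> i; exact: le_trans (h3 i) qd.
(* At s = 0 the base point is a fixed point, [increment_rest] and [state_residual] being 0 there;
   uniqueness identifies it with y 0. *)
have y0E : baseY (om k0) = y 0.
  have n0 : nuY F1 F2 (om k0) cs 0 (baseY (om k0)) = fun=> 0.
    apply/funext => -[[x|]|] //=; last exact: (state_residual_base MstE).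
    by rewrite mulr0 subr0; exact: (increment_rest_base MstE).
  apply: yU.
    split; [by rewrite normr0 ltW|exact: og|].
    by move=> i; rewrite subrr normr0 ltW.
  have zb : bounded_by (fun _ : T => 0 : R) 0 by move=> x; rewrite normr0.
  have zg : even_periodic (fun=> 0).
    have := even_scale 0 og; rewrite (_ : (fun x => 0 * om k0 x) = fun=> 0)//.
    by apply/funext => x; rewrite mul0r.
  move=> [[x|]|]; rewrite n0 /=.
  - rewrite -/E Eom addr0; have [_ h _] := Ab _ 0 (lexx 0) zg zb.
    by have := h x; rewrite mulr0 normr_le0 => /eqP; rewrite -/A => ->; rewrite addr0.
  - by rewrite !addr0.
  - by rewrite ip0l mulr0 oppr0 !addr0.
pose K2 := KK + (q + ob) + 12 * C.
have C0 : 0 <= C := le_trans ler01 CC1.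
have [K20 KK2 qK2 CK2] : [/\ 0 <= K2, KK <= K2, q + ob <= K2 & 12 * C <= K2].
  by rewrite /K2; move: (ltW q0); split; lra.
exists e, K2, y, y', S; split => //.
- by rewrite ee0 (le_trans eq_)// (le_trans qd).
- move=> s se; have [n1 fixE gy' by'] := yP s se; have nbs := nb s se.
  have [_ gw yq] := n1.
  have [gnu bnu] := nuY_good (@even_lin R d L) (@even_comp R d L) de1 CC1 b0 f1CC f2CC og om_b com_C nbs.
  have bnu' : bounded_by (fun x => F1 (pt s (y s) x) - cs * om k0 x * y s None) K2.
    by move=> x; rewrite (le_trans (bnu (Some (Some x))))//.
  have by_ : bounded_by (y s) K2.
    move=> i; rewrite (le_trans _ qK2)// -(subrK (baseY (om k0) i) (y s i)).
    rewrite (le_trans (ler_normD _ _))// lerD//.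
    by case: i => [[x|]|] /=; rewrite ?normr0//; exact: omb.
  have hN := fixE None; have hS := fixE (Some None).
  rewrite /= add0r !addr0 in hN; rewrite /= add0r addr0 in hS.
  have bw : bounded_by (fun x => y s (Some (Some x))) K2 by move=> x; exact: by_.
  have [w1 wE] := @lyapunov_schmidt R d L L0 K Ks Kg S _ c k0 US k0S Se k0_res k0_uniq
    (fun x => F1 (pt s (y s) x) - cs * om k0 x * y s None) (fun x => y s (Some (Some x)))
    _ K2 (y s None) cs K20 (lt0r_neq0 cs0) gnu bnu' gw bw (esym hN)
    (fun x => esym (fixE (Some (Some x)))) (fun x => erefl).
  split => //.
  + split => //; first by move=> i; exact: le_trans (by' i) KK2.
  + move=> x; exact: (FTC _ (pt_box om_b x nbs)).
- move=> s s' i se s'e; have [h1 h2] := yE s s' i se s'e; split.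
    by rewrite (le_trans h1)// ler_wpM2r// sqr_ge0.
  by rewrite (le_trans h2)// ler_wpM2r.
Qed.
(** Undoes the division by s, with u s = ms s + s w s. Two facts will separate this curve from the
    homogeneous one: the unit component of w s along [omega k0], and u' 0, which is a constant plus
    w 0 = omega k0. *)
Lemma solution_curve : exists (e : R) (u u' : R -> T -> R) (al al' ms : R -> R) (w : R -> T -> R),
  [/\ 0 < e, C1_L2S L e u u', C11_scalar [set s | `|s| <= e] al al',
    [/\ al 0 = als, u 0 = (fun=> Mst) & exists v, forall x, u' 0 x = v + om k0 x] &
    forall s, `|s| < e -> [/\ 0 < al s /\ ms s = W0 * resp (al s) (ms s), L2S L (u s),
      exists D, even_periodic (fun x => resp (al s) (u s x)) /\ bounded_by (fun x => resp (al s) (u s x)) D,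
      forall x, u s x = torus_conv L K (fun y => resp (al s) (u s y)) x &
      [/\ forall x, u s x = ms s + s * w s x, ip mu (w s) (om k0) = 1 & sqint mu (w s)]]].
Proof.
have [e [K2 [y [y' [S [/andP[e0 e1] K20 y0E yP yE]]]]]] := branch.
pose w s x := y s (Some (Some x)).
pose ms s := Mst + (sl * y s None + y s (Some None)).
pose ms' s := sl * y' s None + y' s (Some None).
pose al s := als + y s None.
pose u s (x : T) := ms s + s * w s x.
pose u' s (x : T) := ms' s + (w s x + s * y' s (Some (Some x))).
pose KK := (`|sl| + 6) * K2 + `|Mst|.
have sl0 := normr_ge0 sl; have M0 := normr_ge0 Mst.
have KK0 : 0 <= KK by rewrite addr_ge0// mulr_ge0// addr_ge0.
have slK : 0 <= `|sl| * K2 by rewrite mulr_ge0.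
have constg (v : R) : even_periodic (fun=> v).
  have := even_scale v (@even_periodic_cosprod R d L L0 [ffun=> 0%N]); rewrite (_ : (fun x => _) = fun=> v)//.
  by apply/funext => x; rewrite cosprod0 mulr1.
have ms_b s : `|s| <= e -> `|ms s| <= `|Mst| + (`|sl| + 1) * K2.
  move=> se; have [[_ by_ _ _] _ _ _] := yP s se.
  rewrite (le_trans (ler_normD _ _))// lerD2l (le_trans (ler_normD _ _))// mulrDl mul1r normrM.
  by apply: lerD; [exact: ler_wpM2l|exact: by_].
have ms'_b s : `|s| <= e -> `|ms' s| <= (`|sl| + 1) * K2.
  move=> se; have [[_ _ _ by_] _ _ _] := yP s se.
  rewrite (le_trans (ler_normD _ _))// mulrDl mul1r normrM.
  by apply: lerD; [exact: ler_wpM2l|exact: by_].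
have sK s t : `|s| <= e -> `|t| <= K2 -> `|s * t| <= K2.
  move=> se tK; rewrite normrM (le_trans (ler_pM _ _ (le_trans se e1) tK))// mul1r.
  by [].
have ug s : `|s| <= e -> even_periodic (u s) /\ bounded_by (u s) KK.
  move=> se; have [[gw by_ _ _] _ _ _] := yP s se; split.
    by have := even_lin s gw (constg (ms s)); rewrite (_ : (fun x => _) = u s)//; apply/funext => x; rewrite /u addrC.
  move=> x; rewrite (le_trans (ler_normD _ _))//.
  have h1 := ms_b s se; have h2 := sK _ _ se (by_ (Some (Some x))).
  by rewrite (le_trans (lerD h1 h2))// /KK; lra.
have u'g s : `|s| <= e -> even_periodic (u' s) /\ bounded_by (u' s) KK.
  move=> se; have [[gw by_ gw' by'] _ _ _] := yP s se; split.
    have := even_lin 1 gw (even_lin s gw' (constg (ms' s))); rewrite (_ : (fun x => _) = u' s)//.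
    by apply/funext => x; rewrite /u' /w /= mul1r [RHS]addrC addrA.
  move=> x; rewrite (le_trans (ler_normD _ _))//.
  have h1 := ms'_b s se; have h2 := sK _ _ se (by' (Some (Some x))).
  have h3 : `|w s x + s * y' s (Some (Some x))| <= K2 + K2.
    by rewrite (le_trans (ler_normD _ _))// lerD//; exact: by_.
  by rewrite (le_trans (lerD h1 h3))// /KK; lra.
have uE s s' x : `|s| <= e -> `|s'| <= e ->
    `|u s' x - u s x - (s' - s) * u' s x| <= KK * (s' - s) ^+ 2 /\
    `|u' s' x - u' s x| <= KK * `|s' - s|.
  move=> se s'e; have [[_ by_ _ by'] _ _ _] := yP s se.
  set h := s' - s; have [n1 n1'] := yE s s' None se s'e.
  have [n2 n2'] := yE s s' (Some None) se s'e.
  have [n3 n3'] := yE s s' (Some (Some x)) se s'e; rewrite -/h in n1 n1' n2 n2' n3 n3'.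
  have h0 := sqr_ge0 h; have h1 := normr_ge0 h.
  have h2 : h ^+ 2 = `|h| * `|h| by rewrite -expr2 real_normK// num_real.
  have hh : `|h| <= 2 by rewrite (le_trans (ler_normB _ _))//; lra.
  have hK : 0 <= K2 * `|h| by rewrite mulr_ge0.
  have hK2 : 0 <= K2 * h ^+ 2 by rewrite mulr_ge0.
  have s1 := le_trans s'e e1.
  split.
  - have -> : u s' x - u s x - h * u' s x =
      sl * (y s' None - y s None - h * y' s None) +
      ((y s' (Some None) - y s (Some None) - h * y' s (Some None)) +
       (s' * (w s' x - w s x - h * y' s (Some (Some x))) + h ^+ 2 * y' s (Some (Some x)))).
      by rewrite /u /u' /ms /ms' /h; ring.
    have t1 : `|sl * (y s' None - y s None - h * y' s None)| <= `|sl| * (K2 * h ^+ 2).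
      by rewrite normrM ler_wpM2l.
    have t3 : `|s' * (w s' x - w s x - h * y' s (Some (Some x)))| <= K2 * h ^+ 2.
      by rewrite normrM (le_trans (ler_pM _ _ s1 n3))// mul1r.
    have t4 : `|h ^+ 2 * y' s (Some (Some x))| <= K2 * h ^+ 2.
      by rewrite normrM ger0_norm// mulrC ler_wpM2r//; exact: by'.
    rewrite (le_trans (ler_normD _ _))// (le_trans (lerD t1 (le_trans (ler_normD _ _)
      (lerD n2 (le_trans (ler_normD _ _) (lerD t3 t4))))))//.
    by rewrite /KK; have := mulr_ge0 M0 h0; lra.
  - have -> : u' s' x - u' s x =
      sl * (y' s' None - y' s None) + ((y' s' (Some None) - y' s (Some None)) +
       ((w s' x - w s x - h * y' s (Some (Some x))) + (h * y' s (Some (Some x)) +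
        (s' * (y' s' (Some (Some x)) - y' s (Some (Some x))) + h * y' s (Some (Some x)))))).
      by rewrite /u' /ms' /h; ring.
    have t1 : `|sl * (y' s' None - y' s None)| <= `|sl| * (K2 * `|h|).
      by rewrite normrM ler_wpM2l.
    have t3 : `|w s' x - w s x - h * y' s (Some (Some x))| <= 2 * (K2 * `|h|).
      rewrite (le_trans n3)// h2 mulrA; have := ler_wpM2l hK hh; lra.
    have t4 : `|h * y' s (Some (Some x))| <= K2 * `|h|.
      by rewrite normrM mulrC ler_wpM2r//; exact: by'.
    have t5 : `|s' * (y' s' (Some (Some x)) - y' s (Some (Some x)))| <= K2 * `|h|.
      by rewrite normrM (le_trans (ler_pM _ _ s1 n3'))// mul1r.
    have t6 := le_trans (ler_normD _ _) (lerD t5 t4).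
    have t7 := le_trans (ler_normD _ _) (lerD t4 t6).
    have t8 := le_trans (ler_normD _ _) (lerD t3 t7).
    have t9 := le_trans (ler_normD _ _) (lerD n2' t8).
    rewrite (le_trans (le_trans (ler_normD _ _) (lerD t1 t9)))//.
    by rewrite /KK; have := mulr_ge0 M0 h1; lra.
have alE : C11_scalar [set s | `|s| <= e] al (fun s => y' s None).
  have A0 := normr_ge0 als; set CA := 3 * (`|als| + K2).
  have [KA KA3 KA4] : [/\ K2 <= CA, 3 * K2 <= CA & `|als| + K2 <= CA].
    by rewrite /CA; split; lra.
  exists CA; split.
  - by rewrite /CA mulr_ge0// addr_ge0.
  - by move=> p k h h' _; rewrite /GRing.scale/=; ring.
  - move=> p pe; have [[_ by_ _ by'] _ _ _] := yP p pe; split.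
      by rewrite (le_trans _ KA4)// (le_trans (ler_normD _ _))// lerD2l; exact: by_.
    by move=> h; rewrite normrM ler_wpM2r// (le_trans _ KA)//; exact: by'.
  - move=> p p' /= pe p'e; have [n1 n1'] := yE p p' None pe p'e.
    have [[_ _ _ by'] _ _ _] := yP p pe.
    have dE : al p' - al p = y p' None - y p None by rewrite /al; ring.
    have h1 := normr_ge0 (p' - p); have h2 := sqr_ge0 (p' - p).
    have h3 : (p' - p) ^+ 2 = `|p' - p| * `|p' - p| by rewrite -expr2 real_normK// num_real.
    have hh : `|p' - p| <= 2 by rewrite (le_trans (ler_normB _ _))//; lra.
    rewrite dE; split.
    + rewrite -(subrK ((p' - p) * y' p None) (y p' None - y p None)).
      have t1 : `|(p' - p) * y' p None| <= K2 * `|p' - p|.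
        by rewrite normrM mulrC ler_wpM2r//; exact: by'.
      rewrite (le_trans (ler_normD _ _))// (le_trans (lerD n1 t1))//.
      apply: (@le_trans _ _ (3 * K2 * `|p' - p|)); last by rewrite ler_wpM2r.
      by rewrite h3 mulrA; have := ler_wpM2l (mulr_ge0 K20 h1) hh; lra.
    + by rewrite [y' p None * _]mulrC (le_trans n1)// real_normK ?num_real// ler_wpM2r.
    + move=> h; rewrite -mulrBl normrM ler_wpM2r// (le_trans n1')// ler_wpM2r//.
exists e, u, u', al, (fun s => y' s None), ms, w; split => //.
- exact: (curve_C1 KK0 ug u'g uE).
- split.
  + by rewrite /al y0E addr0.
  + by apply/funext => x; rewrite /u /ms y0E /= mul0r mulr0 !addr0.
  + exists (ms' 0) => x; rewrite /u' mul0r addr0 /w y0E.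
    by [].
- move=> s /ltW se; have [[gw by_ gw' by'] [gn bn] [E1 E2 E3 E4] E5] := yP s se.
  have [us1 us2] := ug s se.
  pose p x := pt s (y s) x.
  have mE x : state_ Phi B W0 Lam als Mst (p x) = ms s by [].
  have aE x : Al (p x) = al s by [].
  (* The equation of the second component: the Newton step fixes the guess, which is therefore the
     exact homogeneous state for al s. *)
  have ME x : MT (p x) = ms s.
    rewrite /ms E2 /state_residual -[newton_state _ _ _ _ _ _ (pt0 s (y s))]/(MT (p x)) /=; ring.
  have fixed : ms s = W0 * resp (al s) (ms s).
    have := @newton_state_fixed R Phi B W0 Lam als Mst Phi_incr Phi_neg W00 Lam0 als0 a0 dPhi0 (p 0).
    by rewrite !mE aE; apply; exact: ME.
  pose n x := F1 (p x) - cs * om k0 x * y s None + (c * w s x + cs * y s None * om k0 x).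
  have nE x : n x = w s x * int01 (fun t => dresp (al s) (ms s + t * (s * w s x))).
    rewrite /n /increment_rest -/(w s x); have -> : (p x).2.2.2 = w s x by [].
    have -> : (p x).1 = s by [].
    rewrite aE; have -> : (fun t => dresp (al s) (MT (p x) + t * (s * w s x))) =
      fun t => dresp (al s) (ms s + t * (s * w s x)) by apply/funext => t; rewrite ME.
    by ring.
  have rE x : resp (al s) (u s x) = s * n x + resp (al s) (ms s).
    have [_] := E5 x; rewrite -/(p x) aE.
    have -> : (fun t => dresp (al s) (MT (p x) + t * (s * y s (Some (Some x))))) =
      fun t => dresp (al s) (ms s + t * (s * w s x)) by apply/funext => t; rewrite ME.
    rewrite ME -/(w s x) -nE => ->; rewrite /u subrK//.
  have bnn : exists D, bounded_by n D.
    exists (K2 + (`|c| * K2 + `|cs * y s None| * omega_bound L k0)) => x.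
    rewrite (le_trans (ler_normD _ _))// lerD//.
    rewrite (le_trans (ler_normD _ _))// (normrM c) (normrM (cs * _)) lerD//.
      by apply: ler_wpM2l => //; exact: by_.
    by apply: ler_wpM2l => //; exact: (@omega_bounded R d L L0 k0).
  have gnn : even_periodic n.
    have g1 := even_lin c gw (even_scale (cs * y s None) (even_periodic_omega L0 k0)).
    by have := even_lin 1 gn g1; rewrite (_ : (fun x => _) = n)//; apply/funext => x; rewrite mul1r.
  have [D nD] := bnn; have ns := even_sqint gnn nD.
  have rfE : (fun x => resp (al s) (u s x)) = fun x => s * n x + resp (al s) (ms s).
    by apply/funext.
  split.
  + by have [al0 _] := E5 0; split.
  + exact: even_periodic_L2S us1 us2.
  + exists (`|s| * D + `|resp (al s) (ms s)|); rewrite rfE; split; first exact: even_lin.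
    by move=> x; rewrite (le_trans (ler_normD _ _))// lerD// normrM ler_wpM2l.
  + move=> x; rewrite rfE.
    (* A constant put in the form a * f + g handled by [conv_lin], so that K1 applies to the
       function 1. *)
    have cst1 : (fun _ : T => resp (al s) (ms s)) = fun x => (resp (al s) (ms s) - 1) * 1 + 1.
      by apply/funext => z; rewrite mulr1 subrK.
    rewrite (conv_lin L0 Ks Kg s ns (even_sqint (constg _) (fun=> lexx _))) -E4 cst1.
    rewrite (conv_lin L0 Ks Kg _ (sqint1 _) (sqint1 _)) !K1 -/(w s x) /u [in LHS]fixed.
    by ring.
  + by split => //; exact: even_sqint gw (fun x => by_ (Some (Some x))).
Qed.

End branch.

(** * Bifurcation *)

Section stationary_state.
Context (R : realType) (d : nat) (L : R) (W : 'rV[R]_d -> R) (Phi : R -> R) (B : R).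
Hypothesis L0 : 0 < L.
Hypothesis Phi_cont : continuous Phi.
Hypothesis Phi_incr : forall s t : R, 0 <= s -> s < t -> Phi s < Phi t.
Hypothesis Phi_neg : forall s : R, s <= 0 -> Phi s = 0.
Hypotheses (B0 : 0 < B) (W00 : W0 L W < 0).
Local Notation resp := (resp Phi B (L ^+ d)).

Lemma stat_avg_resp (kappa m : R) : 0 < kappa ->
  stat_avg d L kappa (Phi (m + B)) = resp (Num.sqrt kappa) m.
Proof. by move=> k0; rewrite stat_avgE. Qed.

(** Existence of a solution makes [xget] return one instead of its default value 0. *)
Lemma rho_inf_resp (kappa : R) : 0 < kappa ->
  rho_inf L W Phi B kappa = resp (Num.sqrt kappa) (W0 L W * rho_inf L W Phi B kappa).
Proof.
move=> k0; have al0 : 0 < Num.sqrt kappa by rewrite sqrtr_gt0.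
have Lam0 : 0 < L ^+ d by rewrite exprn_gt0.
have [m mE] := resp_fixed_exists Phi_cont Phi_incr Phi_neg B0 W00 Lam0 al0.
rewrite -stat_avg_resp// /rho_inf.
apply: (@xgetPex _ 0 [set y : R | y = stat_avg d L kappa (Phi (W0 L W * y + B))]).
by exists (resp (Num.sqrt kappa) m); rewrite /= stat_avg_resp// -mE.
Qed.

Lemma m_inf_unique (kappa m : R) : 0 < kappa ->
  m = W0 L W * resp (Num.sqrt kappa) m -> m_inf L W Phi B kappa = m.
Proof.
move=> k0 mE; have al0 : 0 < Num.sqrt kappa by rewrite sqrtr_gt0.
have Lam0 : 0 < L ^+ d by rewrite exprn_gt0.
apply: (resp_fixed_unique Phi_incr Phi_neg W00 Lam0 al0 _ mE).
by rewrite /m_inf -rho_inf_resp.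
Qed.

(** If the input were nonpositive, Phi would vanish and rho would be tmean 0 / (alpha L^d), of
    square 2 / (pi kappa L^(2d)). Then |W0| rho >= B bounds kappa from above by precisely the
    threshold assumed to lie below it. *)
Lemma active_input_gt0 (kappa : R) : 0 < kappa ->
  2 * `|W0 L W| ^+ 2 / (L ^+ (2 * d) * pi * B ^+ 2) < kappa ->
  0 < W0 L W * rho_inf L W Phi B kappa + B.
Proof.
move=> k0 kB; rewrite ltNge; apply/negP => a0.
set rho := rho_inf _ _ _ _ _ in a0.
have al0 : 0 < Num.sqrt kappa by rewrite sqrtr_gt0.
have Lam0 : 0 < L ^+ d by rewrite exprn_gt0.
have rE : rho = tmean 0 / (Num.sqrt kappa * L ^+ d).
  by rewrite /rho rho_inf_resp// /rho_inf -/rho /resp Phi_neg// mulr0.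
have r2 : rho ^+ 2 * (kappa * (L ^+ d) ^+ 2 * pi) = 2.
  rewrite rE exprMn exprVn exprMn sqr_sqrtr ?(ltW k0)// tmean0_sqr.
  have := @pi_gt0 R; move: (pi) k0 Lam0 => p k0 l0 p0.
  by field; rewrite !gt_eqF.
have Br : B ^+ 2 <= (`|W0 L W| * rho) ^+ 2.
  have r0 : 0 <= rho by rewrite rE divr_ge0 ?mulr_ge0 ?(ltW al0) ?(ltW Lam0)// ltW// tmean_gt0.
  rewrite lerXn2r ?nnegrE ?(ltW B0) ?mulr_ge0// ltr0_norm//; lra.
have D0 : 0 < L ^+ (2 * d) * pi * B ^+ 2 by rewrite !mulr_gt0 ?exprn_gt0 ?pi_gt0.
move: kB; rewrite ltr_pdivrMr// => kB.
have : kappa * (L ^+ (2 * d) * pi * B ^+ 2) <= 2 * `|W0 L W| ^+ 2.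
  rewrite -[X in _ <= X * _]r2 mulnC exprM.
  have p0 : 0 <= kappa * (L ^+ d) ^+ 2 * pi.
    by apply: mulr_ge0 (pi_ge0 R); apply: mulr_ge0 (ltW k0) (sqr_ge0 _).
  by have := ler_wpM2l p0 Br; rewrite exprMn; lra.
by rewrite leNgt kB.
Qed.

End stationary_state.

Theorem mainTheorem3 (R : realType) (d : nat) (L : R)
    (W : 'rV[R]_d -> R) (Phi : R -> R) (B : R) (r : 'I_4 -> 'rV[R]_d)
    (kappa : R) :
  (0 < d)%N -> 0 < L ->
  (exists2 m : nat, (d < 2 * m)%N & HmS L m W) ->
  continuous Phi ->
  class_C 3 Phi [set s | s != 0] ->
  (forall s t, 0 <= s -> s < t -> Phi s < Phi t) ->
  (forall s, s <= 0 -> Phi s = 0) ->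
  0 < B ->
  W0 L W < 0 ->
  coordinatewise_even L r ->
  2 * `|W0 L W| ^+ 2 / (L ^+ (2 * d) * pi * B ^+ 2) < kappa ->
  let rho := rho_inf L W Phi B kappa in
  let a := W0 L W * rho + B in
  let Phi0 := Phi a in
  let Phi0' := (Phi^`())%classic a in
  let Phi0'' := (Phi^`(2))%classic a in
  let den := L `^ (d%:R / 2) * Phi0' *
    (1 / L ^+ d - L ^+ d * rho * (rho - Phi0 / L ^+ d) * kappa) in
  (* the right-hand side 1 / den of the equation below is defined *)
  den != 0 ->
  (exists! k : {ffun 'I_d -> nat},
    cos_coef L W k / Theta R k *
      (4^-1 * \sum_(b < 4) \prod_i
        cos (2 * pi * (k i)%:R / L * r b ord0 i)) = 1 / den) ->
  0 <= Phi0'' ->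
  bifurcation_point L W Phi B r (fun _ => W0 L W * rho) kappa.
Proof.
move=> _ L0 [_ _ [_ WS]] Phi_cont Phi_C3 Phi_incr Phi_neg B0 W00 re kB rho a Phi0 Phi0' Phi0'' den den0 kU P20.
have Lam0 : 0 < L ^+ d by rewrite exprn_gt0.
have k0 : 0 < kappa.
  apply: (le_lt_trans _ kB); apply: divr_ge0; first by rewrite mulr_ge0// sqr_ge0.
  by rewrite !mulr_ge0 ?pi_ge0 ?exprn_ge0// ltW.
pose als := Num.sqrt kappa; have als0 : 0 < als by rewrite /als sqrtr_gt0; exact: k0.
have als2 : als ^+ 2 = kappa by rewrite /als sqr_sqrtr// ltW.
have a0 : 0 < a := active_input_gt0 L0 Phi_cont Phi_incr Phi_neg B0 W00 k0 kB.
pose Mst := W0 L W * rho.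
have rhoE : rho = resp Phi B (L ^+ d) als Mst := rho_inf_resp L0 Phi_cont Phi_incr Phi_neg B0 W00 k0.
have MstE : Mst = W0 L W * resp Phi B (L ^+ d) als Mst by rewrite -rhoE.
pose c := dresp Phi B (L ^+ d) als Mst.
have l0 : 0 < L `^ (d%:R / 2) := Ld_gt0 d L0.
(* With kappa = alpha^2 and rho = tmean / (alpha L^d), the bracket in [den] is the variance [dtmean]
   divided by L^d. *)
have denE : den = L `^ (d%:R / 2) * c.
  rewrite /den /c /dresp -/a -/Phi0 -/Phi0' -als2 rhoE /resp -/a -/Phi0 /dtmean.
  move: (tmean _) (L `^ _) => tm l; field.
  by rewrite !gt_eqF.
have dPhi0 : Phi0' != 0.
  by apply: contraNneq den0 => e; rewrite /den e mulr0 mul0r.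
(* Monotonicity gives a nonnegative derivative, and den != 0 excludes the value 0. *)
have dPhi_gt0 : 0 < (Phi^`(1))%classic (Mst + B).
  rewrite derive1n1 lt_neqAle eq_sym dPhi0/=.
  have Phi_d : {in `]0 : R, +oo[%classic, forall x : R, derivable Phi x 1}.
    move=> x; rewrite inE/= in_itv/= andbT => x0.
    by have [] := @Phi_is_derive R Phi Phi_C3 0 x isT (lt0r_neq0 x0).
  have Phi_i : {in `[0 : R, +oo[ &, {homo Phi : x y / x < y}}.
    by move=> x y; rewrite !in_itv/= !andbT => x0 _; exact: Phi_incr.
  by apply: (incr_derive1_ge0_itvy Phi_d Phi_i); rewrite in_itv/= andbT.
have c0 : 0 < c by exact: (dresp_base_gt0 (als := als)).
pose K := model_kernel L W r.
have Ks : sqint (torus_measure L d) K := model_kernel_sqint L0 r WS.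
have Kg : even_periodic L K := even_periodic_model_kernel L0 WS re.
have resE k : c * multiplier L K k = 1 <->
    cos_coef L W k / Theta R k * (4^-1 * \sum_(b < 4) \prod_i
        cos (2 * pi * (k i)%:R / L * r b ord0 i)) = 1 / den.
  rewrite (multiplier_model_kernel L0 _ WS) denE -/(cosprod L k _).
  set X := cos_coef _ _ _ / _ * _; rewrite -[X in _ <-> X = _]/X; split => [e|->].
    apply: (mulfI (lt0r_neq0 c0)); apply: (mulfI (lt0r_neq0 l0)).
    rewrite mulrCA e; by field; rewrite !gt_eqF.
  by field; rewrite !gt_eqF.
have [k1 [/resE k1_res k1_uniq]] := kU.
have k1U k : k != k1 -> c * multiplier L K k != 1.
  by apply: contraNneq => /resE /k1_uniq ->.
have K1 x : torus_conv L K (fun=> 1) x = W0 L W by exact: conv_model_kernel1.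
have [e [u [u' [al [al' [ms [w [e0 uC alC [al0 u0 [v vE]] sol]]]]]]]] :=
  solution_curve L0 Ks Kg Phi_incr Phi_neg W00 Lam0 Phi_C3 als0 MstE a0 dPhi_gt0 P20 k1_res k1U K1.
have oms k : sqint (torus_measure L d) (omega L k) by exact: omega_sqint.
have minf s : `|s| < e -> m_inf L W Phi B (al s ^+ 2) = ms s.
  move=> se; have [[als_ msE] _ _ _ _] := sol s se.
  apply: m_inf_unique => //; first by rewrite exprn_gt0.
  by rewrite sqrtr_sqr gtr0_norm.
pose z0 : {ffun 'I_d -> nat} := [ffun=> 0%N].
pose v0 : R := Theta R z0 / L `^ (d%:R / 2).
have v0_gt0 : 0 < v0 by rewrite divr_gt0 ?Theta_gt0.
have omz : omega L z0 = fun=> v0.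
  by apply/funext => x; rewrite omegaE cosprod0 mulr1.
have ip1 k : ip (torus_measure L d) (fun=> v0 * 1) (omega L k) = (z0 == k)%:R.
  by rewrite mulr1 -omz ip_omega.
(* On constants the multiplier is W0 < 0, and c > 0, so their product cannot be 1: the critical mode
   is not the constant one. *)
have k1z : z0 != k1.
  apply/eqP => e1; have cg : even_periodic L (fun _ : 'rV[R]_d => 1 : R).
    have := even_periodic_cosprod L0 z0; rewrite (_ : cosprod L z0 = fun=> 1)//.
    by apply/funext => x; rewrite cosprod0.
  have c1 : bounded_by (fun _ : 'rV[R]_d => 1 : R) 1 by move=> x; rewrite normr1.
  have := ip_conv L0 Ks Kg z0 ler01 cg c1.
  have -> : torus_conv L K (fun=> 1) = fun x => W0 L W * (fun=> 1) x.
    by apply/funext => x; rewrite K1 mulr1.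
  rewrite (ipZl _ (sqint1 _) (oms z0)).
  have := ip1 z0; rewrite eqxx (ipZl _ (sqint1 _) (oms z0)) => h.
  have h0 : ip (torus_measure L d) (fun=> 1) (omega L z0) != 0.
    by apply/eqP => e2; move: h; rewrite e2 mulr0 => /eqP; rewrite eq_sym oner_eq0.
  move/(mulIf h0) => h1; have := k1_res; rewrite -e1 -h1 => h2.
  by have := W00; rewrite -(pmulr_rlt0 _ c0) h2 ltNge ler01.
split => //.
- apply: nearW => x; rewrite /m_inf -/rho; reflexivity.
- exists e; split => //; exists u, u', (fun s => al s ^+ 2); split.
  + split => //; apply: (@C11_scalar_class_C R e _ (fun s => 2 * al s * al' s)).
    have := C11_mul (@normr_ge0 _ R) alC alC; apply: C11_ext => // s h _ /=; ring.
  + move=> s se; have [[al_gt0 msE] uL2 [D [rg rD]] uE _] := sol s se.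
    split; first by rewrite exprn_gt0.
    have lE : local_avg L Phi B (u s) (al s ^+ 2) = fun x => resp Phi B (L ^+ d) (al s) (u s x).
      apply/funext => x; rewrite /local_avg stat_avg_resp ?exprn_gt0//.
      by rewrite sqrtr_sqr gtr0_norm.
    split => //.
      by rewrite lE; exact: sqint_integrable (even_sqint rg rD).
    apply: nearW => x; rewrite /Q lE model_convolution//; last exact: even_sqint rg rD.
    by rewrite -uE subrr.
  + split; first by rewrite al0.
    by apply: nearW => x; rewrite u0.
  (* On the homogeneous curve s w s = 0, so w s = 0 almost everywhere, against its unit component
     along [omega k1]. *)
  + move=> s se s0 Hae; have [_ _ _ _ [uE w1 ws]] := sol s se.
    have w0 : ip (torus_measure L d) (w s) (omega L k1) = 0.
      rewrite -[RHS](ip0l (torus_measure L d) (omega L k1)) /ip.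
      have [mw _] := ws; have [mo _] := oms k1.
      apply: ae_eq_RintegralT; try exact: measurable_funM.
      apply: filterS Hae => x; rewrite minf// uE => h.
      have /eqP : s * w s x = 0 by apply: (addrI (ms s)); rewrite addr0.
      by rewrite mulf_eq0 (negbTE s0)/= => /eqP ->.
    by move: w1; rewrite w0 => /eqP; rewrite eq_sym oner_eq0.
  (* u' 0 is a constant plus [omega k1]. If it were constant, so would be [omega k1] almost
     everywhere, and being orthogonal to constants it would be orthogonal to itself. *)
  + set l1 := _ * _ => Hae; have [mo _] := oms k1.
    have : ip (torus_measure L d) (omega L k1) (omega L k1) = 0.
      transitivity (ip (torus_measure L d) (fun=> (l1 - v) / v0 * (v0 * 1)) (omega L k1)).
        apply: ae_eq_RintegralT; try exact: measurable_funM.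
        apply: filterS Hae => x; rewrite vE => h.
        by congr (_ * _); rewrite mulr1 divfK ?gt_eqF// -h addrC addKr.
      rewrite (ipZl _ (_ : sqint _ (fun=> v0 * 1)))// ?ip1 ?(negbTE k1z) ?mulr0//.
      by rewrite mulr1 -omz.
    by rewrite ip_omega// eqxx => /eqP; rewrite oner_eq0.
Qed.
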